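(* The set $\{\phi_\gamma(\cdot;a,b;q):\gamma\in -q^{\mathbb{N}}\cup q^{\mathbb{Z}}/abt\}$ is an orthogonal basis for $\mathcal{H}_t$, and for $\gamma,\lambda\in -q^{\mathbb{N}}\cup q^{\mathbb{Z}}/abt$ the orthogonality relations $$\int_{-1}^{\infty(t)}\phi_\gamma(x;a,b;q)\,\overline{\phi_\lambda(x;a,b;q)}\,w(x;a,b;q)\,d_qx=\delta_{\gamma,\lambda}\,H_\gamma(a,b;q)\,I(a,b;t)$$ hold, where $$H_\gamma(a,b;q)=\frac{(q,-a\gamma,-b\gamma;q)_\infty}{|\gamma|\,(a,b,-q\gamma;q)_\infty},\qquad I(a,b;t)=(1-q)\,t\,\frac{(q;q)_\infty}{(a,b;q)_\infty}\,\frac{\theta(-abt,-1/t)}{\theta(-at,-bt)}.$$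
   Context: Fix $0<q<1$; $\mathbb{N}=\{0,1,2,\dots\}$; $(x;q)_n=\prod_{k=0}^{n-1}(1-xq^k)$ for $n\in\mathbb{N}\cup\{\infty\}$, $(x_1,\dots,x_k;q)_n=\prod_j(x_j;q)_n$; $\theta(x)=(x,q/x;q)_\infty$, $\theta(x_1,\dots,x_k)=\prod_j\theta(x_j)$. Standing condition on the parameters: $t>0$ and one of the following holds: (i) $a=\bar b$ with $a\in\mathbb{C}\setminus\mathbb{R}$; (ii) $0<a<1$ and $0<b<1$; (iii) for some $k_0\in-\mathbb{N}$, $q^{k_0}<a<q^{k_0-1}$ and $q^{k_0}<b<q^{k_0-1}$; (iv) for some $k_0\in\mathbb{Z}$, $q^{k_0}<-at<q^{k_0-1}$ and $q^{k_0}<-bt<q^{k_0-1}$. Weight: $w(x)=w(x;a,b;q)=\frac{(-qx;q)_\infty}{(-ax,-bx;q)_\infty}$ (positive on $-q^{\mathbb{N}}\cup tq^{\mathbb{Z}}$). With $\int_{-1}^{\infty(t)}f(x)\,d_qx=(1-q)\sum_{k\ge0}f(-q^k)q^k+(1-q)\sum_{k\in\mathbb{Z}}f(tq^k)tq^k$, $\mathcal{H}_t$ is the Hilbert space of functions $f:-q^{\mathbb{N}}\cup tq^{\mathbb{Z}}\to\mathbb{C}$ with $\int_{-1}^{\infty(t)}|f(x)|^2w(x)\,d_qx<\infty$, with inner product $\langle f,g\rangle=\int_{-1}^{\infty(t)}f(x)\overline{g(x)}w(x)\,d_qx$. $q$-Meixner function: $\phi_\gamma(x)=\phi_\gamma(x;a,b;q)={}_2\varphi_2(-1/x,-1/\gamma;a,b;q,ab\gamma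 x)=\sum_{n\ge0}\frac{(-1/x,-1/\gamma;q)_n}{(q,a,b;q)_n}(-1)^nq^{n(n-1)/2}(ab\gamma x)^n$. *)

(* Defs.v *)
From HB Require Import structures.
From mathcomp Require Import all_boot all_order all_algebra.
From mathcomp Require Import all_classical all_reals all_analysis.
From mathcomp Require Import complex.

Set Implicit Arguments.
Unset Strict Implicit.
Unset Printing Implicit Defensive.

Import Order.TTheory GRing.Theory Num.Theory numFieldNormedType.Exports.

Local Open Scope classical_set_scope.
Local Open Scope ring_scope.

(* All scalars, including q and t, live in the complex field R[i].  Its order
   is partial: x < y means that y - x is real and positive, so hypotheses such
   as 0 < q < 1 or 0 < t also say that q and t are real. *)

(* R[i]^o is R[i] with the topology given by its modulus. *)
Definition csum_cvg (R : realType) (u : nat -> R[i]) : Prop :=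
  cvgn (series (u : nat -> R[i]^o)).

Definition csum (R : realType) (u : nat -> R[i]) : R[i] :=
  limn (series (u : nat -> R[i]^o)).

(* Negz k is - k.+1, so these are the sums over k >= 0 and over k < 0. *)
Definition zsum_cvg (R : realType) (u : int -> R[i]) : Prop :=
  csum_cvg (fun k => u (Posz k)) /\ csum_cvg (fun k => u (Negz k)).

Definition zsum (R : realType) (u : int -> R[i]) : R[i] :=
  csum (fun k => u (Posz k)) + csum (fun k => u (Negz k)).

(* (x_1, ..., x_k; q)_n and (x_1, ..., x_k; q)_oo, with s the list of the x_j *)
Definition qpoch (R : realType) (s : seq R[i]) (q : R[i]) (n : nat) : R[i] :=
  \prod_(x <- s) \prod_(k < n) (1 - x * q ^+ k).

Definition qpoch_inf (R : realType) (s : seq R[i]) (q : R[i]) : R[i] :=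
  \prod_(x <- s) limn (fun n => \prod_(k < n) (1 - x * q ^+ k) : R[i]^o).

Definition theta (R : realType) (q : R[i]) (s : seq R[i]) : R[i] :=
  \prod_(x <- s) qpoch_inf [:: x; q / x] q.

(* 2phi2(A, B; C, D; q, z) *)
Definition phi22 (R : realType) (A B C D q z : R[i]) : R[i] :=
  csum (fun n => qpoch [:: A; B] q n / qpoch [:: q; C; D] q n
                 * (-1) ^+ n * q ^+ 'C(n, 2) * z ^+ n).

Definition qMeixner (R : realType) (a b q gamma x : R[i]) : R[i] :=
  phi22 (-1 / x) (-1 / gamma) a b q (a * b * gamma * x).

Definition weight (R : realType) (a b q x : R[i]) : R[i] :=
  qpoch_inf [:: - q * x] q / qpoch_inf [:: - a * x; - b * x] q.

Definition parameters (R : realType) (a b q t : R[i]) : Prop :=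
  0 < t /\
  [\/ a = b^* /\ a \isn't Num.real,
      0 < a < 1 /\ 0 < b < 1,
      exists k0 : int, [/\ k0 <= 0, q ^ k0 < a < q ^ (k0 - 1)
                                  & q ^ k0 < b < q ^ (k0 - 1)]
    | exists k0 : int, q ^ k0 < - (a * t) < q ^ (k0 - 1) /\
                       q ^ k0 < - (b * t) < q ^ (k0 - 1)].

(* - q^NN `|` t q^ZZ *)
Definition qsupp (R : realType) (q t : R[i]) : set R[i] :=
  [set - q ^+ k | k in [set: nat]] `|` [set t * q ^ k | k in [set: int]].

Lemma qsupp_neg (R : realType) (q t : R[i]) (k : nat) : - q ^+ k \in qsupp q t.
Proof. by apply: mem_set; left; exists k. Qed.

Lemma qsupp_pos (R : realType) (q t : R[i]) (k : int) : t * q ^ k \in qsupp q t.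
Proof. by apply: mem_set; right; exists k. Qed.

(* The points - q^k and t q^k as elements of the subtype qsupp q t, on which
   the functions of H_t are defined. *)
Definition neg_pt (R : realType) (q t : R[i]) (k : nat) : qsupp q t :=
  exist _ (- q ^+ k) (qsupp_neg q t k).

Definition pos_pt (R : realType) (q t : R[i]) (k : int) : qsupp q t :=
  exist _ (t * q ^ k) (qsupp_pos q t k).

Definition qintegrable (R : realType) (q t : R[i]) (f : qsupp q t -> R[i]) :
    Prop :=
  csum_cvg (fun k => f (neg_pt q t k) * q ^+ k) /\
  zsum_cvg (fun k => f (pos_pt q t k) * (t * q ^ k)).

Definition qintegral (R : realType) (q t : R[i]) (f : qsupp q t -> R[i]) :
    R[i] :=
  (1 - q) * csum (fun k => f (neg_pt q t k) * q ^+ k) +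
  (1 - q) * zsum (fun k => f (pos_pt q t k) * (t * q ^ k)).

Definition Hspace (R : realType) (a b q t : R[i]) : set (qsupp q t -> R[i]) :=
  [set f | qintegrable (fun x => `|f x| ^+ 2 * weight a b q (\val x))].
Arguments Hspace {R} a b q t _.

Definition Hinner (R : realType) (a b q t : R[i]) (f g : qsupp q t -> R[i]) :
    R[i] :=
  qintegral (fun x => f x * (g x)^* * weight a b q (\val x)).
Arguments Hinner {R} a b q t f g.

Definition Hnorm (R : realType) (a b q t : R[i]) (f : qsupp q t -> R[i]) :
    R[i] :=
  sqrtC (Hinner a b q t f f).
Arguments Hnorm {R} a b q t f.

(* B consists of nonzero, pairwise orthogonal elements of H_t, and the finite
   linear combinations of elements of B are dense in H_t. *)
Definition orthogonal_basis (R : realType) (a b q t : R[i])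
    (B : set (qsupp q t -> R[i])) : Prop :=
  [/\ B `<=` Hspace a b q t,
      ~ B (fun=> 0),
      forall f g, B f -> B g -> f <> g -> Hinner a b q t f g = 0
    & forall f, Hspace a b q t f -> forall e : R[i], 0 < e ->
        exists (n : nat) (c : 'I_n -> R[i]) (g : 'I_n -> qsupp q t -> R[i]),
          (forall i, B (g i)) /\
          Hnorm a b q t (fun x => f x - \sum_(i < n) c i * g i x) < e].
Arguments orthogonal_basis {R} a b q t B.

(* phi_gamma as a function on - q^NN `|` t q^ZZ *)
Definition qMeixner_fun (R : realType) (a b q t gamma : R[i]) :
    qsupp q t -> R[i] :=
  fun x => qMeixner a b q gamma (\val x).
Arguments qMeixner_fun {R} a b q t gamma _.

(* H_gamma(a, b; q) *)
Definition Hconst (R : realType) (a b q gamma : R[i]) : R[i] :=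
  qpoch_inf [:: q; - a * gamma; - b * gamma] q /
  (`|gamma| * qpoch_inf [:: a; b; - q * gamma] q).

(* I(a, b; t) *)
Definition Iconst (R : realType) (a b q t : R[i]) : R[i] :=
  (1 - q) * t * (qpoch_inf [:: q] q / qpoch_inf [:: a; b] q) *
  (theta q [:: - a * b * t; -1 / t] / theta q [:: - a * t; - b * t]).

(* Main.v *)
Require Import Defs.
From HB Require Import structures.
From mathcomp Require Import all_boot all_order all_algebra.
From mathcomp Require Import all_classical all_reals all_analysis.
From mathcomp Require Import complex ring lra zify.

(** Write [phi g x] for the q-Meixner function at spectral parameter [g] and
    point [x]. Its series is a sum over [n] of a constant times
    [shifted_pow g n * shifted_pow x n], where [shifted_pow x n] is the
    product of the [x + q ^ k], [k < n]; so [phi] is symmetric in [g] and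
    [x]. The hypotheses on the parameters give conditions ([admissible])
    which are stable under replacing [t] by [s = (a * b * t)^-1]. Hence each
    statement about the points [- q ^ n, t * q ^ k] has a dual about the
    spectrum [- q ^ n, s * q ^ k], and the proof plays the two against each
    other.

    Orthogonality. In [x], [phi g] solves a second order q-difference
    equation with eigenvalue [1 + g] ([phi_difference_eq]), so the
    differences of a weighted Casoratian of [phi g] and [phi l] are
    [- (a * b) * (g - l)] times the integrand of the inner product
    ([casoratian_diff]), and the integral telescopes along [- q ^ n] and
    along [t * q ^ k]. The weighted Casoratian vanishes at the endpoint
    [-1], and its two contributions at [0] cancel. At infinity the weight
    decays faster than any geometric sequence, so it suffices that [phi g]
    grows at most geometrically there ([tame]). A generic solution of the
    equation does not, and this is where the spectrum enters: if
    [a * b * g * x] is an integral power of [q], then [phi g x] is bounded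
    far out ([phi_bounded_far]), and the recurrence in [g] dual to the
    difference equation carries tameness to all spectral points ([tame_neg],
    [tame_pos]).

    Norms. Summing the recurrence in [g] against [phi (q * g)] shows that
    the squared norm of [phi g] times the dual weight of [g] is constant on
    each of the two chains of the spectrum ([sqnorm_step]). The two
    constants agree because the kernel has orthogonal rows and, by duality,
    orthogonal columns: evaluating the product V V* V in two ways gives a
    single constant ([norm_constant]), which can be read off at [g = -1],
    where [phi] is [1] and the squared norm is the total mass of the weight.
    The mass satisfies a first order recursion in each parameter
    ([mass_mulq], the integrated Pearson equation). Iterating it and passing
    to the limit leaves a bilateral series, which Ramanujan's summation
    ([ramanujan_1psi1]), a limit of the q-binomial theorem, evaluates in
    closed form ([mass_formula]).

    Completeness. Once the norms are known, column orthogonality is the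
    Parseval identity for finitely supported functions, which are dense
    ([density]); real and imaginary parts are approximated separately. *)

Set Implicit Arguments.
Unset Strict Implicit.
Unset Printing Implicit Defensive.

Import Order.TTheory GRing.Theory Num.Theory numFieldNormedType.Exports.

Local Open Scope classical_set_scope.
Local Open Scope ring_scope.

(** * Limits and series of complex numbers *)

Local Notation Re := complex.Re.

(** A wrapper with one constructor, so that unification compares the
    sequences and never unfolds convergence to filters. *)
Variant clim (R : realType) (u : nat -> R[i]) (l : R[i]) : Prop :=
  Clim of (u : nat -> R[i]^o) @ \oo --> (l : R[i]^o).
Notation "u ~> l" := (clim u l) (at level 70).

Section Limits.
Local Open Scope complex_scope.
Local Open Scope ring_scope.
Variable R : realType.
Notation C := R[i].
Implicit Types (u v g : nat -> C) (c l : C).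

Lemma clim_unique u l l' : u ~> l -> u ~> l' -> l = l'.
Proof. by move=> [h1] [h2]; exact: (cvg_unique _ h1 h2). Qed.

Lemma clim_lim u l : u ~> l -> limn (u : nat -> C^o) = l.
Proof. by move=> [h]; exact: (cvg_lim _ h). Qed.

Lemma posCP (e : C) : 0 < e -> exists2 r : R, 0 < r & e = r%:C.
Proof.
move=> e0; have eE : (Re e)%:C = e by apply: RRe_real; exact: gtr0_real.
by exists (Re e); rewrite // -ltcR eE.
Qed.

Lemma climP u l : u ~> l <->
  (forall e : R, 0 < e -> exists N, forall n, (N <= n)%N -> `|u n - l| < e%:C).
Proof.
split.
  move=> [/cvgrPdist_lt h] e e0.
  have /h [N _ hN] : 0 < e%:C :> C by rewrite ltcR.
  by exists N => n Nn; rewrite distrC; exact: hN.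
move=> h; split; apply/cvgrPdist_lt => e e0.
have [r r0 ->] := posCP e0; have [N hN] := h _ r0.
by exists N => // n Nn; rewrite distrC; exact: hN.
Qed.

Lemma clim_cst l : (fun=> l) ~> l.
Proof. by split; exact: cvg_cst. Qed.

Lemma climD u v l l' : u ~> l -> v ~> l' -> (fun n => u n + v n) ~> (l + l').
Proof. by move=> [h1] [h2]; split; exact: cvgD h1 h2. Qed.

Lemma climB u v l l' : u ~> l -> v ~> l' -> (fun n => u n - v n) ~> (l - l').
Proof. by move=> [h1] [h2]; split; exact: cvgB h1 h2. Qed.

Lemma climM u v l l' : u ~> l -> v ~> l' -> (fun n => u n * v n) ~> (l * l').
Proof. by move=> [h1] [h2]; split; exact: (cvgM h1 h2). Qed.

Lemma climZ c u l : u ~> l -> (fun n => c * u n) ~> (c * l).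
Proof. by move=> h; exact: (climM (clim_cst c) h). Qed.

Lemma climV u l : l != 0 -> u ~> l -> (fun n => (u n)^-1) ~> l^-1.
Proof. by move=> l0 [h]; split; exact: (cvgV l0 h). Qed.

Lemma clim_norm u l : u ~> l -> (fun n => `|u n|) ~> `|l|.
Proof.
move=> /climP h; apply/climP => e /h [N hN]; exists N => n /hN h1.
apply: le_lt_trans h1; exact: ler_dist_dist.
Qed.

Lemma climS u l : u ~> l <-> (fun n => u n.+1) ~> l.
Proof.
split=> /climP h; apply/climP => e /h [N hN].
  by exists N => n Nn; apply: hN; apply: leq_trans Nn _.
by exists N.+1 => -[//|n] Nn; apply: hN.
Qed.

Lemma climSn m u l : u ~> l <-> (fun n => u (n + m)%N) ~> l.
Proof.
elim: m => [|m IH].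
  by rewrite (_ : (fun n => u (n + 0)%N) = u) //; apply/funext => n;
    rewrite addn0.
rewrite IH climS (_ : (fun n => u (n.+1 + m)%N) = fun n => u (n + m.+1)%N) //.
by apply/funext => n; rewrite addnS.
Qed.

Lemma clim_eq u v l : (forall n, u n = v n) -> u ~> l -> v ~> l.
Proof. by move=> /funext ->. Qed.

Lemma clim0_le u v : (forall n, `|u n| <= `|v n|) -> v ~> 0 -> u ~> 0.
Proof.
move=> h /climP hv; apply/climP => e /hv [N hN]; exists N => n /hN.
rewrite !subr0; exact: le_lt_trans.
Qed.

Lemma clim_norm_le u l B : u ~> l -> (forall n, `|u n| <= B) -> `|l| <= B.
Proof.
move=> h hB; have B0 : 0 <= B by apply: le_trans (hB 0%N).
have BE : (Re B)%:C = B by apply: RRe_real; exact: ger0_real.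
have lE : (Re `|l|)%:C = `|l| by apply: RRe_real; exact: normr_real.
rewrite -BE -lE lecR; apply/ler_addgt0Pr => e e0.
rewrite -lecR; have /climP /(_ e e0) [N /(_ _ (leqnn N)) hN] := h.
rewrite rmorphD /= lE BE.
rewrite (_ : l = u N - (u N - l)); last by ring.
apply: (le_trans (ler_normB _ _)); apply: lerD => //; exact: ltW.
Qed.

Lemma clim_bounded u l : u ~> l -> exists2 B, 0 < B & forall n, `|u n| <= B.
Proof.
move=> /climP /(_ 1 ltr01) [N hN].
exists (\sum_(k < N) `|u k| + (`|l| + 1)).
  by rewrite ltr_wpDl ?sumr_ge0 // ltr_wpDl.
move=> n; have [Nn|nN] := leqP N n.
  rewrite ler_wpDl ?sumr_ge0 //.
  rewrite (_ : u n = l + (u n - l)); last by ring.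
  by apply: (le_trans (ler_normD _ _)); rewrite lerD2l ltW // hN.
rewrite (bigD1 (Ordinal nN)) //= -addrA ler_wpDr //.
by rewrite addr_ge0 ?sumr_ge0 // addr_ge0.
Qed.

Lemma real_clim (r : nat -> R) (l : R) :
  r @ \oo --> l -> (fun n => (r n)%:C) ~> l%:C.
Proof.
move=> /cvgrPdist_lt h; apply/climP => e /h [N _ hN]; exists N => n /hN.
by rewrite distrC -rmorphB normc_def /= expr0n addr0 sqrtr_sqr ltcR.
Qed.

Lemma Re_norm_le (z : C) : `|Re z| <= Re `|z|.
Proof.
by rewrite -lecR (RRe_real (normr_real z)); exact: normc_ge_Re.
Qed.

Lemma Re_sum (I : Type) (s : seq I) (f : I -> C) :
  Re (\sum_(i <- s) f i) = \sum_(i <- s) Re (f i).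
Proof. by apply: big_morph => // -[x y] [x' y']. Qed.

Lemma clim_Re u l : u ~> l -> (fun n => Re (u n)) @ \oo --> Re l.
Proof.
move=> /climP h; apply/cvgrPdist_lt => e /h [N hN]; exists N => // n /= /hN.
move=> h1; rewrite distrC -ltcR; apply: le_lt_trans h1.
rewrite -[X in _ <= X](RRe_real (normr_real _)) lecR.
have -> : Re (u n) - Re l = Re (u n - l).
  by case: (u n) => ? ?; case: (l) => ? ?.
exact: Re_norm_le.
Qed.

Definition abs_summable u := exists B : C, forall n, \sum_(k < n) `|u k| <= B.

Lemma abs_summable_le u v : (forall k, `|u k| <= `|v k|) -> abs_summable v ->
  abs_summable u.
Proof.
move=> h [B hB]; exists B => n; apply: le_trans (hB n).
by apply: ler_sum => k _.
Qed.

Lemma abs_summable_norm u : abs_summable u -> abs_summable (fun k => `|u k|).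
Proof. by apply: abs_summable_le => k; rewrite normr_id. Qed.

Lemma abs_summableZ c u : abs_summable u -> abs_summable (fun k => c * u k).
Proof.
move=> [B hB]; exists (`|c| * B) => n.
under eq_bigr do rewrite normrM.
by rewrite -mulr_sumr ler_wpM2l.
Qed.

Lemma seriesE u n : series (u : nat -> C^o) n = \sum_(k < n) u k.
Proof. by rewrite /series /= big_mkord. Qed.

(** Unlike [csum], which is total, this records convergence; it is the form
    in which sums are added, scaled and shifted. *)
Definition has_csum u l := (fun n => \sum_(k < n) u k) ~> l.

Lemma has_csumE u l : has_csum u l <-> series (u : nat -> C^o) @ \oo -->
  (l : C^o).
Proof.
by rewrite /has_csum (_ : (fun n => _) = series (u : nat -> C^o));
  [split=> [[]|]|apply/funext => n; rewrite seriesE].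
Qed.

Lemma has_csum_csum u l : has_csum u l -> csum u = l.
Proof. by move=> /has_csumE h; exact: (cvg_lim _ h). Qed.

Lemma has_csum_cvg u l : has_csum u l -> csum_cvg u.
Proof. by move=> /has_csumE h; apply/cvg_ex; exists l. Qed.

Lemma bounded_real_series (r : nat -> R) (B : R) :
  (forall n, \sum_(k < n) `|r k| <= B) -> cvgn (series r).
Proof.
move=> hB; apply: (@normed_cvg R R^o).
rewrite /normed_series_of; apply: nondecreasing_is_cvgn.
  by apply: nondecreasing_series => n _ _; exact: normr_ge0.
by exists B => _ [n _ <-]; rewrite /series /= big_mkord; exact: hB.
Qed.

Lemma norm_Re_sum_le u (B : C) :
  (forall n, \sum_(k < n) `|u k| <= B) ->
  forall n, \sum_(k < n) `|Re (u k)| <= Re B.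
Proof.
move=> hB n; apply: (@le_trans _ _ (\sum_(k < n) Re `|u k|)).
  by apply: ler_sum => k _; exact: Re_norm_le.
rewrite -Re_sum; have := hB n.
by rewrite lecE => /andP[].
Qed.

(** Completeness of the reals, applied to the real parts of [u] and of
    [i * u]. *)
Lemma abs_summable_has_csum u : abs_summable u -> has_csum u (csum u).
Proof.
move=> [B hB].
have h1 := @bounded_real_series (fun k => Re (u k)) _ (@norm_Re_sum_le u B hB).
have hB' : forall n, \sum_(k < n) `|('i%C * u k)| <= B.
  move=> n; apply: le_trans (hB n); apply: ler_sum => k _.
  by rewrite normrM (_ : `|'i%C| = 1 :> C) ?mul1r // complexiE normCi.
have h2 := @bounded_real_series (fun k => Re ('i%C * u k)) _
  (@norm_Re_sum_le (fun k => 'i%C * u k) B hB').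
have [l1 hl1] := (cvg_ex _).1 h1; have [l2 hl2] := (cvg_ex _).1 h2.
have {}hl1 := real_clim hl1; have {}hl2 := real_clim hl2.
have H : has_csum u (l1%:C + (- 'i%C) * l2%:C).
  apply: clim_eq (climD hl1 (climZ (- 'i%C) hl2)) => n /=.
  rewrite /series /= !big_mkord !rmorph_sum mulr_sumr -big_split /=.
  apply: eq_bigr => k _; case: (u k) => x y.
  by simpc.
by rewrite (has_csum_csum H).
Qed.

Lemma csum_norm_le u B : (forall n, \sum_(k < n) `|u k| <= B) -> `|csum u| <= B.
Proof.
move=> hB; have /abs_summable_has_csum h : abs_summable u by exists B.
apply: (clim_norm_le h) => n; apply: le_trans (hB n); exact: ler_norm_sum.
Qed.

Lemma has_csumD u v l l' : has_csum u l -> has_csum v l' ->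
  has_csum (fun k => u k + v k) (l + l').
Proof.
by move=> h h'; apply: clim_eq (climD h h') => n; rewrite big_split.
Qed.

Lemma has_csumZ c u l : has_csum u l -> has_csum (fun k => c * u k) (c * l).
Proof.
by move=> h; apply: clim_eq (climZ c h) => n; rewrite mulr_sumr.
Qed.

Lemma has_csumB u v l l' : has_csum u l -> has_csum v l' ->
  has_csum (fun k => u k - v k) (l - l').
Proof.
by move=> h h'; apply: clim_eq (climB h h') => n; rewrite sumrB.
Qed.

Lemma has_csumS u l : has_csum (fun k => u k.+1) l <-> has_csum u (u 0%N + l).
Proof.
rewrite /has_csum [X in _ <-> X]climS.
split=> h.
  by apply: clim_eq (climD (clim_cst (u 0%N)) h) => n; rewrite big_ord_recl.
rewrite (_ : l = u 0%N + l - u 0%N); last by ring.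
by apply: clim_eq (climB h (clim_cst (u 0%N))) => n;
  rewrite big_ord_recl addrC addKr.
Qed.

Lemma has_csum_eq u v l : (forall k, u k = v k) -> has_csum u l -> has_csum v l.
Proof. by move=> /funext ->. Qed.

Lemma has_csum_unique u l l' : has_csum u l -> has_csum u l' -> l = l'.
Proof. exact: clim_unique. Qed.

Lemma has_csum0 : has_csum (fun=> 0) 0.
Proof. by apply: clim_eq (clim_cst 0) => n; rewrite big1. Qed.

Lemma telescope_has_csum u l : u ~> l -> has_csum (fun k => u k - u k.+1)
  (u 0%N - l).
Proof.
move=> h; apply: clim_eq (climB (clim_cst (u 0%N)) h) => n.
elim: n => [|n IH]; first by rewrite big_ord0 subrr.
by rewrite big_ord_recr /= -IH; ring.
Qed.

Lemma csum_tail u n : abs_summable u ->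
  has_csum (fun k => u (k + n)%N) (csum u - \sum_(k < n) u k).
Proof.
move=> hu; elim: n => [|n IH].
  rewrite big_ord0 subr0; apply: has_csum_eq (abs_summable_has_csum hu) => k.
  by rewrite addn0.
rewrite big_ord_recr /=.
have -> : has_csum (fun k => u (k + n.+1)%N) = has_csum
  (fun k => u (k.+1 + n)%N).
  by congr has_csum; apply/funext => k; rewrite addnS.
apply/(@has_csumS (fun k => u (k + n)%N)).
by rewrite add0n (_ : _ + _ = csum u - \sum_(k < n) u k) //; ring.
Qed.

Lemma psum_le_csum g n : (forall k, 0 <= g k) -> abs_summable g ->
  \sum_(k < n) g k <= csum g.
Proof.
move=> g0 hg; rewrite -subr_ge0.
have h := csum_tail n hg.
suff <- : `|csum g - \sum_(k < n) g k| = csum g - \sum_(k < n) g k by [].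
apply: (clim_unique (clim_norm h)); apply: clim_eq h => m.
by rewrite ger0_norm // sumr_ge0.
Qed.

Lemma tail_norm_le w g n : (forall k, `|w k| <= g k) -> abs_summable g ->
  `|csum w - \sum_(k < n) w k| <= csum g - \sum_(k < n) g k.
Proof.
move=> hwg hg.
have g0 k : 0 <= g k by apply: le_trans (hwg k).
have hw : abs_summable w by apply: abs_summable_le hg => k;
  rewrite (ger0_norm (g0 k)).
have hgt := csum_tail n hg.
rewrite -(has_csum_csum (csum_tail n hw)) -(has_csum_csum hgt).
have hgb : abs_summable (fun k => g (k + n)%N).
  exists (csum g) => m; under eq_bigr do rewrite ger0_norm //.
  apply: le_trans (psum_le_csum (n + m) g0 hg).
  rewrite big_split_ord /= ler_wpDl ?sumr_ge0 //.
  by under eq_bigr do rewrite addnC.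
apply: csum_norm_le => m.
apply: le_trans (@psum_le_csum (fun k => g (k + n)%N) m _ hgb) => //.
exact: ler_sum.
Qed.

(** Dominated convergence for series: the tails are uniformly small by
    domination, and the remaining finite sums converge termwise. *)
Lemma tannery (u : nat -> nat -> C) v g :
  (forall k, (fun n => u n k) ~> v k) -> (forall n k, `|u n k| <= g k) ->
  abs_summable g -> (fun n => csum (u n)) ~> csum v.
Proof.
move=> huv hug hg.
have g0 k : 0 <= g k by apply: le_trans (hug 0%N k).
have hvg k : `|v k| <= g k by apply: clim_norm_le (huv k) _ => n; exact: hug.
apply/climP => e e0.
have e4 : 0 < e / 4 by lra.
have /climP /(_ _ e4) [K /(_ _ (leqnn K)) hK] := abs_summable_has_csum hg.
(* Beyond [K] the majorant sums to less than [e / 4], and so does every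
   sequence it dominates. *)
have tailB (w : nat -> C) : (forall k, `|w k| <= g k) ->
    `|csum w - \sum_(k < K) w k| <= (e / 4)%:C.
  move=> hwg; apply: le_trans (tail_norm_le K hwg hg) _.
  apply: le_trans (ltW hK); rewrite distrC real_ler_norm //.
  by apply: ger0_real; rewrite subr_ge0 psum_le_csum.
have hfin : (fun n => \sum_(k < K) u n k) ~> \sum_(k < K) v k.
  elim: (K) => [|m IH].
    by apply: clim_eq (clim_cst _) => n; rewrite !big_ord0.
  rewrite big_ord_recr /=; apply: clim_eq (climD IH (huv m)) => n.
  by rewrite big_ord_recr.
have /climP /(_ _ e4) [N hN] := hfin.
exists N => n Nn.
have -> : csum (u n) - csum v = (csum (u n) - \sum_(k < K) u n k)
   + (\sum_(k < K) u n k - \sum_(k < K) v k) - (csum v - \sum_(k < K) v k).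
  by ring.
apply: le_lt_trans (ler_normB _ _) _.
apply: (@le_lt_trans _ _ ((e / 4)%:C + (e / 4)%:C + (e / 4)%:C)).
  apply: lerD; last exact: tailB.
  apply: le_trans (ler_normD _ _) _; apply: lerD; first exact: tailB.
  exact: ltW (hN _ Nn).
by rewrite -!rmorphD /= ltcR; lra.
Qed.

End Limits.

(** * Geometric majorants and sums over the integers *)

Section MoreSums.
Variable R : realType.
Notation C := R[i].
Implicit Types (u v g : nat -> C) (c l : C).

Lemma abs_summable_clim0 u : abs_summable u -> u ~> 0.
Proof.
move=> /abs_summable_has_csum h; have := climB ((climS _ _).1 h) h.
rewrite subrr; apply: clim_eq => n.
by rewrite big_ord_recr /= addrAC subrr add0r.
Qed.

Lemma geom_sum_le (r : C) n : 0 <= r -> r < 1 ->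
  \sum_(k < n) r ^+ k <= (1 - r)^-1.
Proof.
move=> r0 r1; rewrite -[leRHS]mul1r ler_pdivlMr ?subr_gt0 //.
have -> : (\sum_(k < n) r ^+ k) * (1 - r) = 1 - r ^+ n.
  by rewrite -[RHS]opprB subrX1; ring.
by rewrite lerBlDr lerDl exprn_ge0.
Qed.

Lemma abs_summable_geom (r : C) : 0 <= r -> r < 1 ->
  abs_summable (fun k => r ^+ k).
Proof.
move=> r0 r1; exists (1 - r)^-1 => n; apply: le_trans (geom_sum_le n r0 r1).
by apply: ler_sum => k _; rewrite ger0_norm // exprn_ge0.
Qed.

Lemma abs_summable_geom_le u (B r : C) : 0 <= r -> r < 1 ->
  (forall k, `|u k| <= B * r ^+ k) -> abs_summable u.
Proof.
move=> r0 r1 h;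
  apply: abs_summable_le (abs_summableZ B (abs_summable_geom r0 r1)) => k.
by apply: le_trans (h k) _;
  rewrite real_ler_norm // ger0_real // (le_trans _ (h k)).
Qed.

Lemma geom_clim0 (r : C) : 0 <= r -> r < 1 -> (fun k => r ^+ k) ~> 0.
Proof. by move=> r0 r1; apply: abs_summable_clim0;
  exact: abs_summable_geom. Qed.

Lemma clim0_lt u (e : C) : u ~> 0 -> 0 < e ->
  exists N, forall n, (N <= n)%N -> `|u n| < e.
Proof.
move=> /climP h /posCP[r r0 ->]; have [N hN] := h _ r0.
by exists N => n /hN; rewrite subr0.
Qed.

(** A sequence whose ratio tends to zero decays faster than any geometric
    sequence; it is used for the weight, for the coefficients of the series
    and for bilateral sums. *)
Lemma geom_bound_of_ratio0 u (r : nat -> C) (s : C) :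
  (forall n, u n.+1 = r n * u n) -> r ~> 0 -> 0 < s ->
  exists2 B, 0 <= B & forall n, `|u n| <= B * s ^+ n.
Proof.
move=> hu hr s0; have [N hN] := clim0_lt hr s0.
pose B := \sum_(k < N.+1) `|u k| / s ^+ k.
have B0 : 0 <= B.
  by apply: sumr_ge0 => k _; rewrite mulr_ge0 // invr_ge0 exprn_ge0 // ltW.
have hB n : (n <= N)%N -> `|u n| <= B * s ^+ n.
  move=> nN; rewrite -ler_pdivrMr ?exprn_gt0 //.
  rewrite /B (bigD1 (inord n)) //= inordK ?ltnS // lerDl.
  by apply: sumr_ge0 => k _; rewrite mulr_ge0 // invr_ge0 exprn_ge0 // ltW.
exists B => // n; have [nN|Nn] := leqP n N; first exact: hB.
rewrite -(subnK (ltnW Nn)); elim: (n - N)%N => [|m IH]; first exact: hB.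
rewrite addSn hu normrM exprS mulrCA.
by apply: ler_pM => //; apply: ltW; apply: hN; rewrite leq_addl.
Qed.

Implicit Types (f h : int -> C).

(** The integers are split into [Posz k] and [Negz k = - k.+1], as in
    [zsum]. *)
Definition abs_zsummable f := abs_summable (fun k => f (Posz k)) /\ abs_summable
  (fun k => f (Negz k)).

Definition has_zsum f l := exists l1 l2,
  [/\ has_csum (fun k => f (Posz k)) l1, has_csum (fun k => f (Negz k)) l2 & l =
    l1 + l2].

Lemma abs_zsummable_has_zsum f : abs_zsummable f -> has_zsum f (zsum f).
Proof.
move=> [h1 h2]; exists (csum (fun k => f (Posz k))),
  (csum (fun k => f (Negz k))).
by split => //; exact: abs_summable_has_csum.
Qed.

Lemma has_zsum_zsum f l : has_zsum f l -> zsum f = l.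
Proof.
by move=> [l1 [l2 [h1 h2 ->]]];
  rewrite /zsum (has_csum_csum h1) (has_csum_csum h2).
Qed.

Lemma has_zsum_cvg f l : has_zsum f l -> zsum_cvg f.
Proof. by move=> [l1 [l2 [h1 h2 _]]]; split;
  [exact: has_csum_cvg h1|exact: has_csum_cvg h2]. Qed.

Lemma has_zsum_eq f h l : (forall k, f k = h k) -> has_zsum f l -> has_zsum h l.
Proof. by move=> /funext ->. Qed.

Lemma has_zsumD f h l l' : has_zsum f l -> has_zsum h l' ->
  has_zsum (fun k => f k + h k) (l + l').
Proof.
move=> [l1 [l2 [h1 h2 ->]]] [l3 [l4 [h3 h4 ->]]].
exists (l1 + l3), (l2 + l4); split;
  [exact: has_csumD h1 h3|exact: has_csumD h2 h4|ring].
Qed.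

Lemma has_zsumZ c f l : has_zsum f l -> has_zsum (fun k => c * f k) (c * l).
Proof.
move=> [l1 [l2 [h1 h2 ->]]]; exists (c * l1), (c * l2).
by split; [exact: has_csumZ|exact: has_csumZ|ring].
Qed.

Lemma abs_zsummable_le f h : (forall k, `|f k| <= `|h k|) -> abs_zsummable h ->
  abs_zsummable f.
Proof.
by move=> fh [h1 h2]; split;
  [apply: abs_summable_le h1|apply: abs_summable_le h2] => k.
Qed.

Lemma abs_zsummableZ c f : abs_zsummable f -> abs_zsummable (fun k => c * f k).
Proof. by move=> [h1 h2]; split; exact: abs_summableZ. Qed.

Lemma has_zsum_shift f l : has_zsum f l -> has_zsum (fun k => f (k + 1)) l.
Proof.
move=> [l1 [l2 [h1 h2 ->]]]; exists (l1 - f 0), (l2 + f 0); split; last by ring.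
  rewrite (_ : (fun k => _) = fun k => f (Posz k.+1)); last first.
    by apply/funext => k; rewrite -addn1 PoszD.
  by apply/(@has_csumS _ (fun k => f (Posz k))); rewrite addrC subrK.
rewrite (_ : (fun k => _) = fun k => if k is m.+1 then f (Negz m) else f 0).
  by rewrite addrC;
    apply/(@has_csumS _ (fun k => if k is m.+1 then f (Negz m) else f 0)).
by apply/funext => -[|k]; congr f; rewrite !NegzE; lia.
Qed.

Lemma has_zsum_unshift f l : has_zsum (fun k => f (k + 1)) l -> has_zsum f l.
Proof.
move=> [l1 [l2 [h1 h2 ->]]].
exists (f 0 + l1), (l2 - f 0); split; last by ring.
  apply/(@has_csumS _ (fun k => f (Posz k))).
  by apply: has_csum_eq h1 => k; rewrite -addn1 PoszD.
rewrite (_ : (fun k => f (Negz k)) = fun k => f (Negz k.+1 + 1)); last first.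
  by apply/funext => k; congr f; rewrite !NegzE; lia.
apply/(@has_csumS _ (fun k => f (Negz k + 1))).
by rewrite (_ : f (Negz 0 + 1) = f 0) // addrC subrK.
Qed.

Lemma has_zsum_shiftn f l n : has_zsum f l -> has_zsum (fun k => f (k - Posz n))
  l.
Proof.
elim: n => [|n IH] h; first by apply: has_zsum_eq h => k; rewrite subr0.
apply: has_zsum_unshift; apply: has_zsum_eq (IH h) => k; congr f; lia.
Qed.

(** The limit at the negative end appears with a plus sign: the sum runs
    from minus infinity to plus infinity. *)
Lemma has_zsum_telescope f l l' :
  (fun k => f (Posz k)) ~> l -> (fun k => f (Negz k)) ~> l' ->
  has_zsum (fun k => f k - f (k + 1)) (l' - l).
Proof.
move=> h h'; exists (f 0 - l), (l' - f 0); split; last by ring.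
  apply: has_csum_eq (telescope_has_csum h) => k /=.
  by rewrite -addn1 PoszD.
have h2 : (fun k => - f (Negz k + 1)) ~> - l'.
  apply/climS; have := climZ (-1) h'; rewrite mulN1r; apply: clim_eq => n.
  by rewrite mulN1r; congr (- f _); rewrite !NegzE; lia.
have := telescope_has_csum h2.
rewrite (_ : - f (Negz 0 + 1) - - l' = l' - f 0); last by rewrite opprK addrC.
apply: has_csum_eq => k; rewrite opprK addrC; congr (f _ - _).
by rewrite !NegzE; lia.
Qed.

Lemma ztannery (F : nat -> int -> C) f (g : int -> C) :
  (forall k, (fun n => F n k) ~> f k) -> (forall n k, `|F n k| <= g k) ->
  abs_zsummable g -> (fun n => zsum (F n)) ~> zsum f.
Proof.
move=> h1 h2 [h3 h4]; apply: climD.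
  by apply: (@tannery _ (fun n k => F n (Posz k)) _ (fun k => g (Posz k))).
by apply: (@tannery _ (fun n k => F n (Negz k)) _ (fun k => g (Negz k))).
Qed.

End MoreSums.

Lemma q_gt0 (R : realType) (q : R[i]) : 0 < q < 1 -> 0 < q.
Proof. by case/andP. Qed.

(** * Finite and infinite shifted factorials *)

Section QProducts.
Variable R : realType.
Notation C := R[i].
Variable q : C.
Hypothesis hq : 0 < q < 1.
Implicit Types (x z : C) (n k : nat).

Let q0 : 0 < q. Proof. by case/andP: hq. Qed.
Let q1 : q < 1. Proof. by case/andP: hq. Qed.
Let qn0 : q != 0. Proof. by rewrite gt_eqF. Qed.

Lemma qX_gt0 n : 0 < q ^+ n. Proof. exact: exprn_gt0. Qed.
Lemma qX_ge0 n : 0 <= q ^+ n. Proof. exact/ltW/qX_gt0. Qed.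
Lemma qX_le1 n : q ^+ n <= 1. Proof. exact: exprn_ile1 (ltW q0) (ltW q1). Qed.
Lemma qX_norm n : `|q ^+ n| = q ^+ n. Proof. exact/ger0_norm/qX_ge0. Qed.
Lemma qX_lt1 n : q ^+ n.+1 < 1.
Proof. by rewrite exprn_ilt1 // ltW. Qed.
Lemma qX_clim0 : (fun n => q ^+ n) ~> 0.
Proof. exact: geom_clim0 (ltW q0) q1. Qed.

Definition qfact x n : C := \prod_(k < n) (1 - x * q ^+ k).
Definition qfact_inf x : C := limn (qfact x : nat -> C^o).

Lemma qfactE x n : qfact x n = \prod_(k < n) (1 - x * q ^+ k).
Proof. by []. Qed.
Lemma qfact0 x : qfact x 0 = 1. Proof. by rewrite /qfact big_ord0. Qed.
Lemma qfactSr x n : qfact x n.+1 = qfact x n * (1 - x * q ^+ n).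
Proof. by rewrite /qfact big_ord_recr. Qed.
Lemma qfactS x n : qfact x n.+1 = (1 - x) * qfact (x * q) n.
Proof.
rewrite /qfact big_ord_recl expr0 mulr1; congr (_ * _); apply: eq_bigr => k _.
by rewrite -mulrA -exprS.
Qed.
Lemma qfactD x n m : qfact x (n + m) = qfact x n * qfact (x * q ^+ n) m.
Proof.
elim: m => [|m IH]; first by rewrite addn0 qfact0 mulr1.
by rewrite addnS !qfactSr IH -mulrA -[x * _ * _]mulrA -exprD.
Qed.

(** The product of the [1 + r q^k] times [1 - r * sum q^k] is at most [1],
    by induction, and the second factor is at least [1 / 2] for small [r]. *)
Lemma qfact_bound_small (r : C) n : 0 <= r -> r <= (1 - q) / 2 ->
  qfact (- r) n <= 2.
Proof.
move=> r0 hr.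
have H : qfact (- r) n * (1 - r * \sum_(k < n) q ^+ k) <= 1.
  elim: n => [|n IH]; first by rewrite qfact0 big_ord0 mulr0 subr0 mulr1.
  have P0 : 0 <= qfact (- r) n.
    by apply: prodr_ge0 => k _; rewrite mulNr opprK addr_ge0 // mulr_ge0 //
      qX_ge0.
  rewrite qfactSr big_ord_recr /=; apply: le_trans IH.
  rewrite -mulrA ler_wpM2l // -subr_ge0.
  set s := \sum_(i < n) _.
  have s0 : 0 <= s by apply: sumr_ge0 => k _; exact: qX_ge0.
  rewrite (_ : _ - _ = r * s * (r * q ^+ n) + (r * q ^+ n) ^+ 2); last by ring.
  by rewrite addr_ge0 ?exprn_ge0 // !mulr_ge0 // qX_ge0.
have h2 : 2^-1 <= 1 - r * \sum_(k < n) q ^+ k.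
  rewrite lerBrDl -lerBrDr.
  have : r * \sum_(k < n) q ^+ k <= (1 - q) / 2 * (1 - q)^-1.
    apply: ler_pM => //; first by apply: sumr_ge0 => k _; exact: qX_ge0.
    exact: geom_sum_le (ltW q0) q1.
  rewrite mulrAC mulfV ?mul1r ?subr_eq0 1?eq_sym ?lt_eqF // => h.
  by rewrite (_ : 1 - 2^-1 = 2^-1 :> C) //; field.
have P0 : 0 <= qfact (- r) n.
  by apply: prodr_ge0 => k _; rewrite mulNr opprK addr_ge0 // mulr_ge0 //
    qX_ge0.
have : qfact (- r) n * 2^-1 <= 1 by apply: le_trans H; rewrite ler_wpM2l.
by rewrite ler_pdivrMr // mul1r.
Qed.

Lemma qX_small (r e : C) : 0 <= r -> 0 < e -> exists N, r * q ^+ N <= e.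
Proof.
move=> r0 e0; have h := climZ r qX_clim0; rewrite mulr0 in h.
have [N /(_ N (leqnn N)) hN] := clim0_lt h e0.
by exists N; apply: ltW; rewrite -[X in X < _]ger0_norm // mulr_ge0 // qX_ge0.
Qed.

(** After finitely many factors [r q^N] is small enough for the preceding
    bound. *)
Lemma qfact_bound (r : C) : 0 <= r -> exists2 B, 0 < B & forall n,
  qfact (- r) n <= B.
Proof.
move=> r0; have e0 : 0 < (1 - q) / 2 by rewrite divr_gt0 // subr_gt0.
have [N hN] := qX_small r0 e0.
have ge1 n : 1 <= qfact (- r) n.
  elim: n => [|n IH]; first by rewrite qfact0.
  by rewrite qfactSr -[leLHS]mulr1 ler_pM // mulNr opprK lerDl mulr_ge0 //
    qX_ge0.
have g0 n : 0 <= qfact (- r) n by apply: le_trans (ge1 n).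
exists (qfact (- r) N * 2);
  first by rewrite mulr_gt0 // (lt_le_trans _ (ge1 N)).
move=> n; have [Nn|nN] := leqP N n.
  rewrite -(subnKC Nn) qfactD mulNr; apply: ler_wpM2l => //.
  by apply: qfact_bound_small => //; rewrite mulr_ge0 // qX_ge0.
apply: (@le_trans _ _ (qfact (- r) N)); last by rewrite ler_peMr // ler1n.
rewrite -(subnKC (ltnW nN)) qfactD ler_peMr // mulNr.
elim: (N - n)%N => [|m IH]; first by rewrite qfact0.
by rewrite qfactSr -[leLHS]mulr1 ler_pM // mulNr opprK lerDl !mulr_ge0 //
  qX_ge0.
Qed.

Lemma norm_qfact_le x (r : C) n : `|x| <= r -> `|qfact x n| <= qfact (- r) n.
Proof.
move=> xr; rewrite /qfact normr_prod; apply: ler_prod => k _;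
  rewrite normr_ge0 /=.
apply: le_trans (ler_normB _ _) _; rewrite normr1 lerD2l normrM qX_norm mulNr
  opprK.
by rewrite ler_wpM2r // qX_ge0.
Qed.

Lemma qfact_has_csum x : has_csum (fun k => - x * q ^+ k * qfact x k)
  (csum (fun k => - x * q ^+ k * qfact x k)).
Proof.
apply: abs_summable_has_csum; have [B B0 hB] := qfact_bound (normr_ge0 x).
apply: (@abs_summable_geom_le _ _ (`|x| * B) q); rewrite ?(ltW q0) // => k.
rewrite !normrM normrN qX_norm mulrAC ler_wpM2r ?qX_ge0 // ler_wpM2l //.
exact: le_trans (norm_qfact_le _ (lexx _)) (hB k).
Qed.

(** Writing the products as partial sums of their increments reduces
    infinite products to absolutely convergent series. *)
Lemma qfact_sumE x n : qfact x n = 1 + \sum_(k < n) (- x * q ^+ k * qfact x k).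
Proof.
elim: n => [|n IH]; first by rewrite qfact0 big_ord0 addr0.
by rewrite big_ord_recr /= addrA -IH qfactSr; ring.
Qed.

Lemma qfact_infE x : qfact_inf x = 1 + csum (fun k => - x * q ^+ k * qfact x k).
Proof.
apply: clim_lim; apply: clim_eq (climD (clim_cst 1) (qfact_has_csum x)) => n.
by rewrite -qfact_sumE.
Qed.

Lemma qfact_clim x : qfact x ~> qfact_inf x.
Proof.
rewrite qfact_infE; apply: clim_eq (climD (clim_cst 1) (qfact_has_csum x)) => n.
by rewrite -qfact_sumE.
Qed.

(** Uniformity in [x] is what makes infinite products continuous at [0]. *)
Lemma qfact_inf_near1 (r : C) : 0 <= r -> exists2 B, 0 < B &
  forall x, `|x| <= r -> `|qfact_inf x - 1| <= `|x| * B.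
Proof.
move=> r0; have [B B0 hB] := qfact_bound r0.
exists (B / (1 - q)); first by rewrite divr_gt0 // subr_gt0.
move=> x xr; rewrite qfact_infE addrAC subrr add0r.
apply: csum_norm_le => n.
apply: (@le_trans _ _ (\sum_(k < n) `|x| * B * q ^+ k)).
  apply: ler_sum => k _; rewrite !normrM normrN qX_norm mulrAC ler_wpM2r ?qX_ge0
    //.
  by rewrite ler_wpM2l // (le_trans (norm_qfact_le _ xr)).
rewrite -mulr_sumr mulrA ler_wpM2l ?mulr_ge0 ?(ltW B0) //.
exact: geom_sum_le (ltW q0) q1.
Qed.

Lemma qfact_inf_clim1 (u : nat -> C) : u ~> 0 -> (fun n => qfact_inf (u n)) ~>
  1.
Proof.
move=> hu; have [r r0 hr] := clim_bounded hu.
have [B B0 hB] := qfact_inf_near1 (ltW r0).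
have H : (fun n => qfact_inf (u n) - 1) ~> 0.
  apply: (clim0_le _ (v := fun n => B * u n)); last first.
    by have := climZ B hu; rewrite mulr0.
  by move=> n; rewrite normrM (gtr0_norm B0) mulrC; apply: hB.
have := climD H (clim_cst 1); rewrite add0r; apply: clim_eq => n.
by rewrite subrK.
Qed.

Lemma qfact_inf_split n x : qfact_inf x = qfact x n * qfact_inf (x * q ^+ n).
Proof.
apply: (clim_unique ((climSn n _ _).1 (qfact_clim x))).
apply: clim_eq (climZ (qfact x n) (qfact_clim _)) => m.
by rewrite addnC qfactD.
Qed.

Lemma qfact_infS x : qfact_inf x = (1 - x) * qfact_inf (x * q).
Proof. by rewrite (qfact_inf_split 1) qfactS qfact0 mulr1 expr1. Qed.

Lemma qfact_neq0 x n : (forall k, (k < n)%N -> 1 - x * q ^+ k != 0) ->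
  qfact x n != 0.
Proof. by move=> h; apply/prodf_neq0 => -[k kn] _; exact: h. Qed.

(** Far enough out the tail product is within distance less than [1] of [1],
    and the finitely many remaining factors are nonzero. *)
Lemma qfact_inf_neq0 x : (forall k, 1 - x * q ^+ k != 0) -> qfact_inf x != 0.
Proof.
move=> h.
have hu : (fun n => x * q ^+ n) ~> 0 by have := climZ x qX_clim0; rewrite mulr0.
have H := climB (qfact_inf_clim1 hu) (clim_cst 1); rewrite subrr in H.
have [N /(_ N (leqnn N)) hN] := clim0_lt H ltr01.
rewrite (qfact_inf_split N) mulf_neq0 //; first by apply: qfact_neq0.
by apply: contraTneq hN => ->; rewrite sub0r normrN normr1 ltxx.
Qed.

Lemma norm_cq_le x n : `|x * q ^+ n| <= `|x|.
Proof. by rewrite normrM qX_norm ler_piMr // qX_le1. Qed.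

Lemma lin_neq0 x n : `|x| < 1 -> 1 - x * q ^+ n != 0.
Proof.
move=> x1; rewrite subr_eq0; apply/eqP => h.
by have := le_lt_trans (norm_cq_le x n) x1; rewrite -h normr1 ltxx.
Qed.

Lemma qfact_inf_neq0_lt1 x : `|x| < 1 -> qfact_inf x != 0.
Proof. by move=> x1; apply: qfact_inf_neq0 => k; exact: lin_neq0. Qed.

End QProducts.

Lemma expfzS (F : fieldType) (x : F) (k : int) :
  x != 0 -> x ^ (k + 1) = x ^ k * x.
Proof. by move=> x0; rewrite expfzDr // expr1z. Qed.

Lemma normrM3 (F : numDomainType) (x y z : F) :
  `|x * y * z| = `|x| * `|y| * `|z|.
Proof. by rewrite !normrM. Qed.

(** * The weight *)

Section Weight.
Variable R : realType.
Notation C := R[i].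
Variable q : C.
Hypothesis hq : 0 < q < 1.
Implicit Types (a b c t x z : C) (n : nat) (k : int).

Let q0 : 0 < q. Proof. by case/andP: hq. Qed.
Let q1 : q < 1. Proof. by case/andP: hq. Qed.
Let qn0 : q != 0. Proof. by rewrite gt_eqF. Qed.
Local Notation qfact_inf := (qfact_inf q).
Local Notation qfact := (qfact q).

Definition wgt a b x : C := qfact_inf (- q * x) /
  (qfact_inf (- a * x) * qfact_inf (- b * x)).

(** By [pearsonE] this is [(1 + x)] times the weight. It plays the part of
    the coefficient function in a Pearson equation, see [pearson_diff]. *)
Definition pearson a b x : C := qfact_inf (- x) /
  (qfact_inf (- a * x) * qfact_inf (- b * x)).

(** No denominator of the weight vanishes on the support, nor does one of
    the q-Meixner series: [c] is [a] or [b]. *)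
Definition nondeg t c : Prop :=
  [/\ c != 0, forall n, 1 - c * q ^+ n != 0 & forall k, 1 + c * t * q ^ k != 0].

Lemma qz_gt0 k : 0 < q ^ k. Proof. exact: exprz_gt0. Qed.

Lemma nondegM t c : nondeg t c -> nondeg t (c * q).
Proof.
case=> c0 h1 h2; split; first by rewrite mulf_neq0.
  by move=> n; rewrite -mulrA -exprS.
by move=> k; have := h2 (k + 1); rewrite (expfzS _ qn0); congr (1 + _ != 0);
  ring.
Qed.

Lemma nondegMX t c n : nondeg t c -> nondeg t (c * q ^+ n).
Proof.
elim: n => [|n IH] h; first by rewrite mulr1.
by rewrite exprSr mulrA; apply: nondegM; exact: IH.
Qed.

Lemma nondeg_neg t c n : nondeg t c -> qfact_inf (- c * - q ^+ n) != 0.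
Proof.
case=> _ h _; apply: (qfact_inf_neq0 hq) => k; have := h (n + k)%N.
by rewrite exprD; congr (1 - _ != 0); ring.
Qed.

Lemma nondeg_pos t c k : nondeg t c -> qfact_inf (- c * (t * q ^ k)) != 0.
Proof.
case=> _ _ h; apply: (qfact_inf_neq0 hq) => n; have := h (k + n).
by rewrite expfzDr //; congr (_ != 0); rewrite -exprnP; ring.
Qed.

Lemma wgtE a b x : wgt a b x = qfact_inf (- q * x) /
  (qfact_inf (- a * x) * qfact_inf (- b * x)).
Proof. by []. Qed.

Lemma wgt_sym a b x : wgt a b x = wgt b a x.
Proof. by rewrite /wgt [qfact_inf (- a * x) * _]mulrC. Qed.

Lemma pearsonE a b x : pearson a b x = (1 + x) * wgt a b x.
Proof.
rewrite /pearson /wgt mulrA; congr (_ / _).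
by rewrite (qfact_infS hq (- x)) opprK; congr (_ * qfact_inf _); ring.
Qed.

Lemma qfact_inf_shift c x : 1 + c * x != 0 -> qfact_inf (- c * (q * x)) =
  qfact_inf (- c * x) / (1 + c * x).
Proof.
move=> h; rewrite [qfact_inf (- c * x)](qfact_infS hq)
  (_ : 1 - - c * x = 1 + c * x); last by ring.
by rewrite mulrAC mulfV // mul1r; congr qfact_inf; ring.
Qed.

Lemma wgt_mulq a b x : 1 + a * x != 0 -> wgt (a * q) b x = (1 + a * x) * wgt a b
  x.
Proof.
move=> h; rewrite /wgt (_ : - (a * q) * x = - a * (q * x)); last by ring.
by rewrite qfact_inf_shift // !invfM invrK; ring.
Qed.

Lemma pearson_qx a b x : 1 + a * x != 0 -> 1 + b * x != 0 ->
  pearson a b (q * x) = (1 + a * x) * (1 + b * x) * wgt a b x.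
Proof.
move=> h1 h2; rewrite /pearson /wgt !qfact_inf_shift // !invfM !invrK.
by rewrite (_ : - (q * x) = - q * x); [ring|ring].
Qed.

(** The first order equation of the weight in exact form: it makes integrals
    of the weight against linear functions telescope. *)
Lemma pearson_diff a b x : 1 + a * x != 0 -> 1 + b * x != 0 ->
  pearson a b x - pearson a b (q * x) = (1 - a - b - a * b * x) *
    (x * wgt a b x).
Proof. by move=> h1 h2; rewrite pearson_qx // pearsonE; ring. Qed.

Lemma clim_cq c : (fun n => c * q ^+ n) ~> 0.
Proof. by have := climZ c (qX_clim0 hq); rewrite mulr0. Qed.

Lemma wgt_clim1 a b (u : nat -> C) : u ~> 0 -> (fun n => wgt a b (u n)) ~> 1.
Proof.
move=> hu.
have H c : (fun n => qfact_inf (- c * u n)) ~> 1.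
  by apply: (qfact_inf_clim1 hq); have := climZ (- c) hu; rewrite mulr0.
have HH : (fun n => qfact_inf (- a * u n) * qfact_inf (- b * u n)) ~> 1.
  by have := climM (H a) (H b); rewrite mulr1.
have := climM (H q) (climV (oner_neq0 _) HH).
by rewrite invr1 mulr1.
Qed.

Lemma pearson_clim1 a b (u : nat -> C) : u ~> 0 -> (fun n => pearson a b (u n))
  ~> 1.
Proof.
move=> hu; have := climM (climD (clim_cst 1) hu) (wgt_clim1 a b hu).
by rewrite addr0 mulr1; apply: clim_eq => n; rewrite pearsonE.
Qed.

(** The ratio of the weights at [t q^-(n+1)] and [t q^-n] is of the order of
    [q^n]. *)
Lemma wgt_decay a b t s : 0 < t -> nondeg t a -> nondeg t b -> 0 < s ->
  exists2 B, 0 <= B & forall n, `|wgt a b (t * q ^ (- n%:Z))| <= B * s ^+ n.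
Proof.
move=> t0 ha hb s0.
have tn0 : t != 0 by rewrite gt_eqF.
have [a0 _ hat] := ha; have [b0 _ hbt] := hb.
(* [y n] is the reciprocal of the point; in this coordinate the ratio of
   consecutive weights is a rational function with a zero at [0]. *)
pose y n := q ^+ n / t.
pose r n := (y n + 1) * y n / ((y n + a / q) * (y n + b / q)).
apply: (@geom_bound_of_ratio0 _ _ r) => //.
  move=> n; rewrite /r /y.
  have xE : t * q ^ (- n%:Z) = q * (t * q ^ (- n.+1%:Z)).
    rewrite mulrCA; congr (t * _).
    by rewrite (_ : - n%:Z = - n.+1%:Z + 1) ?(expfzS _ qn0) 1?mulrC //; clear;
      lia.
  set x := t * q ^ (- n.+1%:Z) in xE *.
  have xn0 : x != 0 by rewrite mulf_neq0 // gt_eqF // qz_gt0.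
  have hyx : q ^+ n / t = (q * x)^-1.
    by rewrite -xE invfM mulrC -exprnN invrK.
  have h1 : 1 + a * x != 0 by rewrite mulrA; exact: hat.
  have h2 : 1 + b * x != 0 by rewrite mulrA; exact: hbt.
  have hw : wgt a b (q * x) * ((1 + q * x)) = (1 + a * x) * (1 + b * x) * wgt a
    b x.
    by rewrite -pearson_qx // pearsonE mulrC.
  rewrite xE hyx.
  have e1 : (q * x)^-1 + a / q = (1 + a * x) / (q * x) by field;
    rewrite xn0 qn0.
  have e2 : (q * x)^-1 + b / q = (1 + b * x) / (q * x) by field;
    rewrite xn0 qn0.
  have e3 : (q * x)^-1 + 1 = (1 + q * x) / (q * x) by field; rewrite xn0 qn0.
  rewrite e1 e2 e3.
  have -> : wgt a b x = wgt a b (q * x) * (1 + q * x) /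
    ((1 + a * x) * (1 + b * x)).
    by rewrite hw; field; rewrite h1 h2.
  by field; rewrite h1 h2 xn0 qn0.
have hy : y ~> 0.
  by have := clim_cq t^-1; apply: clim_eq => n; rewrite mulrC.
have hn := climM (climD hy (clim_cst 1)) hy; rewrite mulr0 in hn.
have hd := climM (climD hy (clim_cst (a / q))) (climD hy (clim_cst (b / q))).
rewrite !add0r in hd.
have d0 : a / q * (b / q) != 0 by rewrite !mulf_neq0 // invr_neq0.
have := climM hn (climV d0 hd); by rewrite mul0r.
Qed.

End Weight.

Lemma int_addn_nat (k : int) : exists N m : nat, k + N%:Z = m%:Z.
Proof. by case: k => k; [exists 0%N, k|exists k.+1, 0%N; rewrite NegzE];
  lia. Qed.

(** * The q-binomial theorem and Ramanujan's summation *)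

Section Summations.
Variable R : realType.
Notation C := R[i].
Variable q : C.
Hypothesis hq : 0 < q < 1.
Implicit Types (a b c t x z A : C) (n : nat) (k : int).

Let q0 : 0 < q. Proof. by case/andP: hq. Qed.
Let q1 : q < 1. Proof. by case/andP: hq. Qed.
Let qn0 : q != 0. Proof. by rewrite gt_eqF. Qed.
Local Notation qfact_inf := (qfact_inf q).
Local Notation qfact := (qfact q).

Lemma qfact_q_neq0 n : qfact q n != 0.
Proof.
apply: qfact_neq0 => k _; rewrite -exprS subr_eq0 eq_sym lt_eqF //.
exact: qX_lt1.
Qed.

Lemma qfact_inf_q_neq0 : qfact_inf q != 0.
Proof.
apply: (qfact_inf_neq0 hq) => k; rewrite -exprS subr_eq0 eq_sym lt_eqF //.
exact: qX_lt1.
Qed.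

Lemma qfact_q_inv_bound : exists2 B, 0 < B & forall n, `|(qfact q n)^-1| <= B.
Proof. exact: clim_bounded (climV qfact_inf_q_neq0 (qfact_clim hq q)). Qed.

(** The series [f] satisfies [(1 - w) f(w) = (1 - A w) f(q w)]; iterating
    from [z] to [0], where [f] is [1], gives the two infinite products. *)
Lemma q_binomial A z : `|z| < 1 ->
  abs_summable (fun m => qfact A m / qfact q m * z ^+ m) /\
  csum (fun m => qfact A m / qfact q m * z ^+ m) * qfact_inf z = qfact_inf
    (A * z).
Proof.
move=> z1; pose c m := qfact A m / qfact q m.
have [B B0 hB] : exists2 B, 0 < B & forall n, `|c n| <= B.
  exact: clim_bounded
    (climM (qfact_clim hq A) (climV qfact_inf_q_neq0 (qfact_clim hq q))).
have hs w : `|w| <= `|z| -> abs_summable (fun m => c m * w ^+ m).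
  move=> wz; apply: (@abs_summable_geom_le _ _ B `|z|) => // m.
  by rewrite normrM normrX ler_pM // lerXn2r ?nnegrE.
pose f w := csum (fun m => c m * w ^+ m).
(* The functional equation is the recursion of the coefficients. *)
have hf w : `|w| <= `|z| -> (1 - w) * f w = (1 - A * w) * f (q * w).
  move=> wz.
  have qwz : `|q * w| <= `|z|.
    by rewrite normrM (gtr0_norm q0) (le_trans _ wz) // ler_piMl // ltW.
  have h1 := abs_summable_has_csum (hs _ wz);
    have h2 := abs_summable_has_csum (hs _ qwz).
  have h3 : has_csum (fun m => c m.+1 * w ^+ m.+1 - c m.+1 * (q * w) ^+ m.+1)
      (w * f w - A * w * f (q * w)).
    apply: has_csum_eq (has_csumB (has_csumZ w h1) (has_csumZ (A * w) h2)) =>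
      m /=.
    have cS : c m.+1 = c m * (1 - A * q ^+ m) / (1 - q ^+ m.+1).
      by rewrite /c !qfactSr invfM -exprS; ring.
    have h : 1 - q * q ^+ m != 0.
      by rewrite -exprS subr_eq0 eq_sym lt_eqF // qX_lt1.
    by rewrite cS !exprMn !exprS; field.
  have h4 := (has_csumS (fun m => c m * w ^+ m - c m * (q * w) ^+ m) _).1 h3.
  have := has_csum_unique h4 (has_csumB h1 h2); rewrite !expr0 subrr add0r.
  rewrite -/(f w) -/(f (q * w)); move: (f w) (f (q * w)) => u v h.
  have -> : (1 - w) * u = u - v - (w * u - A * w * v) + (1 - A * w) * v by ring.
  by rewrite h subrr add0r.
split; first by apply: hs.
have hit n : f z * qfact z n = qfact (A * z) n * f (q ^+ n * z).
  elim: n => [|n IH]; first by rewrite !qfact0 mulr1 mul1r expr0 mul1r.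
  have qz : `|q ^+ n * z| <= `|z| by rewrite mulrC norm_cq_le.
  have := hf _ qz; rewrite exprS -[q * _ * z]mulrA.
  move: (f (q * _)) => v h; rewrite !qfactSr mulrA IH.
  move: (f (q ^+ n * z)) h => u h.
  by rewrite -mulrA [u * _]mulrC [z * _]mulrC h; ring.
have hlim : (fun n => f (q ^+ n * z)) ~> 1.
  have -> : 1 = csum (fun m => if m is 0 then 1 else 0 : C).
    apply/esym/has_csum_csum; rewrite -[X in has_csum _ X]addr0.
    by apply: (has_csumS (fun m => if m is 0 then 1 else 0 : C) _).1;
      exact: has_csum0.
  apply: (@tannery _ _ _ (fun m => B * `|z| ^+ m)).
  - move=> [|m].
      by apply: clim_eq (clim_cst 1) => n; rewrite /c !qfact0 expr0 divr1 mulr1.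
    have h := climZ (c m.+1 * z ^+ m.+1)
      (geom_clim0 (qX_ge0 hq m.+1) (qX_lt1 hq m)).
    rewrite mulr0 in h; apply: clim_eq h => n.
    by rewrite exprMn -!exprM [(n * _)%N]mulnC; ring.
  - move=> n m; rewrite normrM ler_pM // normrX lerXn2r ?nnegrE //.
    by rewrite normrM qX_norm // ler_piMl // qX_le1.
  - exact: abs_summableZ (abs_summable_geom _ _).
have h1 := climZ (f z) (qfact_clim hq z).
have h2 := climM (qfact_clim hq (A * z)) hlim; rewrite mulr1 in h2.
apply: clim_unique h1 _; apply: clim_eq h2 => n; by rewrite hit.
Qed.

Lemma has_zsum_unshiftn (f : int -> C) l n : has_zsum (fun k => f (k - n%:Z)) l
  -> has_zsum f l.
Proof.
elim: n => [|n IH] h; first by apply: has_zsum_eq h => k; rewrite subr0.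
apply: IH; apply: has_zsum_eq (has_zsum_shift h) => k; congr f; clear; lia.
Qed.

Section Psi11.
Variables (c z : C).
Hypotheses (c0 : c != 0) (z0 : z != 0) (z1 : `|z| < 1).
Hypothesis hc : forall k, 1 - c * q ^ k != 0.

Lemma qfact_inf_cqz_neq0 k : qfact_inf (c * q ^ k) != 0.
Proof.
apply: (qfact_inf_neq0 hq) => n; have := hc (k + n).
by rewrite expfzDr // mulrA.
Qed.

Lemma lin_qc_neq0 n : 1 - q / c * q ^+ n != 0.
Proof.
have := hc (- n.+1%:Z); apply: contraNneq => h.
rewrite -exprnN exprS (_ : _ - _ = - (1 - q / c * q ^+ n) * (c / (q * q ^+ n))).
  by rewrite h oppr0 mul0r.
by field; rewrite c0 qn0 expf_neq0.
Qed.

(** Towards plus infinity the terms are comparable to [z^k] with [`|z| < 1];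
    towards minus infinity the denominators grow so fast that the ratio of
    successive terms tends to zero. *)
Lemma ramanujan_summable : abs_zsummable
  (fun k => z ^ k / qfact_inf (c * q ^ k)).
Proof.
split.
  have [B B0 hB] : exists2 B, 0 < B & forall n : nat,
    `|(qfact_inf (c * q ^+ n))^-1| <= B.
    apply: clim_bounded (climV (oner_neq0 _) _).
    exact: (qfact_inf_clim1 hq) (clim_cq hq c).
  apply: (@abs_summable_geom_le _ _ B `|z|) => // n.
  by rewrite mulrC normrM -exprnP normrX ler_pM.
pose r n := z^-1 * (q ^+ n.+2 / c) / (q ^+ n.+2 / c - 1).
have cq n : q ^+ n + -1 * c != 0.
  have := hc (- n%:Z); apply: contraNneq => h.
  rewrite -exprnN (_ : _ - _ = (q ^+ n + -1 * c) / q ^+ n);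
    first by rewrite h mul0r.
  by field; rewrite expf_neq0.
have h2 : (0 : C) < 2^-1 by rewrite invr_gt0.
have [||B B0 hB] := @geom_bound_of_ratio0 _ (fun n => z ^ (Negz n) / qfact_inf
  (c * q ^ (Negz n))) r (2^-1) _ _ h2.
- move=> n; rewrite /r /= !NegzE.
  have e1 : q ^ (- n.+1%:Z) = q ^ (- n.+2%:Z) * q.
    by rewrite -(expfzS _ qn0); congr (q ^ _); clear; lia.
  have e2 : z ^ (- n.+1%:Z) = z ^ (- n.+2%:Z) * z.
    by rewrite -(expfzS _ z0); congr (z ^ _); clear; lia.
  rewrite e1 e2 (qfact_infS hq (c * q ^ (- n.+2%:Z)))
    [c * (q ^ (- n.+2%:Z) * q)]mulrA.
  have hne : qfact_inf (c * q ^ (- n.+2%:Z) * q) != 0 by rewrite -mulrA -e1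
    qfact_inf_cqz_neq0.
  have e3 : 1 - c * q ^ (- n.+2%:Z) = (q ^+ n.+2 / c - 1) * (c / q ^+ n.+2).
    by rewrite -exprnN; field; rewrite c0 expf_neq0.
  rewrite e3; field.
  by rewrite hne c0 cq z0 expf_neq0.
- have hy : (fun n => q ^+ n.+2 / c) ~> 0.
    have := (climSn 2 _ _).1 (clim_cq hq c^-1); apply: clim_eq => n.
    by rewrite addn2 mulrC.
  have := climM (climZ z^-1 hy) (climV _ (climB hy (clim_cst 1))).
  rewrite mulr0 mul0r; apply; by rewrite sub0r oppr_eq0 oner_neq0.
apply: abs_summable_geom_le hB; first exact: ltW.
by rewrite invf_lt1 // ltr1n.
Qed.

(** The q-binomial series with [A = c q^-n] and its index shifted by [n];
    termwise it tends to [(q; q)_oo^-1 z^k / (c q^k; q)_oo]. *)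
Let F n k : C := if (k + n%:Z) is Posz m then z ^ k /
  (qfact q m * qfact_inf (c * q ^ k)) else 0.

Lemma ramanujan_shifted n : has_zsum (F n)
  (qfact_inf (c * z) * qfact (q / (c * z)) n /
    (qfact_inf c * qfact (q / c) n * qfact_inf z)).
Proof.
apply: (@has_zsum_unshiftn _ _ n); rewrite /F.
have qz0 : qfact_inf z != 0 by exact: qfact_inf_neq0_lt1.
have nA : qfact_inf (c * q ^ (- n%:Z)) != 0 by apply: qfact_inf_cqz_neq0.
have [hb hs] := q_binomial (c * q ^ (- n%:Z)) z1.
have h1 := has_csumZ (z ^ (- n%:Z) / qfact_inf (c * q ^ (- n%:Z)))
  (abs_summable_has_csum hb).
have -> : qfact_inf (c * z) * qfact (q / (c * z)) n /
  (qfact_inf c * qfact (q / c) n * qfact_inf z) =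
    z ^ (- n%:Z) / qfact_inf (c * q ^ (- n%:Z)) *
      (qfact_inf (c * q ^ (- n%:Z) * z) / qfact_inf z).
  elim: n {nA hb hs h1} => [|n IH].
    by rewrite !qfact0 oppr0 !expr0z !mulr1 mul1r invfM; ring.
  have e1 : q ^ (- n%:Z) = q ^ (- n.+1%:Z) * q.
    by rewrite -(expfzS _ qn0); congr (q ^ _); clear; lia.
  have e2 : z ^ (- n%:Z) = z ^ (- n.+1%:Z) * z.
    by rewrite -(expfzS _ z0); congr (z ^ _); clear; lia.
  have := IH; rewrite e1 e2.
  rewrite (qfact_infS hq (c * q ^ (- n.+1%:Z)))
    (qfact_infS hq (c * q ^ (- n.+1%:Z) * z)) !qfactSr.
  set X := q ^ (- n.+1%:Z).
  have -> : c * X * z * q = c * (X * q) * z by ring.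
  rewrite -[c * X * q]mulrA.
  have p0 : qfact_inf (c * (X * q)) != 0 by rewrite -e1 qfact_inf_cqz_neq0.
  have p1 : qfact_inf c != 0 by have := qfact_inf_cqz_neq0 0;
    rewrite expr0z mulr1.
  have p2 : qfact (q / c) n != 0 by apply: qfact_neq0 => m _;
    exact: lin_qc_neq0.
  have XE : X = (q * q ^+ n)^-1 by rewrite /X -exprnN exprS.
  have p3 : 1 - c * X != 0 by exact: hc.
  have p4 := lin_qc_neq0 n.
  have p5 : 1 - q / (c * z) * q ^+ n = (1 - c * X * z) *
    (- (q * q ^+ n) / (c * z)).
    by rewrite XE; field; rewrite c0 z0 qn0 expf_neq0.
  have p6 : 1 - q / c * q ^+ n = (1 - c * X) * (- (q * q ^+ n) / c).
    by rewrite XE; field; rewrite c0 qn0 expf_neq0.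
  have Z0 : z ^ (- n.+1%:Z) != 0 by rewrite expfz_neq0.
  move=> {}IH.
  have -> : qfact_inf (c * z) *
    (qfact (q / (c * z)) n * (1 - q / (c * z) * q ^+ n)) /
    (qfact_inf c * (qfact (q / c) n * (1 - q / c * q ^+ n)) * qfact_inf z) =
    qfact_inf (c * z) * qfact (q / (c * z)) n /
      (qfact_inf c * qfact (q / c) n * qfact_inf z) *
    ((1 - q / (c * z) * q ^+ n) / (1 - q / c * q ^+ n)).
    by rewrite !invfM; ring.
  rewrite IH p5 p6; field.
  by rewrite c0 z0 qz0 p0 p3 qn0 expf_neq0.
exists (z ^ (- n%:Z) / qfact_inf (c * q ^ (- n%:Z)) *
  (qfact_inf (c * q ^ (- n%:Z) * z) / qfact_inf z)), 0.
split; last by rewrite addr0.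
- rewrite -hs mulfK //; apply: has_csum_eq h1 => m.
  rewrite subrK.
  rewrite expfzDr // (expfzDr m%:Z) // -!exprnP.
  rewrite (qfact_inf_split hq m (c * q ^ (- n%:Z))) in nA *.
  have n1 := nA; rewrite mulf_eq0 negb_or in n1; case/andP: n1 => n1 n2.
  rewrite [q ^+ m * _]mulrC [c * (_ * q ^+ m)]mulrA.
  by field; rewrite n1 n2 qfact_q_neq0.
- apply: has_csum_eq (@has_csum0 R) => k.
  by rewrite subrK.
Qed.

(** Ramanujan's summation of the bilateral series 1psi1 with vanishing lower
    parameter, the limit of the shifted q-binomial sums. *)
Lemma ramanujan_1psi1 : zsum (fun k => z ^ k / qfact_inf (c * q ^ k)) =
  qfact_inf q * (qfact_inf (c * z) * qfact_inf (q / (c * z))) /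
    (qfact_inf c * qfact_inf (q / c) * qfact_inf z).
Proof.
have qz0 : qfact_inf z != 0 by exact: qfact_inf_neq0_lt1.
have p1 : qfact_inf c != 0 by have := qfact_inf_cqz_neq0 0;
  rewrite expr0z mulr1.
have p2 : qfact_inf (q / c) != 0 := qfact_inf_neq0 hq lin_qc_neq0.
have [B B0 hB] := qfact_q_inv_bound.
have H1 : (fun n => zsum (F n)) ~> zsum
  (fun k => (qfact_inf q)^-1 * (z ^ k / qfact_inf (c * q ^ k))).
  apply: (@ztannery _ _ _ (fun k => `|B * (z ^ k / qfact_inf (c * q ^ k))|)).
  - move=> k; have [N [m hm]] := int_addn_nat k; apply/(climSn N).
    have := climM (climV qfact_inf_q_neq0 ((climSn m _ _).1 (qfact_clim hq q)))
             (clim_cst (z ^ k / qfact_inf (c * q ^ k))).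
    apply: clim_eq => n; rewrite /F.
    rewrite PoszD addrCA hm -PoszD.
    by rewrite invfM; ring.
  - move=> n k; rewrite /F; case: (k + n%:Z) => m; last by rewrite normr0.
    rewrite (_ : _ / _ = (qfact q m)^-1 * (z ^ k / qfact_inf (c * q ^ k)));
      last first.
      by rewrite invfM; ring.
    by rewrite normrM [leRHS]normrM ler_wpM2r // (gtr0_norm B0).
  - apply: (abs_zsummable_le _ (abs_zsummableZ B ramanujan_summable)) => k;
    by rewrite normr_id.
have H2 : (fun n => zsum (F n)) ~>
    (qfact_inf (c * z) * qfact_inf (q / (c * z)) /
      (qfact_inf c * qfact_inf (q / c) * qfact_inf z)).
  have d0 : qfact_inf c * qfact_inf (q / c) * qfact_inf z != 0 by rewrite
    !mulf_neq0.
  have h := climM (climZ (qfact_inf (c * z)) (qfact_clim hq (q / (c * z))))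
    (climV d0 (climM (climZ (qfact_inf c) (qfact_clim hq (q / c)))
      (clim_cst (qfact_inf z)))).
  by apply: clim_eq h => n; rewrite (has_zsum_zsum (ramanujan_shifted n)).
have H3 :=
  has_zsum_zsum
    (has_zsumZ (qfact_inf q)^-1 (abs_zsummable_has_zsum ramanujan_summable)).
have H := clim_unique H1 H2; rewrite H3 in H.
by rewrite -mulrA -H mulrA mulfV ?mul1r // qfact_inf_q_neq0.
Qed.

End Psi11.
End Summations.

(** * The total mass of the weight: recursion *)

Section Mass.
Variable R : realType.
Notation C := R[i].
Variables q t : C.
Hypothesis hq : 0 < q < 1.
Hypothesis t0 : 0 < t.
Implicit Types (a b c x z : C) (n : nat) (k : int).

Let q0 : 0 < q. Proof. by case/andP: hq. Qed.
Let q1 : q < 1. Proof. by case/andP: hq. Qed.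
Let qn0 : q != 0. Proof. by rewrite gt_eqF. Qed.
Let tn0 : t != 0. Proof. by rewrite gt_eqF. Qed.
Local Notation qfact_inf := (qfact_inf q).
Local Notation qfact := (qfact q).
Local Notation wgt := (wgt q).
Local Notation pearson := (pearson q).
Local Notation nondeg := (nondeg q t).

Lemma tq_neq0 k : t * q ^ k != 0.
Proof. by rewrite mulf_neq0 // expfz_neq0. Qed.

Lemma tq_gt0 k : 0 < t * q ^ k.
Proof. by rewrite mulr_gt0 // qz_gt0. Qed.

Lemma tqS k : t * q ^ (k + 1) = q * (t * q ^ k).
Proof. by rewrite expfzS //; ring. Qed.

Lemma nondeg_neg1 c n : nondeg c -> 1 + c * - q ^+ n != 0.
Proof. by case=> _ h _; rewrite mulrN. Qed.

Lemma nondeg_pos1 c k : nondeg c -> 1 + c * (t * q ^ k) != 0.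
Proof. by case=> _ _ h; rewrite mulrA. Qed.

(** Towards [0] the points themselves form a geometric sequence; towards
    infinity the weight outruns the growth rate [r]. *)
Lemma pos_abs_summable a b (f : int -> C) (D r : C) : nondeg a -> nondeg b ->
  0 < r ->
  (forall n, `|f n%:Z| <= D) ->
  (forall n, `|f (Negz n)| <= D * r ^+ n) ->
  abs_zsummable (fun k => f k * wgt a b (t * q ^ k) * (t * q ^ k)).
Proof.
move=> ha hb r0 hf1 hf2; split.
  have [B B0 hB] := clim_bounded (wgt_clim1 hq a b (clim_cq hq t)).
  apply: (@abs_summable_geom_le _ _ (D * B * t) q); rewrite ?(ltW q0) // => n.
  rewrite -exprnP normrM3 [`|t * _|]normrM (gtr0_norm t0) qX_norm // mulrA.
  rewrite ler_wpM2r ?qX_ge0 // ler_wpM2r ?(ltW t0) // ler_pM //.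
have s0 : 0 < q / (r * 2) by rewrite divr_gt0 // mulr_gt0.
have [B B0 hB] := wgt_decay hq t0 ha hb s0.
apply: (@abs_summable_geom_le _ _ (D * B / (r * 2) * t) (2^-1)).
- by rewrite invr_ge0.
- by rewrite invf_lt1 // ltr1n.
- move=> n; have := hB n.+1; rewrite NegzE => hw.
  rewrite normrM3 (gtr0_norm (tq_gt0 _)).
  have D0 : 0 <= D by apply: le_trans (hf1 0%N).
  have := ler_pM (normr_ge0 _) (normr_ge0 _) (hf2 n) hw.
  rewrite NegzE => h.
  apply: (@le_trans _ _ (D * r ^+ n * (B * (q / (r * 2)) ^+ n.+1) *
    (t * q ^ (- n.+1%:Z)))).
    by rewrite ler_wpM2r // ltW // tq_gt0.
  rewrite -exprnN exprMn exprVn exprMn le_eqVlt; apply/orP; left; apply/eqP.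
  by rewrite exprVn !exprS; field; rewrite !expf_neq0 ?gt_eqF // qn0.
Qed.

Lemma neg_abs_summable a b (f : nat -> C) (D : C) :
  (forall n, `|f n| <= D) -> abs_summable (fun n => f n * wgt a b (- q ^+ n) * q
    ^+ n).
Proof.
move=> hf.
have h0 : (fun n => - q ^+ n) ~> 0.
  by have := clim_cq hq (-1); apply: clim_eq => n; rewrite mulN1r.
have [B B0 hB] := clim_bounded (wgt_clim1 hq a b h0).
apply: (@abs_summable_geom_le _ _ (D * B) q); rewrite ?(ltW q0) // => n.
rewrite normrM3 qX_norm // ler_wpM2r ?qX_ge0 // ler_pM //; exact: hB.
Qed.

Definition mass_neg a b := csum (fun n => wgt a b (- q ^+ n) * q ^+ n).
Definition mass_pos a b := zsum (fun k => wgt a b (t * q ^ k) * (t * q ^ k)).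
Definition mass a b := mass_neg a b + mass_pos a b.

Lemma mass_neg_abs_summable a b : abs_summable
  (fun n => wgt a b (- q ^+ n) * q ^+ n).
Proof.
apply: (abs_summable_le _ (@neg_abs_summable a b (fun=> 1) 1 _)) => n;
  last by rewrite normr1.
by rewrite mul1r.
Qed.

Lemma mass_pos_abs_summable a b : nondeg a -> nondeg b ->
  abs_zsummable (fun k => wgt a b (t * q ^ k) * (t * q ^ k)).
Proof.
move=> ha hb;
  apply: (abs_zsummable_le _ (@pos_abs_summable a b (fun=> 1) 1 1 ha hb _ _
    _)) => //.
- by move=> k; rewrite mul1r.
- by move=> n; rewrite normr1.
- by move=> n; rewrite normr1 expr1n mulr1.
Qed.

Lemma mass_sym a b : mass a b = mass b a.
Proof.
rewrite /mass /mass_neg /mass_pos; congr (csum _ + zsum _); apply/funext => k.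
  by rewrite (wgt_sym q a b).
by rewrite (wgt_sym q a b).
Qed.

(** Integrating [pearson_diff] over both halves of the support relates the
    first moment to the mass, and [1 + a x] turns the weight of [(a, b)]
    into that of [(a q, b)]. *)
Lemma mass_mulq a b : nondeg a -> nondeg b -> mass (a * q) b = (1 - a) / b *
  mass a b.
Proof.
move=> ha hb; have [b0 _ _] := hb; have [a0 _ _] := ha.
(* [pearson] vanishes at [-1] and at infinity and tends to [1] at [0] from
   both sides. *)
have hneg : has_csum (fun n => (1 - a - b - a * b * - q ^+ n) *
  (- q ^+ n * wgt a b (- q ^+ n))) (-1).
  have hl : (fun n => pearson a b (- q ^+ n)) ~> 1.
    apply: pearson_clim1 => //.
    by have := clim_cq hq (-1); apply: clim_eq => n; rewrite mulN1r.
  have := telescope_has_csum hl.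
  rewrite [pearson a b (- q ^+ 0)]pearsonE // expr0 subrr mul0r sub0r.
  apply: has_csum_eq => n; rewrite -pearson_diff ?nondeg_neg1 //.
  by rewrite mulrN -exprS.
have hdec : (fun n => pearson a b (t * q ^ (Negz n))) ~> 0.
  have [] := @pos_abs_summable a b (fun k => if k is Negz n then (1 + t * q ^ k)
    / (t * q ^ k) else 0) ((1 + t) / t) 1 ha hb ltr01.
  - move=> n; rewrite normr0 divr_ge0 ?(ltW t0) // addr_ge0 // ltW //.
  - move=> n; rewrite expr1n mulr1 ger0_norm; last first.
      by rewrite divr_ge0 ?addr_ge0 ?ltW // tq_gt0.
    have ty : t <= t * q ^ Negz n.
      rewrite -[leLHS]mulr1 ler_wpM2l ?(ltW t0) // NegzE -exprnN.
      by rewrite invf_ge1 ?qX_gt0 // qX_le1.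
    move: (t * q ^ Negz n) ty (tq_gt0 (Negz n)) => y ty y0.
    rewrite ler_pdivrMr // mulrAC ler_pdivlMr // !mulrDl !mul1r [y * t]mulrC.
    by rewrite lerD2r.
  move=> _ /abs_summable_clim0; apply: clim_eq => n.
  by rewrite pearsonE // mulrAC divfK ?tq_neq0.
have hpos : has_zsum (fun k => (1 - a - b - a * b * (t * q ^ k)) *
  (t * q ^ k * wgt a b (t * q ^ k))) (-1).
  have := @has_zsum_telescope _ (fun k => pearson a b (t * q ^ k)) 1 0 _ hdec;
    rewrite sub0r.
  move=> /(_ (pearson_clim1 hq a b (clim_cq hq t))).
  by apply: has_zsum_eq => k; rewrite -pearson_diff ?nondeg_pos1 // tqS.
(* [(1 - a) - (1 - a - b - a * b * x) = b * (1 + a * x)]. *)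
have E x : 1 + a * x != 0 ->
    (1 - a) / b * (x * wgt a b x) + - b^-1 *
      ((1 - a - b - a * b * x) * (x * wgt a b x))
    = x * wgt (a * q) b x.
  by move=> h; rewrite wgt_mulq //; field.
have hn :=
  has_csumD
    (has_csumZ ((1 - a) / b)
      (abs_summable_has_csum (mass_neg_abs_summable a b)))
  (has_csumZ b^-1 hneg).
have hp :=
  has_zsumD
    (has_zsumZ ((1 - a) / b)
      (abs_zsummable_has_zsum (mass_pos_abs_summable ha hb)))
  (has_zsumZ (- b^-1) hpos).
rewrite /mass; apply: (@eq_trans _ _ ((1 - a) / b * mass_neg a b + b^-1 * -1 +
   ((1 - a) / b * mass_pos a b + - b^-1 * -1))); last by ring.
congr (_ + _).
  apply: has_csum_csum; apply: has_csum_eq hn => n.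
  have := E (- q ^+ n) (nondeg_neg1 n ha); rewrite !mulNr => h.
  apply: oppr_inj; rewrite [RHS](_ : _ = - (q ^+ n * wgt (a * q) b (- q ^+ n)));
    last by rewrite mulrC.
  by rewrite -h; ring.
apply: has_zsum_zsum; apply: has_zsum_eq hp => k.
by rewrite [RHS]mulrC -E ?nondeg_pos1 //; ring.
Qed.

Lemma mass_mulqn a b n : nondeg a -> nondeg b ->
  b ^+ n * mass (a * q ^+ n) b = qfact a n * mass a b.
Proof.
move=> ha hb; elim: n => [|n IH]; first by rewrite qfact0 expr0 mulr1.
have hn := nondegMX hq n ha; have [b0 _ _] := hb.
rewrite exprSr [q ^+ _]exprSr mulrA mass_mulq // qfactSr [RHS]mulrAC -IH.
by field.
Qed.

End Mass.

Lemma int_geom (K : fieldType) (F : int -> K) b : b != 0 ->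
  (forall k, F (k + 1) = b * F k) ->
  forall k : int, F k = b ^ k * F 0.
Proof.
move=> b0 hF; case=> n.
  elim: n => [|n IH]; first by rewrite mul1r.
  by rewrite -addn1 PoszD hF IH expfzS // [_ * b]mulrC mulrA.
suff : b ^+ n.+1 * F (Negz n) = F 0.
  by move=> <-; rewrite NegzE -exprnN mulKf // expf_neq0.
elim: n => [|n IH]; first by rewrite expr1 -hF.
by rewrite exprSr -mulrA -hF -IH; congr (_ * F _); rewrite !NegzE; clear; lia.
Qed.

(** * The total mass of the weight: closed form *)

Section MassFormula.
Variable R : realType.
Notation C := R[i].
Variables q t : C.
Hypothesis hq : 0 < q < 1.
Hypothesis t0 : 0 < t.
Implicit Types (a b c x z : C) (n : nat) (k : int).

Let q0 : 0 < q. Proof. by case/andP: hq. Qed.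
Let q1 : q < 1. Proof. by case/andP: hq. Qed.
Let qn0 : q != 0. Proof. by rewrite gt_eqF. Qed.
Let tn0 : t != 0. Proof. by rewrite gt_eqF. Qed.
Local Notation qfact_inf := (qfact_inf q).
Local Notation qfact := (qfact q).
Local Notation wgt := (wgt q).
Local Notation nondeg := (nondeg q t).
Local Notation mass := (mass q t).

Definition theta1 x : C := qfact_inf x * qfact_inf (q / x).

Definition mass_value a b : C := t * (qfact_inf q / (qfact_inf a * qfact_inf b))
  *
  (theta1 (- a * b * t) * theta1 (-1 / t) /
    (theta1 (- a * t) * theta1 (- b * t))).

Lemma wgt_mulqn a b x n : (forall j, 1 + a * (x * q ^+ j) != 0) ->
  wgt (a * q ^+ n) b x = qfact (- a * x) n * wgt a b x.
Proof.
move=> h; elim: n => [|n IH]; first by rewrite qfact0 expr0 mulr1 mul1r.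
rewrite exprSr mulrA wgt_mulq //; last by rewrite -mulrA [q ^+ n * x]mulrC h.
by rewrite IH qfactSr; ring.
Qed.

Section Small.
Variables a b : C.
Hypotheses (ha : nondeg a) (hb : nondeg b).
Hypothesis bsmall : `|b| * (1 + 2 * q * t) <= q.

Let b0 : b != 0. Proof. by case: hb. Qed.
Let a0 : a != 0. Proof. by case: ha. Qed.

Lemma norm_b_lt1 : `|b| < 1.
Proof.
apply: le_lt_trans q1; apply: le_trans bsmall.
by rewrite ler_peMr // lerDl !mulr_ge0 // ltW.
Qed.

(** Multiplying [a] by [q^n] changes the weight on [- q^k] by a bounded
    factor only, while [b^n] tends to zero. *)
Lemma mass_neg_lim : (fun n => b ^+ n * mass_neg q (a * q ^+ n) b) ~> 0.
Proof.
have [B B0 hB] := qfact_bound hq (normr_ge0 a).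
have [D hD] := mass_neg_abs_summable hq a b.
have hl : (fun n => B * D * b ^+ n) ~> 0.
  have := climZ (B * D) (geom_clim0 (normr_ge0 b) norm_b_lt1);
    rewrite mulr0 => h.
  apply: clim0_le _ h => n; by rewrite [leLHS]normrM [leRHS]normrM !normrX
    normr_id.
apply: clim0_le hl => n; rewrite [leLHS]normrM [leRHS]normrM mulrC ler_wpM2r //.
have D0 : 0 <= D by apply: le_trans (hD 0%N); rewrite big_ord0.
rewrite (ger0_norm (mulr_ge0 (ltW B0) D0)).
apply: csum_norm_le => m;
  apply: (@le_trans _ _ (\sum_(k < m) B * `|wgt a b (- q ^+ k) * q ^+ k|)).
  apply: ler_sum => k _; rewrite wgt_mulqn; last first.
    move=> j; rewrite mulNr -exprD; exact: nondeg_neg1 ha.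
  rewrite -mulrA normrM ler_wpM2r //; apply: le_trans (hB n).
  apply: norm_qfact_le => //; rewrite mulNr mulrN opprK normrM qX_norm //.
  by rewrite ler_piMr // qX_le1.
by rewrite -mulr_sumr ler_wpM2l // ltW.
Qed.

(** The factor by which the [n]-fold step [a -> a q], combined with moving
    the point [y] to [y / q^n], changes the integrand; see [term_shift]. *)
Definition shift_ratio (y : C) n : C := qfact (-1 / y) n / qfact (- q / (b * y))
  n.

Lemma den_neq0 k j : 1 - - q / (b * (t * q ^ k)) * q ^+ j != 0.
Proof.
have [_ _ h] := hb; have := h (k - j.+1%:Z); apply: contraNneq => e.
rewrite expfzDr // -exprnN exprS.
rewrite (_ : _ + _ = (1 - - q / (b * (t * q ^ k)) * q ^+ j) *
  (b * (t * q ^ k) / (q * q ^+ j))).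
  by rewrite e mul0r.
by field; rewrite b0 tn0 qn0 expf_neq0 // expfz_neq0.
Qed.

(** Without the shift each term tends to zero as [n] grows while the sum
    does not; recentred, the terms have a limit that carries the whole sum. *)
Lemma term_shift n k :
  b ^+ n * (wgt (a * q ^+ n) b (t * q ^ (k - n%:Z)) * (t * q ^ (k - n%:Z))) =
  wgt a b (t * q ^ k) * (t * q ^ k) * shift_ratio (t * q ^ k) n.
Proof.
set y := t * q ^ k.
have y0 : y != 0 by exact: tq_neq0.
have yE m : t * q ^ (k - m%:Z) = y / q ^+ m.
  by rewrite expfzDr // -exprnN mulrA.
rewrite yE /shift_ratio.
elim: n => [|n IH]; first by rewrite !qfact0 !expr0 !mulr1 divr1 mul1r divr1
  mulr1.
have hbn m : qfact_inf (- b * (y / q ^+ m)) != 0 by rewrite -yE;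
  exact: nondeg_pos.
have han : qfact_inf (- a * y) != 0 by exact: nondeg_pos.
have hd := den_neq0 k n; rewrite -/y in hd.
have hd1 : qfact (- q / (b * y)) n != 0 by apply: qfact_neq0 => j _;
  exact: den_neq0.
clearbody y; rewrite !qfactSr.
have e1 : qfact_inf (- q * (y / q ^+ n.+1)) = (1 + y / q ^+ n) * qfact_inf
  (- q * (y / q ^+ n)).
  rewrite (qfact_infS hq) (_ : - q * (y / q ^+ n.+1) = - (y / q ^+ n)).
    by rewrite opprK; congr (_ * qfact_inf _); ring.
  by rewrite exprS; field; rewrite qn0 expf_neq0.
have e2 : qfact_inf (- b * (y / q ^+ n.+1)) = (1 + b * (y / q ^+ n.+1)) *
  qfact_inf (- b * (y / q ^+ n)).
  rewrite (qfact_infS hq) mulNr opprK; congr (_ * qfact_inf _).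
  by rewrite exprS; field; rewrite qn0 expf_neq0.
have e3 m : - (a * q ^+ m) * (y / q ^+ m) = - a * y.
  by field; rewrite expf_neq0.
have hbq : 1 + b * (y / q ^+ n.+1) != 0.
  by have := hbn n.+1; rewrite e2 mulf_eq0 negb_or => /andP[].
have e4 : 1 + y / q ^+ n = (1 - -1 / y * q ^+ n) * (y / q ^+ n).
  by field; rewrite y0 expf_neq0.
have e5 : 1 + b * (y / q ^+ n.+1) = (1 - - q / (b * y) * q ^+ n) *
  (b * y / (q * q ^+ n)).
  by rewrite exprS; field; rewrite y0 b0 qn0 expf_neq0.
have -> : b ^+ n.+1 * (wgt (a * q ^+ n.+1) b (y / q ^+ n.+1) * (y / q ^+ n.+1)) =
  b ^+ n * (wgt (a * q ^+ n) b (y / q ^+ n) * (y / q ^+ n)) *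
   ((1 - -1 / y * q ^+ n) / (1 - - q / (b * y) * q ^+ n)).
  rewrite !wgtE !e3 e1 e2 e4 e5.
  set A := qfact_inf (- q * _); set B := qfact_inf (- a * y);
    set D := qfact_inf _.
  set U := 1 - -1 / y * _; set V := 1 - - q / _ * _.
  rewrite !exprS !invfM !invrK.
  rewrite (_ : b * b ^+ n * _ = b ^+ n * (A * (B^-1 * D^-1) * (y * (q ^+ n)^-1))
    * (U * V^-1) *
     ((b * b^-1) * (q * q^-1) * (y * y^-1) * (q ^+ n * (q ^+ n)^-1)));
       last by ring.
  by rewrite !mulfV ?expf_neq0 // !mulr1.
by rewrite IH !invfM; ring.
Qed.

(** The ratio is a product of values of the Moebius map [rho]. Where its
    argument is large, the smallness of [b] bounds [rho] by [1]; elsewhere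
    the arguments lie in the sequence [q^i / t], along which [rho - 1] is
    geometrically small. *)
Lemma shift_ratio_bound : exists2 E, 0 < E & forall n k,
  `|shift_ratio (t * q ^ k) n| <= E.
Proof.
pose rho (u : C) := (1 + u) / (1 + q / b * u).
have rtE y n : shift_ratio y n = \prod_(j < n) rho (q ^+ j / y).
  rewrite /shift_ratio -prodf_div; apply: eq_bigr => j _; rewrite /rho.
  by congr (_ / _); rewrite ?invfM; ring.
(* The bound on [b] makes the denominator of [rho] dominate its numerator. *)
have big u : 1 / (q * t) <= u -> `|rho u| <= 1.
  move=> hu; have qt0 : 0 < q * t by rewrite mulr_gt0.
  have u0 : 0 < u by apply: lt_le_trans hu; rewrite divr_gt0.
  have hqb : 1 + 2 * q * t <= `|q / b|.
    by rewrite normrM normfV (gtr0_norm q0) ler_pdivlMr ?normr_gt0 // mulrC.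
  have h1 : 1 + u <= `|1 + q / b * u|.
    have : `|q / b * u| - `|1 : C| <= `|q / b * u + 1|.
      by rewrite lerBlDr -{1}(addrK 1 (q / b * u)); exact: ler_normB.
    rewrite [1 + q / b * u]addrC; apply: le_trans.
    rewrite normr1 normrM (gtr0_norm u0) lerBrDr.
    apply: (@le_trans _ _ ((1 + 2 * q * t) * u)); last first.
      by rewrite ler_wpM2r ?(ltW u0).
    rewrite mulrDl mul1r (_ : 1 + u + 1 = u + 2 * 1); last by ring.
    rewrite lerD2l -!mulrA ler_wpM2l // mulrA.
    by move: hu; rewrite ler_pdivrMr // mulrC.
  rewrite /rho normrM normfV ler_pdivrMr; last first.
    by apply: lt_le_trans h1; rewrite addr_gt0.
  by rewrite mul1r ger0_norm // addr_ge0 // ltW.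
have [D D0 hD] : exists2 D, 0 < D & forall i, `|(1 + q / b * (q ^+ i / t))^-1|
  <= D.
  apply: (@clim_bounded _ _ 1); rewrite -[X in _ ~> X]invr1.
  apply: climV; first exact: oner_neq0.
  have := climD (clim_cst 1) (clim_cq hq (q / (b * t))); rewrite addr0.
  by apply: clim_eq => n; rewrite invfM; ring.
have nz i : 1 + q / b * (q ^+ i / t) != 0.
  have := den_neq0 0 i; rewrite expr0z mulr1; congr (_ != 0).
  by rewrite invfM; ring.
pose K := `|1 - q / b| / t * D.
have K0 : 0 <= K by rewrite !mulr_ge0 ?invr_ge0 // ltW.
have small i : `|rho (q ^+ i / t)| <= 1 + K * q ^+ i.
  have -> : rho (q ^+ i / t) = 1 + (1 - q / b) * (q ^+ i / t) /
    (1 + q / b * (q ^+ i / t)).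
    rewrite /rho; apply: (mulIf (nz i)).
    by rewrite divfK // mulrDl mul1r divfK //; ring.
  apply: le_trans (ler_normD _ _) _; rewrite normr1 lerD2l normrM.
  rewrite normrM normrM normfV (gtr0_norm t0) qX_norm //.
  rewrite /K [leRHS]mulrAC ler_pM // ?mulr_ge0 ?invr_ge0 ?qX_ge0 // ?(ltW t0)
    //.
  by rewrite le_eqVlt; apply/orP; left; apply/eqP; ring.
(* The arguments of [rho] are [q^(j - k) / t]: those with [j < k] are large,
   and the others are covered by [small] with distinct exponents. *)
have [E E0 hE] := qfact_bound hq K0.
exists E => // n k; rewrite rtE normr_prod; case: k => m.
  apply: le_trans (hE (n - m)%N); rewrite -exprnP.
  elim: n => [|n IH]; first by rewrite big_ord0 sub0n qfact0.
  rewrite big_ord_recr /=; have [mn|nm] := leqP m n.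
    rewrite subSn // qfactSr ler_pM // ?prodr_ge0 //.
    rewrite (_ : q ^+ n / (t * q ^+ m) = q ^+ (n - m) / t).
      by apply: le_trans (small _) _; rewrite mulNr opprK.
    by rewrite -{1}(subnK mn) exprD; field; rewrite tn0 expf_neq0.
  rewrite (_ : (n.+1 - m)%N = (n - m)%N); last by clear -nm; lia.
  rewrite -[leRHS]mulr1 ler_pM // ?prodr_ge0 //; apply: big.
  rewrite -(subnKC nm) exprD exprSr.
  rewrite (_ : q ^+ n / _ = (q * t)^-1 / q ^+ (m - n.+1)).
    have h1 : 1 <= q ^- (m - n.+1) by rewrite invf_ge1 ?qX_gt0 // qX_le1.
    by rewrite mul1r ler_peMr // invr_ge0 ltW // mulr_gt0.
  by field; rewrite tn0 qn0 !expf_neq0.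
apply: le_trans (hE n); rewrite NegzE -exprnN.
apply: ler_prod => j _; rewrite normr_ge0 /=.
rewrite (_ : q ^+ j / (t / q ^+ m.+1) = q ^+ (j + m.+1) / t); last first.
  by rewrite exprD; field; rewrite tn0 expf_neq0.
apply: le_trans (small _) _; rewrite mulNr opprK lerD2l ler_wpM2l //.
by rewrite exprD ler_piMr ?qX_ge0 // qX_le1.
Qed.

(** In [b^n mass(a q^n, b) = (a; q)_n mass(a, b)] let [n] tend to infinity.
    The half [- q^k] contributes nothing, and the other half becomes a
    bilateral geometric series over [(- a t q^k; q)_oo]. *)
Lemma mass_formula_small : mass a b = mass_value a b.
Proof.
pose Y0 k := wgt a b (t * q ^ k) * (t * q ^ k).
pose Y k :=
  Y0 k * (qfact_inf (-1 / (t * q ^ k)) / qfact_inf (- q / (b * (t * q ^ k)))).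
have hpos : (fun n => b ^+ n * mass_pos q t (a * q ^+ n) b) ~> zsum Y.
  have [E E0 hE] := shift_ratio_bound.
  have H : (fun n => zsum (fun k => Y0 k * shift_ratio (t * q ^ k) n)) ~> zsum
    Y.
    apply: (@ztannery _ _ _ (fun k => `|E * Y0 k|)).
    - move=> k; apply: climZ; apply: climM; first exact: qfact_clim.
      by apply: climV;
        [apply: (qfact_inf_neq0 hq) => j; exact: den_neq0|exact: qfact_clim].
    - by move=> n k; rewrite normrM [leRHS]normrM mulrC ler_wpM2r //
      (gtr0_norm E0).
    - apply: (abs_zsummable_le _
      (abs_zsummableZ E (mass_pos_abs_summable hq t0 ha hb))) => k.
      by rewrite normr_id.
  apply: clim_eq H => n; apply: has_zsum_zsum.
  have := has_zsumZ (b ^+ n)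
    (has_zsum_shiftn n
      (abs_zsummable_has_zsum (mass_pos_abs_summable hq t0 (nondegMX hq n ha)
        hb))).
  by apply: has_zsum_eq => k; rewrite term_shift.
have H1 := climD mass_neg_lim hpos; rewrite add0r in H1.
have H2 := climM (qfact_clim hq a) (clim_cst (mass a b)).
have Ha : qfact_inf a * mass a b = zsum Y.
  apply: clim_unique H2 _; apply: clim_eq H1 => n.
  by rewrite -mulrDr -(mass_mulqn hq t0 n ha hb).
(* The limit [Y k] is [T (t q^k)] divided by [(- a t q^k; q)_oo], and [T] is
   geometric along the points. *)
pose T y := y * qfact_inf (- q * y) * qfact_inf (-1 / y) /
  (qfact_inf (- b * y) * qfact_inf (- q / (b * y))).
have hT k : T (t * q ^ k) = b ^ k * T t.
  rewrite -[in RHS](mulr1 t) -[in RHS](expr0z q).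
  apply: (int_geom (F := fun k => T (t * q ^ k))) => // {}k.
  have y0 := tq_neq0 hq t0 k; rewrite tqS //.
  have hb1 := nondeg_pos hq k hb; have hb1' := nondeg_pos1 k hb.
  have hbq : qfact_inf (- b * (q * (t * q ^ k))) != 0.
    by rewrite -tqS //; exact: nondeg_pos.
  have hd : qfact_inf (- q / (b * (t * q ^ k))) != 0.
    by apply: (qfact_inf_neq0 hq) => j; exact: den_neq0.
  have p0 := tq_gt0 hq t0 k.
  move: (t * q ^ k) y0 hb1 hb1' hbq hd p0 => y y0 hb1 hb1' hbq hd p0.
  rewrite /T [qfact_inf (- q * y)](qfact_infS hq)
    [qfact_inf (- b * y)](qfact_infS hq).
  rewrite [qfact_inf (-1 / (q * y))](qfact_infS hq)
    [qfact_inf (- q / (b * (q * y)))](qfact_infS hq).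
  have -> : -1 / (q * y) * q = -1 / y by field; rewrite y0 qn0.
  have -> : - q / (b * (q * y)) * q = - q / (b * y) by field; rewrite y0 qn0 b0.
  have -> : - b * y * q = - b * (q * y) by ring.
  have -> : - q * y * q = - q * (q * y) by ring.
  have d1 : 1 + q * y != 0 by rewrite gt_eqF // addr_gt0 // mulr_gt0.
  have d2 : 1 - - b * y != 0 by rewrite mulNr opprK.
  have d3 : 1 - - q / (b * (q * y)) = (1 - - b * y) / (b * y) by field;
    rewrite y0 qn0 b0.
  have d4 : 1 - -1 / (q * y) = (1 - - q * y) / (q * y) by field; rewrite y0 qn0.
  rewrite d3 d4 !invfM !invrK.
  set A := qfact_inf _; set B := qfact_inf _; set D := qfact_inf _;
    set E := qfact_inf _.
  set V := 1 - - b * y; set U := 1 - - q * y.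
  rewrite (_ : q * y * A * _ * _ = b * (y * (U * A) * B * (V^-1 / D / E)) *
     ((q * q^-1) * (y * y^-1))); last by ring.
  by rewrite !mulfV // !mulr1.
have c0 : - (a * t) != 0 by rewrite oppr_eq0 mulf_neq0.
have hc k : 1 - - (a * t) * q ^ k != 0.
  by have [_ _ h] := ha; rewrite mulNr opprK.
have hY : zsum Y = T t * zsum (fun k => b ^ k / qfact_inf (- (a * t) * q ^ k)).
  apply: has_zsum_zsum.
  have := has_zsumZ (T t)
    (abs_zsummable_has_zsum (ramanujan_summable hq c0 b0 norm_b_lt1 hc)).
  apply: has_zsum_eq => k; rewrite mulrA [T t * _]mulrC -hT /Y /Y0 /T wgtE.
  rewrite (_ : - (a * t) * q ^ k = - a * (t * q ^ k)); last by ring.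
  by rewrite !invfM; ring.
rewrite (ramanujan_1psi1 hq c0 b0 norm_b_lt1 hc) in hY.
have pa : qfact_inf a != 0.
  by have := nondeg_neg hq 0 ha; rewrite expr0 mulrN1 opprK.
apply: (mulfI pa); rewrite Ha hY /mass_value /theta1 /T.
rewrite (_ : q / (-1 / t) = - q * t); last by field.
rewrite (_ : - (a * t) * b = - a * b * t); last by ring.
rewrite (_ : q / (- b * t) = - q / (b * t)); last by rewrite !invfM invrN; ring.
rewrite -[- (a * t)]mulNr !invfM.
rewrite (_ : forall x y z w v,
  qfact_inf a * (t * (x * ((qfact_inf a)^-1 * y)) * (z * w * v)) =
    (qfact_inf a / qfact_inf a) * (t * (x * y) * (z * w * v)));
      last by move=> *; ring.
by rewrite mulfV // mul1r; ring.
Qed.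

End Small.

(** The theta function satisfies [theta(q x) = - x^-1 theta(x)], so the
    closed form obeys the recursion of the mass. *)
Lemma mass_value_mulq a b : nondeg a -> nondeg b -> mass_value a (b * q) =
  (1 - b) / a * mass_value a b.
Proof.
move=> ha hb; have [a0 _ _] := ha; have [b0 _ hbt] := hb.
have thq x : x != 0 -> theta1 (x * q) = - x^-1 * theta1 x.
  move=> x0; rewrite /theta1 [in RHS](qfact_infS hq x)
    [in LHS](qfact_infS hq (q / (x * q))).
  rewrite (_ : q / (x * q) * q = q / x); last by field; rewrite x0 qn0.
  rewrite (_ : 1 - q / (x * q) = - x^-1 * (1 - x)); last by field;
    rewrite x0 qn0.
  by ring.
have b1 : 1 - b != 0 by case: hb => _ /(_ 0%N); rewrite expr0 mulr1.
rewrite /mass_value (_ : - a * (b * q) * t = - a * b * t * q); last by ring.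
rewrite (_ : - (b * q) * t = - b * t * q); last by ring.
rewrite !thq ?mulf_neq0 ?oppr_eq0 //.
rewrite (qfact_infS hq b).
move: (theta1 (- a * b * t)) (theta1 (-1 / t)) (theta1 (- a * t))
  (theta1 (- b * t)) => T1 T2 T3 T4.
move: (qfact_inf (b * q)) (qfact_inf a) (qfact_inf q) => A D Q.
rewrite (_ : (- a * b * t)^-1 = - (a^-1 * b^-1 * t^-1)); last by field;
  rewrite a0 b0 tn0.
rewrite (_ : (- b * t)^-1 = - (b^-1 * t^-1)); last by field; rewrite b0 tn0.
rewrite !opprK !invfM !invrK.
rewrite (_ : (1 - b) / a * _ = a^-1 *
  (t * (Q * (D^-1 * A^-1)) * (T1 * T2 * (T3^-1 * T4^-1))) *
  ((1 - b) * (1 - b)^-1)); last by ring.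
rewrite [LHS](_ : _ = a^-1 *
  (t * (Q * (D^-1 * A^-1)) * (T1 * T2 * (T3^-1 * T4^-1))) *
  ((b * b^-1) * (t * t^-1))); last by ring.
by rewrite !mulfV // !mulr1.
Qed.

(** Both sides obey the same recursion in [b], which reduces the general
    case to small [b]. *)
Theorem mass_formula a b : nondeg a -> nondeg b -> mass a b = mass_value a b.
Proof.
move=> ha hb; have [a0 _ _] := ha.
have r0 : 0 <= `|b| * (1 + 2 * q * t).
  by rewrite mulr_ge0 // addr_ge0 // !mulr_ge0 // ltW.
(* Induction on the number of steps from [b] to [b * q] that make [b] small. *)
have [m] := qX_small hq r0 q0; elim: m b hb {r0} => [|m IH] b hb hm.
  by apply: mass_formula_small => //; move: hm; rewrite expr0 mulr1.
have b1 : 1 - b != 0 by case: hb => _ /(_ 0%N); rewrite expr0 mulr1.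
have := IH (b * q) (nondegM hq hb);
  rewrite mass_value_mulq // mass_sym mass_mulq // [mass b a]mass_sym.
move=> H; apply: (mulfI (mulf_neq0 b1 (invr_neq0 a0))); apply: H.
apply: le_trans hm; rewrite normrM (gtr0_norm q0) exprS.
by rewrite le_eqVlt; apply/orP; left; apply/eqP; ring.
Qed.

End MassFormula.

(** * The q-Meixner functions and their difference equation *)

Section PhiSeries.
Variable R : realType.
Notation C := R[i].
Variables q a b : C.
Hypothesis hq : 0 < q < 1.
Hypothesis ha : forall n, 1 - a * q ^+ n != 0.
Hypothesis hb : forall n, 1 - b * q ^+ n != 0.
Implicit Types (g x : C) (n k : nat).

Let q0 : 0 < q. Proof. by case/andP: hq. Qed.
Let q1 : q < 1. Proof. by case/andP: hq. Qed.
Let qn0 : q != 0. Proof. by rewrite gt_eqF. Qed.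
Local Notation qfact := (qfact q).

(** Equal to [x ^ n (-1 / x; q)_n] for nonzero [x], see [shifted_pow_qfact].
    This form is polynomial in [x], so that [phi] is defined and continuous
    at [0], and it makes [phi] symmetric. *)
Definition shifted_pow x n : C := \prod_(k < n) (x + q ^+ k).
Definition phi_coef n : C := (- (a * b)) ^+ n * q ^+ 'C(n, 2) /
  (qfact q n * qfact a n * qfact b n).
Definition phi_term g x n : C := phi_coef n * shifted_pow g n * shifted_pow x n.
Definition phi g x : C := csum (phi_term g x).
Definition phi_qdiff_term g x n : C := phi_coef n.+1 * shifted_pow g n.+1 *
  (1 - q ^+ n.+1) * shifted_pow x n.

(** The q-difference quotient of [phi] in [x], see [phi_qx]; as a series it
    also makes sense at [0]. *)
Definition phi_qdiff g x : C := csum (phi_qdiff_term g x).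

Lemma shifted_pow_qfact x n : x != 0 -> shifted_pow x n = x ^+ n * qfact
  (-1 / x) n.
Proof.
move=> x0; rewrite /shifted_pow qfactE -[n in x ^+ n]card_ord -prodr_const
  -big_split /=.
by apply: eq_bigr => k _; field.
Qed.

Lemma shifted_pow0 x : shifted_pow x 0 = 1. Proof. by rewrite /shifted_pow
  big_ord0. Qed.
Lemma shifted_powSr x n : shifted_pow x n.+1 = shifted_pow x n * (x + q ^+ n).
Proof. by rewrite /shifted_pow big_ord_recr. Qed.
Lemma shifted_powS x n : shifted_pow (q * x) n.+1 = (q * x + 1) * q ^+ n *
  shifted_pow x n.
Proof.
rewrite /shifted_pow big_ord_recl expr0 -mulrA; congr (_ * _).
elim: n => [|n IH]; first by rewrite !big_ord0 mulr1.
by rewrite !big_ord_recr /= IH !exprS; ring.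
Qed.

Lemma phiC g x : phi g x = phi x g.
Proof. by congr csum; apply/funext => n; rewrite /phi_term; ring. Qed.

Lemma shifted_pow_m1 n : shifted_pow (-1) n.+1 = 0.
Proof. by rewrite /shifted_pow big_ord_recl expr0 addNr mul0r. Qed.

Lemma phi_m1 g : phi g (-1) = 1.
Proof.
apply: has_csum_csum; rewrite -[X in has_csum _ X]addr0.
have e : phi_term g (-1) 0 = 1 by rewrite /phi_term !shifted_pow0 !mulr1
  /phi_coef !qfact0 !mulr1 divr1.
rewrite -[X in has_csum _ (X + _)]e.
by apply: (has_csumS (phi_term g (-1)) _).1;
  apply: has_csum_eq (@has_csum0 R) => n;
    rewrite /phi_term shifted_pow_m1 mulr0.
Qed.

Lemma one_minus_qX_neq0 n : 1 - q ^+ n.+1 != 0.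
Proof. by rewrite subr_eq0 eq_sym lt_eqF // qX_lt1. Qed.

Lemma phi_coefS n : phi_coef n.+1 = phi_coef n * (- (a * b) * q ^+ n /
  ((1 - q ^+ n.+1) * (1 - a * q ^+ n) * (1 - b * q ^+ n))).
Proof.
rewrite /phi_coef !qfactSr binS bin1 exprD !exprS !invfM; ring.
Qed.

(** The ratio of successive coefficients is of the order of [q^n], so [phi]
    is entire in each variable. *)
Lemma phi_coef_bound (r : C) : 0 < r -> exists2 B, 0 <= B & forall n,
  `|phi_coef n| * r ^+ n <= B * 2^-1 ^+ n.
Proof.
move=> r0; have s0 : 0 < (2 * r)^-1 by rewrite invr_gt0 mulr_gt0.
pose ratio n : C := - (a * b) * q ^+ n / ((1 - q ^+ n.+1) * (1 - a * q ^+ n) *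
  (1 - b * q ^+ n)).
have hr : ratio ~> 0.
  have h c : (fun n => 1 - c * q ^+ n) ~> 1.
    by have := climB (clim_cst 1) (clim_cq hq c); rewrite subr0.
  have h1 : (fun n => 1 - q ^+ n.+1) ~> 1 by apply: clim_eq (h q) => n;
    rewrite exprS.
  have hd := climM (climM h1 (h a)) (h b); rewrite !mulr1 in hd.
  have := climM (clim_cq hq (- (a * b))) (climV (oner_neq0 _) hd).
  by rewrite mul0r.
have [B B0 hB] := geom_bound_of_ratio0 (r := ratio)
  (fun n => etrans (phi_coefS n) (mulrC _ _)) hr s0.
exists B => // n; have rn : 0 <= r ^+ n by rewrite exprn_ge0 // ltW.
apply: le_trans (ler_wpM2r rn (hB n)) _.
by rewrite -mulrA -exprMn invfM mulfVK ?gt_eqF.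
Qed.

Lemma shifted_pow_le x n : `|shifted_pow x n| <= (`|x| + 1) ^+ n.
Proof.
elim: n => [|n IH]; first by rewrite shifted_pow0 normr1.
rewrite shifted_powSr normrM exprSr ler_pM //;
  apply: le_trans (ler_normD _ _) _.
by rewrite lerD2l qX_norm // qX_le1.
Qed.

Lemma phi_term_bound (X Y : C) : 0 <= X -> 0 <= Y -> exists2 B, 0 <= B &
  forall g x n, `|g| <= X -> `|x| <= Y -> `|phi_term g x n| <= B * 2^-1 ^+ n.
Proof.
move=> X0 Y0; have r0 : 0 < (X + 1) * (Y + 1) by rewrite mulr_gt0 // ltr_wpDl.
have [B B0 hB] := phi_coef_bound r0; exists B => // g x n gX xY.
apply: le_trans (hB n); rewrite /phi_term normrM normrM -mulrA ler_wpM2l //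
  exprMn.
by rewrite ler_pM //; apply: le_trans (shifted_pow_le _ _) _;
  rewrite lerXn2r ?nnegrE ?addr_ge0 // lerD2r.
Qed.

Lemma half_ge0 : (0 : C) <= 2^-1. Proof. by rewrite invr_ge0. Qed.
Lemma half_lt1 : (2^-1 : C) < 1. Proof. by rewrite invf_lt1 // ltr1n. Qed.

Lemma phi_term_abs_summable g x : abs_summable (phi_term g x).
Proof.
have [B B0 hB] := phi_term_bound (normr_ge0 g) (normr_ge0 x).
by apply: (abs_summable_geom_le half_ge0 half_lt1) => n; exact: hB.
Qed.

Lemma phi_term_has_csum g x : has_csum (phi_term g x) (phi g x).
Proof. exact: abs_summable_has_csum (phi_term_abs_summable g x). Qed.

Lemma phi_qdiff_bound g (Y : C) : 0 <= Y -> exists2 B, 0 <= B &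
  forall x n, `|x| <= Y -> `|phi_qdiff_term g x n| <= B * 2^-1 ^+ n.
Proof.
move=> Y0; have r1 : 0 < (`|g| + 1) * (Y + 1) by rewrite mulr_gt0 // ltr_wpDl.
have [B B0 hB] := phi_coef_bound r1; exists B => // x n xY.
apply: (@le_trans _ _ (B * 2^-1 ^+ n.+1)); last first.
  by rewrite exprS ler_wpM2l // ler_piMl ?exprn_ge0 ?half_ge0 // ltW //
    half_lt1.
apply: le_trans (hB n.+1); rewrite /phi_qdiff_term normrM normrM normrM -!mulrA
  ler_wpM2l //.
rewrite exprMn ler_pM ?mulr_ge0 //; first exact: shifted_pow_le.
rewrite -[leLHS]mul1r mulrA mul1r -[leRHS]mul1r ler_pM //.
  by rewrite ger0_norm ?lerBlDr ?lerDl ?qX_ge0 // subr_ge0 qX_le1.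
apply: le_trans (shifted_pow_le _ _) _; rewrite exprS.
have h1 : `|x| + 1 <= Y + 1 by rewrite lerD2r.
apply: (@le_trans _ _ ((Y + 1) ^+ n)).
  by rewrite lerXn2r ?nnegrE ?addr_ge0.
by rewrite ler_peMl ?exprn_ge0 ?addr_ge0 // lerDr.
Qed.

Lemma phi_qdiff_has_csum g x : has_csum (phi_qdiff_term g x) (phi_qdiff g x).
Proof.
apply: abs_summable_has_csum; have [B B0 hB] := phi_qdiff_bound g (normr_ge0 x).
by apply: (abs_summable_geom_le half_ge0 half_lt1) => n; exact: hB.
Qed.

Lemma shifted_pow_clim (u : nat -> C) n l : u ~> l ->
  (fun k => shifted_pow (u k) n) ~> shifted_pow l n.
Proof.
move=> hu; elim: n => [|n IH].
  by apply: clim_eq (clim_cst _) => k; rewrite !shifted_pow0.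
rewrite shifted_powSr;
  apply: clim_eq (climM IH (climD hu (clim_cst (q ^+ n)))) => k.
by rewrite shifted_powSr.
Qed.

Lemma phi_clim g (u : nat -> C) l : u ~> l -> (fun k => phi g (u k)) ~> phi g l.
Proof.
move=> hu; have [Y Y0 hY] := clim_bounded hu.
have [B B0 hB] := phi_term_bound (normr_ge0 g) (ltW Y0).
apply: (@tannery _ _ _ (fun n => B * 2^-1 ^+ n)).
- by move=> n; apply: climZ; exact: shifted_pow_clim.
- by move=> k n; apply: hB.
- by apply: abs_summableZ; exact: abs_summable_geom half_ge0 half_lt1.
Qed.

Lemma phi_qdiff_clim g (u : nat -> C) l : u ~> l -> (fun k => phi_qdiff g (u k))
  ~> phi_qdiff g l.
Proof.
move=> hu; have [Y Y0 hY] := clim_bounded hu.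
have [B B0 hB] := phi_qdiff_bound g (ltW Y0).
apply: (@tannery _ _ _ (fun n => B * 2^-1 ^+ n)).
- by move=> n; apply: climZ; exact: shifted_pow_clim.
- by move=> k n; apply: hB.
- by apply: abs_summableZ; exact: abs_summable_geom half_ge0 half_lt1.
Qed.

Lemma phi_qx g x : phi g (q * x) - phi g x = - x * phi_qdiff g x.
Proof.
have h := has_csumB (phi_term_has_csum g (q * x)) (phi_term_has_csum g x).
have h2 := has_csumZ (- x) (phi_qdiff_has_csum g x).
apply: has_csum_unique h _.
rewrite -[X in has_csum _ X]add0r.
have <- : phi_term g (q * x) 0 - phi_term g x 0 = 0 by rewrite /phi_term
  !shifted_pow0 subrr.
apply: (has_csumS (fun k => phi_term g (q * x) k - phi_term g x k) _).1.
apply: has_csum_eq h2 => n; rewrite /phi_term /phi_qdiff_term shifted_powS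
  (shifted_powSr x) !exprS; ring.
Qed.

(** The difference operator sends [shifted_pow x n.+1] to a combination of
    [shifted_pow] of neighbouring degrees; the two-term recursion of the
    coefficients then makes the sum of these combinations collapse. *)
Lemma phi_difference_eq g x : x != 0 ->
  (1 + a * x) * (1 + b * x) * (phi g (q * x) - phi g x) +
  q * (1 + x) * (phi g (x / q) - phi g x) = - (a * b) * (1 + g) * x ^+ 2 * phi g
    x.
Proof.
move=> x0.
have h :=
  has_csumD (has_csumZ ((1 + a * x) * (1 + b * x))
    (has_csumB (phi_term_has_csum g (q * x)) (phi_term_has_csum g x)))
  (has_csumZ (q * (1 + x)) (has_csumB (phi_term_has_csum g (x / q))
    (phi_term_has_csum g x))).
apply: has_csum_unique h _; set L := (X in has_csum X _).
have L0 : L 0%N = 0 by rewrite /L /phi_term !shifted_pow0 !subrr !mulr0 addr0.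
rewrite -[X in has_csum _ X]add0r -L0; apply: (has_csumS L _).1.
have hqt : abs_summable (fun n => q ^+ n * phi_term g x n).
  apply: abs_summable_le (phi_term_abs_summable g x) => n;
    rewrite normrM qX_norm // ler_piMl //.
  exact: qX_le1.
have hS := abs_summable_has_csum hqt; set S := csum _ in hS.
have h1 := has_csumB (phi_term_has_csum g x) hS.
(* [phi g x - S] is the sum of the terms weighted by [1 - q^n]; the one at
   [n = 0] vanishes, so shifting the index does not change the sum. *)
have h2 : has_csum (fun n => phi_term g x n.+1 - q ^+ n.+1 * phi_term g x n.+1)
  (phi g x - S).
  apply/(has_csumS (fun n => phi_term g x n - q ^+ n * phi_term g x n)).
  by rewrite expr0 mul1r subrr add0r.
have h3 := has_csumZ (- (a * b) * x ^+ 2)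
  (has_csumD (has_csumD (has_csumZ g (phi_term_has_csum g x)) hS) h2).
rewrite (_ : - (a * b) * (1 + g) * x ^+ 2 * phi g x =
   - (a * b) * x ^+ 2 * (g * phi g x + S + (phi g x - S))); last by ring.
apply: has_csum_eq h3 => n; rewrite /L.
have U1 := shifted_powS x n; have U2 := shifted_powS (x / q) n.
have xq : q * (x / q) = x by field.
rewrite xq in U2.
have E : (1 + x) * (shifted_pow (x / q) n.+1 - shifted_pow x n.+1) * q =
    (1 - q ^+ n.+1) * x * (q ^+ n)^-1 * shifted_pow x n.+1.
  rewrite [shifted_pow (x / q) n.+1]shifted_powSr U2 exprS; field;
    by rewrite qn0 expf_neq0.
have -> : q * (1 + x) * (phi_term g (x / q) n.+1 - phi_term g x n.+1) =
   phi_coef n.+1 * shifted_pow g n.+1 *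
     ((1 + x) * (shifted_pow (x / q) n.+1 - shifted_pow x n.+1) * q).
  by rewrite /phi_term; ring.
rewrite E /phi_term U1 phi_coefS !shifted_powSr exprS.
have := one_minus_qX_neq0 n; rewrite exprS => hqq.
field.
by rewrite ?hqq ?ha ?hb ?expf_neq0.
Qed.

End PhiSeries.

(** * Boundedness of the q-Meixner functions far out *)

Section Tame.
Variable R : realType.
Notation C := R[i].
Variable q : C.
Hypothesis hq : 0 < q < 1.
Implicit Types (c x z D : C) (n j : nat) (m : int) (f : nat -> C).

Let q0 : 0 < q. Proof. by case/andP: hq. Qed.
Let q1 : q < 1. Proof. by case/andP: hq. Qed.
Let qn0 : q != 0. Proof. by rewrite gt_eqF. Qed.
Local Notation qfact_inf := (qfact_inf q).
Local Notation qfact := (qfact q).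

(** The coefficients of Euler's series for [(z; q)_oo]. *)
Definition euler_coef n : C := (-1) ^+ n * q ^+ 'C(n, 2) / qfact q n.

(** Euler's series with its coefficients modified by [f]. The factors that
    distinguish [phi] from [(z; q)_oo] are moved into [f]. *)
Definition euler_sum f z : C := csum (fun n => euler_coef n * z ^+ n * f n).

(** The bound is carried explicitly, because it has to stay uniform when the
    number of factors in [f] grows. *)
Definition bounded_on_qZ D f := forall m, `|euler_sum f (q ^ m)| <= D.
Definition bounded_seq f := exists K, forall n, `|f n| <= K.

Lemma euler_coefS n : euler_coef n.+1 = - q ^+ n / (1 - q ^+ n.+1) * euler_coef
  n.
Proof. by rewrite /euler_coef qfactSr binS bin1 exprD !exprS !invfM; ring. Qed.

Lemma euler_coef_abs_summable z : abs_summable (fun n => euler_coef n * z ^+ n).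
Proof.
have s0 : 0 < (2 * (`|z| + 1))^-1 by rewrite invr_gt0 mulr_gt0 // ltr_wpDl.
have hr : (fun n => - q ^+ n / (1 - q ^+ n.+1)) ~> 0.
  have h1 : (fun n => 1 - q ^+ n.+1) ~> 1.
    have := climB (clim_cst 1) (clim_cq hq q); rewrite subr0.
    by apply: clim_eq => n; rewrite exprS.
  have := climM (clim_cq hq (-1)) (climV (oner_neq0 _) h1); rewrite mul0r.
  by apply: clim_eq => n; rewrite mulN1r.
have [B B0 hB] := geom_bound_of_ratio0 euler_coefS hr s0.
apply: (abs_summable_geom_le (half_ge0 R) (half_lt1 R)) => n.
rewrite normrM normrX.
apply: (@le_trans _ _ (B * (2 * (`|z| + 1))^-1 ^+ n * (`|z| + 1) ^+ n)).
  by rewrite ler_pM // lerXn2r ?nnegrE ?addr_ge0 // lerDl.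
by rewrite -mulrA -exprMn invfM mulfVK // gt_eqF // ltr_wpDl.
Qed.

Lemma euler_sum_has_csum f z : bounded_seq f ->
  has_csum (fun n => euler_coef n * z ^+ n * f n) (euler_sum f z).
Proof.
move=> [K hK]; apply: abs_summable_has_csum;
  apply: abs_summable_le (abs_summableZ K (euler_coef_abs_summable z)) => n.
rewrite normrM [leRHS]normrM mulrC ler_wpM2r //.
by apply: le_trans (hK n) _;
  rewrite real_ler_norm // ger0_real // (le_trans _ (hK n)).
Qed.

(** Multiplying the coefficients by [1 - c q^n] mixes the sums at [z] and at
    [q z], and this shift preserves the set of integral powers of [q]. *)
Lemma euler_sum_mul f c z : bounded_seq f ->
  euler_sum (fun n => (1 - c * q ^+ n) * f n) z = euler_sum f z - c * euler_sum
    f (q * z).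
Proof.
move=> hf; apply: has_csum_csum.
apply: has_csum_eq (has_csumB (euler_sum_has_csum z hf)
  (has_csumZ c (euler_sum_has_csum (q * z) hf))) => n.
by rewrite exprMn; ring.
Qed.

Lemma euler_sum1 z : euler_sum (fun=> 1) z = (1 - z) * euler_sum (fun=> 1)
  (q * z).
Proof.
have h1 : bounded_seq (fun=> 1 : C) by exists 1 => n; rewrite normr1.
have ez := euler_sum_has_csum z h1; have eqz := euler_sum_has_csum (q * z) h1.
have e : has_csum (fun n => euler_coef n.+1 * z ^+ n.+1 * 1 - euler_coef n.+1 *
  (q * z) ^+ n.+1 * 1)
    (- z * euler_sum (fun=> 1) (q * z)).
  apply: has_csum_eq (has_csumZ (- z) eqz) => n.
  have hn := one_minus_qX_neq0 hq n.
  by rewrite euler_coefS !exprMn exprS [z ^+ n.+1]exprS; move: hn;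
    rewrite exprS => hn; field.
have := has_csum_unique
  ((has_csumS (fun n => euler_coef n * z ^+ n * 1 - euler_coef n * (q * z) ^+ n
    * 1) _).1 e)
  (has_csumB ez eqz).
rewrite !expr0 subrr add0r => h.
by rewrite mulrBl mul1r -mulNr h addrC subrK.
Qed.

(** At nonnegative powers of [q] the series is dominated by its value at
    [1]; at negative powers [(z; q)_oo] vanishes. *)
Lemma bounded_on_qZ1 : exists2 D, 0 <= D & bounded_on_qZ D (fun=> 1).
Proof.
have [D hD] := euler_coef_abs_summable 1.
have D0 : 0 <= D by apply: le_trans (hD 0%N); rewrite big_ord0.
exists D => // -[n|n].
  apply: csum_norm_le => k; apply: le_trans (hD k).
  apply: ler_sum => i _; rewrite mulr1 expr1n mulr1 normrM ler_piMr //.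
  by rewrite -exprnP -exprM qX_norm // qX_le1.
suff -> : euler_sum (fun=> 1) (q ^ Negz n) = 0 by rewrite normr0.
elim: n => [|n IH].
  rewrite euler_sum1 NegzE -exprnN expr1 mulfV // euler_sum1 subrr mul0r mulr0
    //.
rewrite euler_sum1 (_ : q * q ^ Negz n.+1 = q ^ Negz n) ?IH ?mulr0 //.
by rewrite mulrC -(expfzS _ qn0); congr (q ^ _); rewrite !NegzE; clear; lia.
Qed.

Lemma bounded_seqM f h : bounded_seq f -> bounded_seq h ->
  bounded_seq (fun n => f n * h n).
Proof.
by move=> [K hK] [L hL]; exists (K * L) => n; rewrite normrM ler_pM.
Qed.

Lemma bounded_seq_lin c : bounded_seq (fun n => 1 - c * q ^+ n).
Proof.
exists (1 + `|c|) => n; apply: le_trans (ler_normB _ _) _.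
by rewrite normr1 lerD2l norm_cq_le.
Qed.

Lemma bounded_seq_inv c : `|c| < 1 ->
  bounded_seq (fun n => (1 - c * q ^+ n)^-1).
Proof.
move=> c1; exists (1 - `|c|)^-1 => n; rewrite normfV.
have c0 : 0 < 1 - `|c| by rewrite subr_gt0.
have h : 1 - `|c| <= `|1 - c * q ^+ n|.
  apply: (@le_trans _ _ (`|1 : C| - `|c * q ^+ n|)); last exact: lerB_dist.
  by rewrite normr1 lerB // norm_cq_le.
by rewrite lef_pV2 ?posrE // (lt_le_trans c0).
Qed.

Lemma bounded_on_qZ_mul D c f : bounded_seq f -> bounded_on_qZ D f ->
  bounded_on_qZ ((1 + `|c|) * D) (fun n => (1 - c * q ^+ n) * f n).
Proof.
move=> hf hD m; rewrite euler_sum_mul //; apply: le_trans (ler_normB _ _) _.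
rewrite mulrDl mul1r lerD // normrM ler_wpM2l //.
by rewrite mulrC -(expfzS _ qn0); exact: hD.
Qed.

Lemma le_of_clim0 (x y : C) (u : nat -> C) : (forall n, x <= y + u n) ->
  u ~> 0 -> x <= y.
Proof.
move=> h hu; rewrite -subr_ge0.
have H := climB (climD (clim_cst y) hu) (clim_cst x); rewrite addr0 in H.
have H2 : (fun n => `|y + u n - x|) ~> `|y - x| := clim_norm H.
suff <- : `|y - x| = y - x by [].
apply: clim_unique H2 _; apply: clim_eq H => n.
by rewrite ger0_norm // subr_ge0.
Qed.

(** The relation of [euler_sum_mul], solved for the sum with the factor
    removed, is iterated towards high powers of [q]; it contracts by [`|c|]. *)
Lemma bounded_on_qZ_div D c f : 0 <= D -> bounded_seq f -> bounded_on_qZ D f ->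
  `|c| < 1 ->
  bounded_on_qZ (D / (1 - `|c|)) (fun n => f n / (1 - c * q ^+ n)).
Proof.
move=> D0 hf hD c1 m; pose h n := f n / (1 - c * q ^+ n).
have hh : bounded_seq h by apply: bounded_seqM => //; exact: bounded_seq_inv.
have hrec k : euler_sum h (q ^ k) = euler_sum f (q ^ k) + c * euler_sum h
  (q ^ (k + 1)).
  have -> : f = (fun n => (1 - c * q ^+ n) * h n).
    by apply/funext => n; rewrite /h mulrCA mulfV ?mulr1 // lin_neq0.
  by rewrite euler_sum_mul // expfzS // [q * _]mulrC subrK.
have [K hK] := hh; have [B hB] := euler_coef_abs_summable (q ^ m).
have K0 : 0 <= K by apply: le_trans (hK 0%N).
(* The remainder of the iteration stays bounded, since the arguments
   [q ^ (m + l)] do not exceed [q ^ m]. *)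
have hunif l : `|euler_sum h (q ^ (m + Posz l))| <= K * B.
  apply: csum_norm_le => n;
    apply: (@le_trans _ _ (\sum_(k < n) K * `|euler_coef k * (q ^ m) ^+ k|));
      last first.
    by rewrite -mulr_sumr ler_wpM2l.
  apply: ler_sum => k _; rewrite normrM mulrC ler_pM // normrM [leRHS]normrM.
  rewrite ler_wpM2l // normrX [leRHS]normrX lerXn2r ?nnegrE // expfzDr //.
  by rewrite normrM -exprnP qX_norm // ler_piMr // qX_le1.
have hit l : `|euler_sum h (q ^ m)| <= D * \sum_(i < l) `|c| ^+ i + `|c| ^+ l *
  `|euler_sum h (q ^ (m + Posz l))|.
  elim: l => [|l IH]; first by rewrite big_ord0 mulr0 add0r expr0 mul1r addr0.
  apply: le_trans IH _; rewrite big_ord_recr /= mulrDr -addrA lerD2l hrec.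
  apply: (@le_trans _ _
    (`|c| ^+ l * (D + `|c| * `|euler_sum h (q ^ (m + Posz l + 1))|))).
    rewrite ler_wpM2l ?exprn_ge0 //; apply: le_trans (ler_normD _ _) _.
    by rewrite lerD // normrM.
  rewrite mulrDr [_ * D]mulrC lerD2l mulrA -exprSr.
  by rewrite -addrA -PoszD addn1.
apply: (@le_of_clim0 _ _ (fun l => K * B * `|c| ^+ l)).
  move=> l; apply: le_trans (hit l) _; rewrite lerD //.
    by rewrite ler_wpM2l // geom_sum_le.
  by rewrite mulrC ler_wpM2r ?exprn_ge0.
by have := climZ (K * B) (geom_clim0 (normr_ge0 c) c1); rewrite mulr0.
Qed.

Lemma bounded_seq_qfact c j : bounded_seq (fun n => qfact (c * q ^+ n) j).
Proof.
elim: j => [|j IH]; first by exists 1 => n; rewrite qfact0 normr1.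
have := bounded_seqM IH (bounded_seq_lin (c * q ^+ j)); case=> K hK;
  exists K => n.
by rewrite qfactSr -mulrA [q ^+ n * _]mulrC mulrA.
Qed.

Lemma bounded_seq_qfactV c j : `|c| < 1 ->
  bounded_seq (fun n => (qfact (c * q ^+ n) j)^-1).
Proof.
move=> c1; elim: j => [|j IH]; first by exists 1 => n;
  rewrite qfact0 invr1 normr1.
have cj : `|c * q ^+ j| < 1 := le_lt_trans (norm_cq_le hq c j) c1.
have := bounded_seqM IH (bounded_seq_inv cj); case=> K hK; exists K => n.
by rewrite qfactSr invfM -mulrA [q ^+ n * _]mulrC mulrA.
Qed.

Lemma bounded_on_qZ_qfact D c f j : 0 <= D -> bounded_seq f -> bounded_on_qZ D f
  ->
  bounded_on_qZ (qfact (- `|c|) j * D) (fun n => qfact (c * q ^+ n) j * f n).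
Proof.
move=> D0 hf hD; elim: j => [|j IH].
  rewrite qfact0 mul1r; congr bounded_on_qZ: hD; apply/funext => n;
    by rewrite qfact0 mul1r.
have := bounded_on_qZ_mul (c * q ^+ j) (bounded_seqM (bounded_seq_qfact c j) hf)
  IH.
rewrite qfactSr normrM qX_norm // mulNr opprK mulrA [(1 + _) * _]mulrC.
congr bounded_on_qZ; apply/funext => n.
by rewrite qfactSr mulrA; congr (_ * _); rewrite mulrC; congr (_ * (1 - _));
  ring.
Qed.

Lemma qfact_gt0 xi j : 0 <= xi -> xi < 1 -> 0 < qfact xi j.
Proof.
move=> x0 x1; apply: prodr_gt0 => k _; rewrite subr_gt0.
by apply: le_lt_trans x1; rewrite ler_piMr // qX_le1.
Qed.

Lemma bounded_on_qZ_qfactV D c f j : 0 <= D -> bounded_seq f ->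
  bounded_on_qZ D f -> `|c| < 1 ->
  bounded_on_qZ (D / qfact `|c| j) (fun n => f n / qfact (c * q ^+ n) j).
Proof.
move=> D0 hf hD c1; elim: j => [|j IH].
  rewrite qfact0 divr1; congr bounded_on_qZ: hD; apply/funext => n;
    by rewrite qfact0 divr1.
have cj : `|c * q ^+ j| < 1 := le_lt_trans (norm_cq_le hq c j) c1.
have Dj : 0 <= D / qfact `|c| j.
  by rewrite divr_ge0 // ltW // qfact_gt0.
have := bounded_on_qZ_div Dj (bounded_seqM hf (bounded_seq_qfactV j c1)) IH cj.
rewrite normrM qX_norm // qfactSr invfM mulrA.
congr bounded_on_qZ; apply/funext => n.
by rewrite qfactSr invfM mulrA; congr (_ / (1 - _)); ring.
Qed.

Lemma qfactV_le c xi j : xi < 1 -> `|c| <= xi -> `|(qfact c j)^-1| <=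
  (qfact xi j)^-1.
Proof.
move=> x1 cx; have x0 : 0 <= xi by apply: le_trans cx.
rewrite normfV lef_pV2 ?posrE ?qfact_gt0 //; last first.
  by rewrite normr_gt0; apply: qfact_neq0 => k _; apply: (lin_neq0 hq);
    exact: le_lt_trans cx x1.
rewrite /qfact normr_prod; apply: ler_prod => k _; apply/andP; split.
  by rewrite subr_ge0 (le_trans _ (ltW x1)) // ler_piMr // qX_le1.
apply: (@le_trans _ _ (`|1 : C| - `|c * q ^+ k|)); last exact: lerB_dist.
by rewrite normr1 lerB // normrM qX_norm // ler_wpM2r ?qX_ge0.
Qed.

Lemma qfact_inf_le c r B : `|c| <= r -> (forall n, qfact (- r) n <= B) ->
  `|qfact_inf c| <= B.
Proof.
move=> cr hB; apply: (clim_norm_le (qfact_clim hq c)) => n.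
by apply: le_trans (hB n); exact: norm_qfact_le.
Qed.

Section Bound.
Variables a b : C.
Hypothesis ha : forall n, 1 - a * q ^+ n != 0.
Hypothesis hb : forall n, 1 - b * q ^+ n != 0.

(** Up to infinite products, [phi g x] is Euler's series at [z = a b g x]
    with the n-th coefficient multiplied by
    [(a q^n, b q^n; q)_oo / (- q^n / g, - q^n / x; q)_oo]. The elementary
    factors of these products change the supremum over [z] in the powers of
    [q] by factors whose product converges, uniformly for [-1 / g] and
    [-1 / x] in a disc of radius less than [1]. *)
Lemma phi_bounded_far xi : 0 <= xi -> xi < 1 -> exists2 D, 0 <= D &
  forall g x m, g != 0 -> x != 0 -> `|-1 / g| <= xi -> `|-1 / x| <= xi ->
    a * b * g * x = q ^ m -> `|phi q a b g x| <= D.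
Proof.
move=> x0 x1; have [D0 hD0 hD] := bounded_on_qZ1.
have [A A0 hA] := qfact_bound hq (normr_ge0 a).
have [B B0 hB] := qfact_bound hq (normr_ge0 b).
have [X X0 hX] := qfact_bound hq x0.
have xin : qfact_inf xi != 0 by apply: (qfact_inf_neq0_lt1 hq);
  rewrite ger0_norm.
have [E E0 hE'] := clim_bounded (climV xin (qfact_clim hq xi)).
have hE j : (qfact xi j)^-1 <= E.
  by have := hE' j; rewrite ger0_norm // invr_ge0 ltW // qfact_gt0.
have pa : qfact_inf a != 0 := qfact_inf_neq0 hq ha.
have pb : qfact_inf b != 0 := qfact_inf_neq0 hq hb.
exists (X * X / `|qfact_inf a * qfact_inf b| * (B * (A * D0) * E * E)).
  by rewrite !mulr_ge0 ?invr_ge0 // ltW.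
move=> g x m g0 xn0 gxi xxi gx.
(* [f j] keeps [j] factors of each infinite product in [h]; the bounds on
   its Euler sums are uniform in [j]. *)
pose f j n := qfact (b * q ^+ n) j * (qfact (a * q ^+ n) j * 1) /
  qfact (-1 / g * q ^+ n) j / qfact (-1 / x * q ^+ n) j.
pose h n := qfact_inf (b * q ^+ n) * (qfact_inf (a * q ^+ n) * 1) /
  qfact_inf (-1 / g * q ^+ n) / qfact_inf (-1 / x * q ^+ n).
have g1 : `|-1 / g| < 1 := le_lt_trans gxi x1.
have xx1 : `|-1 / x| < 1 := le_lt_trans xxi x1.
have nz c n : `|c| < 1 -> qfact_inf (c * q ^+ n) != 0.
  by move=> c1; apply: (qfact_inf_neq0_lt1 hq);
    exact: le_lt_trans (norm_cq_le hq c n) c1.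
have nz' c n : (forall k, 1 - c * q ^+ k != 0) -> qfact_inf (c * q ^+ n) != 0.
  by move=> hc; apply: (qfact_inf_neq0 hq) => k; rewrite -mulrA -exprD.
have nb1 : bounded_seq (fun=> 1 : C) by exists 1 => n; rewrite normr1.
have hfb j : `|euler_sum (f j) (q ^ m)| <= B * (A * D0) * E * E.
  have n1 := bounded_seqM (bounded_seq_qfact a j) nb1.
  have b1 := bounded_on_qZ_qfact a j hD0 nb1 hD.
  have p1 c : 0 <= qfact (- `|c|) j.
    by apply: prodr_ge0 => k _; rewrite mulNr opprK addr_ge0 // mulr_ge0 //
      qX_ge0.
  have d1 : 0 <= qfact (- `|a|) j * D0 by rewrite mulr_ge0.
  have n2 := bounded_seqM (bounded_seq_qfact b j) n1.
  have b2 := bounded_on_qZ_qfact b j d1 n1 b1.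
  have d2 : 0 <= qfact (- `|b|) j * (qfact (- `|a|) j * D0) by rewrite mulr_ge0.
  have n3 := bounded_seqM n2 (bounded_seq_qfactV j g1).
  have b3 := bounded_on_qZ_qfactV j d2 n2 b2 g1.
  have d3 : 0 <= qfact (- `|b|) j * (qfact (- `|a|) j * D0) / qfact `|-1 / g| j.
    by rewrite divr_ge0 // ltW // qfact_gt0.
  have b4 := bounded_on_qZ_qfactV j d3 n3 b3 xx1.
  have V c : `|c| <= xi -> 0 <= (qfact `|c| j)^-1 <= E.
    move=> cx; have c0 : 0 <= (qfact `|c| j)^-1.
      by rewrite invr_ge0 ltW // qfact_gt0 // (le_lt_trans cx).
    rewrite c0 /= -[X in X <= E]ger0_norm //; apply: le_trans (hE j).
    by apply: qfactV_le => //; rewrite normr_id.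
  have /andP[v1 w1] := V _ gxi; have /andP[v2 w2] := V _ xxi.
  by apply: le_trans (b4 m) _; rewrite !ler_pM ?mulr_ge0.
have hflim n : (fun j => f j n) ~> h n.
  apply: climM; last by apply: climV; [exact: nz|exact: qfact_clim].
  apply: climM; last by apply: climV; [exact: nz|exact: qfact_clim].
  apply: climM; first exact: qfact_clim.
  by apply: climM; [exact: qfact_clim|exact: clim_cst].
have hfle j n : `|f j n| <= B * A * E * E.
  have cn c (r : C) : `|c| <= r -> `|c * q ^+ n| <= r :=
    le_trans (norm_cq_le hq c n).
  rewrite /f mulr1 !normrM !ler_pM // ?mulr_ge0 //.
  - by apply: le_trans (hB j); apply: norm_qfact_le => //; exact: cn.
  - by apply: le_trans (hA j); apply: norm_qfact_le => //; exact: cn.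
  - by apply: le_trans (hE j); apply: qfactV_le => //; exact: cn.
  - by apply: le_trans (hE j); apply: qfactV_le => //; exact: cn.
have hlim : (fun j => euler_sum (f j) (q ^ m)) ~> euler_sum h (q ^ m).
  apply: (@tannery _ _ _ (fun n => B * A * E * E * `|euler_coef n * (q ^ m) ^+
    n|)).
  - by move=> n; apply: climZ.
  - by move=> j n; rewrite normrM mulrC ler_wpM2r.
  - exact: abs_summableZ (abs_summable_norm (euler_coef_abs_summable _)).
have hh := clim_norm_le hlim hfb.
have hphi : phi q a b g x = qfact_inf (-1 / g) * qfact_inf (-1 / x) /
  (qfact_inf a * qfact_inf b) * euler_sum h (q ^ m).
  have hnb : bounded_seq h.
    by exists (B * A * E * E) => n; apply: (clim_norm_le (hflim n)) => j.
  apply: has_csum_csum.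
  apply: has_csum_eq (has_csumZ _ (euler_sum_has_csum (q ^ m) hnb)) => n.
  rewrite /phi_term /phi_coef !shifted_pow_qfact // -gx /h /euler_coef.
  rewrite (qfact_inf_split hq n a) (qfact_inf_split hq n b).
  rewrite (qfact_inf_split hq n (-1 / g)) (qfact_inf_split hq n (-1 / x)).
  have e : (- (a * b)) ^+ n = (-1) ^+ n * (a ^+ n * b ^+ n).
    by rewrite -[- (a * b)]mulN1r !exprMn.
  rewrite e !exprMn.
  have := qfact_q_neq0 hq n.
  have : qfact a n != 0 by exact: qfact_neq0.
  have : qfact b n != 0 by exact: qfact_neq0.
  move: (nz _ n g1) (nz _ n xx1) (nz' _ n ha) (nz' _ n hb).
  move: (qfact_inf (a * q ^+ n)) (qfact_inf (b * q ^+ n))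
    (qfact_inf (-1 / g * q ^+ n)) (qfact_inf (-1 / x * q ^+ n)).
  move: (qfact a n) (qfact b n) (qfact q n) (qfact (-1 / g) n)
    (qfact (-1 / x) n) => *.
  by field; do ?(apply/andP; split).
rewrite hphi normrM ler_pM // normrM ler_pM //; last by rewrite normfV.
by rewrite normrM ler_pM // (qfact_inf_le _ hX).
Qed.

End Bound.
End Tame.

Lemma int_below (M : nat) (k : int) : k <= - M%:Z ->
  exists2 m, (M <= m)%N & k = - m%:Z.
Proof. by move=> h; exists `|k|%N; lia. Qed.

Lemma int_above (M : nat) (k : int) : - M%:Z <= k ->
  exists m : nat, k = - M%:Z - 1 + m%:Z.
Proof. by move=> h; exists (absz (k + M%:Z + 1)); lia. Qed.

Lemma int_addS (M : int) (m : nat) : M + m.+1%:Z = M + m%:Z + 1.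
Proof. lia. Qed.

Lemma int_le_total (M k : int) : k <= M \/ M <= k.
Proof. lia. Qed.

(** * Growth of the q-Meixner functions at infinity *)

Section Orthogonality.
Variable R : realType.
Notation C := R[i].
Variables q a b t : C.
Hypothesis hq : 0 < q < 1.
Hypothesis t0 : 0 < t.
Hypothesis ha : nondeg q t a.
Hypothesis hb : nondeg q t b.
Implicit Types (g l x : C) (n m : nat) (k : int) (u v : nat -> C).

Let q0 : 0 < q. Proof. by case/andP: hq. Qed.
Let q1 : q < 1. Proof. by case/andP: hq. Qed.
Let qn0 : q != 0. Proof. by rewrite gt_eqF. Qed.
Let tn0 : t != 0. Proof. by rewrite gt_eqF. Qed.
Let a0 : a != 0. Proof. by case: ha. Qed.
Let b0 : b != 0. Proof. by case: hb. Qed.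
Let han n : 1 - a * q ^+ n != 0. Proof. by case: ha. Qed.
Let hbn n : 1 - b * q ^+ n != 0. Proof. by case: hb. Qed.
Local Notation phi := (phi q a b).
Local Notation phi_qdiff := (phi_qdiff q a b).
Local Notation wgt := (wgt q a b).
Local Notation pearson := (pearson q a b).
Local Notation xN n := (t * q ^ (Negz n)).

(** Growth is measured in powers of [q^-1] because the points going to
    infinity are [t q^-(n+1)]: the class contains them and is closed under
    products. *)
Definition geom_growth u := exists D p, forall n, `|u n| <= D * (q^-1 ^+ p) ^+
  n.

Lemma geom_growth_le (D D' : C) p p' n : 0 <= D -> D <= D' -> (p <= p')%N ->
  D * (q^-1 ^+ p) ^+ n <= D' * (q^-1 ^+ p') ^+ n.
Proof.
move=> D0 DD pp; have qi : 1 <= q^-1 by rewrite invf_ge1 // ltW.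
have qi0 : 0 <= q^-1 by rewrite invr_ge0 ltW.
rewrite ler_pM ?exprn_ge0 // lerXn2r ?nnegrE ?exprn_ge0 //.
by rewrite ler_weXn2l.
Qed.

Lemma geom_growth_nonneg u D p : (forall n, `|u n| <= D * (q^-1 ^+ p) ^+ n) ->
  0 <= D.
Proof. by move=> /(_ 0%N); rewrite expr0 mulr1; apply: le_trans. Qed.

Lemma geom_growthD u v : geom_growth u -> geom_growth v ->
  geom_growth (fun n => u n + v n).
Proof.
move=> [D [p hu]] [E [r hv]]; exists (D + E), (p + r)%N => n.
have D0 := geom_growth_nonneg hu; have E0 := geom_growth_nonneg hv.
apply: le_trans (ler_normD _ _) _; rewrite mulrDl; apply: lerD.
  by apply: le_trans (hu n) _; apply: geom_growth_le; rewrite ?leq_addr.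
by apply: le_trans (hv n) _; apply: geom_growth_le; rewrite ?leq_addl.
Qed.

Lemma geom_growthM u v : geom_growth u -> geom_growth v ->
  geom_growth (fun n => u n * v n).
Proof.
move=> [D [p hu]] [E [r hv]]; exists (D * E), (p + r)%N => n.
rewrite normrM exprD exprMn (_ : D * E * _ = (D * (q^-1 ^+ p) ^+ n) *
  (E * (q^-1 ^+ r) ^+ n)); last by ring.
by rewrite ler_pM.
Qed.

Lemma geom_growth_cst (c : C) : geom_growth (fun=> c).
Proof. by exists `|c|, 0%N => n; rewrite expr0 expr1n mulr1. Qed.

Lemma geom_growth_eq u v : (forall n, u n = v n) -> geom_growth u ->
  geom_growth v.
Proof. by move=> /funext ->. Qed.

Lemma geom_growth_xN : geom_growth (fun n => xN n).
Proof.
exists (t / q), 1%N => n; rewrite NegzE -exprnN normrM (gtr0_norm t0) normfV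
  qX_norm //.
rewrite expr1 exprVn exprS le_eqVlt; apply/orP; left; apply/eqP.
by field; rewrite qn0 expf_neq0.
Qed.

Lemma geom_growth_eventually u N : geom_growth (fun n => u (n + N)%N) ->
  geom_growth u.
Proof.
move=> [D [p hu]]; have D0 := geom_growth_nonneg hu.
have qi : 1 <= q^-1 by rewrite invf_ge1 // ltW.
exists (D + \sum_(k < N) `|u k|), p => n.
have qp1 : 1 <= (q^-1 ^+ p) ^+ n by rewrite -exprM exprn_ege1.
have s0 : 0 <= \sum_(k < N) `|u k| by rewrite sumr_ge0.
have [Nn|nN] := leqP N n.
  have := hu (n - N)%N; rewrite subnK // => h; apply: le_trans h _.
  rewrite ler_pM ?exprn_ge0 ?invr_ge0 ?(ltW q0) ?lerDl //.
  by rewrite ler_weXn2l ?exprn_ege1 // leq_subr.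
rewrite -[leLHS]mulr1 ler_pM // (bigD1 (Ordinal nN)) //= addrCA lerDl.
by rewrite addr_ge0 // sumr_ge0.
Qed.

Lemma xN_neq0 n : xN n != 0. Proof. exact: tq_neq0. Qed.

Lemma wgt_geom_growth_clim0 u : geom_growth u -> (fun n => wgt (xN n) * u n) ~>
  0.
Proof.
move=> [D [p hu]]; have D0 := geom_growth_nonneg hu.
have s0 : 0 < q ^+ p / 2 by rewrite divr_gt0 // exprn_gt0.
have [B B0 hB] := wgt_decay hq t0 ha hb s0.
have h := climZ (D * B * (q ^+ p / 2)) (geom_clim0 (half_ge0 R) (half_lt1 R));
  rewrite mulr0 in h.
apply: clim0_le h => n; rewrite normrM [leRHS]ger0_norm; last first.
  by rewrite !mulr_ge0 ?exprn_ge0 ?half_ge0 // ltW.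
apply: le_trans (ler_pM _ _ (hB n.+1) (hu n)) _ => //.
rewrite le_eqVlt; apply/orP; left; apply/eqP.
rewrite exprS exprMn !exprVn -!exprM; field.
by rewrite !expf_neq0.
Qed.

(** Only the points of the support going to infinity matter: near [0] every
    [phi g] is continuous. *)
Definition tame g := geom_growth (fun n => phi g (xN n)).

Lemma phi_recurrence g x : g != 0 ->
  (1 + a * g) * (1 + b * g) * (phi (q * g) x - phi g x) +
  q * (1 + g) * (phi (g / q) x - phi g x) = - (a * b) * (1 + x) * g ^+ 2 * phi g
    x.
Proof. by move=> g0; rewrite ![phi _ x]phiC //; exact: phi_difference_eq. Qed.

(** The recurrence in [g] expresses [phi (q g)] through [phi g] and
    [phi (g / q)] with coefficients linear in [x]; at [g = -1] the last term
    drops out. *)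
Lemma tame_next g : g != 0 -> 1 + a * g != 0 -> 1 + b * g != 0 ->
  tame g -> (1 + g = 0 \/ tame (g / q)) -> tame (q * g).
Proof.
move=> g0 h1 h2 hg hgq.
have hn : geom_growth
  (fun n => q * (1 + g) * (phi (g / q) (xN n) - phi g (xN n))).
  case: hgq => [->|h].
    by apply: geom_growth_eq (geom_growth_cst 0) => n; rewrite mulr0 mul0r.
  apply: geom_growthM (geom_growth_cst _) _; apply: geom_growthD h _.
  by apply: geom_growth_eq (geom_growthM (geom_growth_cst (-1)) hg) => n;
    rewrite mulN1r.
have hx : geom_growth (fun n => - (a * b) * (1 + xN n) * g ^+ 2 * phi g (xN n)).
  apply: geom_growthM hg; apply: geom_growthM (geom_growth_cst _);
    apply: geom_growthM (geom_growth_cst _) _.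
  exact: geom_growthD (geom_growth_cst _) geom_growth_xN.
have := geom_growthD hg
  (geom_growthM (geom_growth_cst ((1 + a * g) * (1 + b * g))^-1)
  (geom_growthD hx (geom_growthM (geom_growth_cst (-1)) hn))).
apply: geom_growth_eq => n; rewrite -phi_recurrence // mulN1r addrK mulKf
  ?mulf_neq0 //.
by rewrite addrC subrK.
Qed.

(** [phi (-1)] is constant, and the recurrence produces the other points
    from it. *)
Lemma tame_neg n : tame (- q ^+ n).
Proof.
have na (k : nat) : 1 + a * - q ^+ k != 0 := nondeg_neg1 k ha.
have nb (k : nat) : 1 + b * - q ^+ k != 0 := nondeg_neg1 k hb.
have nq (k : nat) : - q ^+ k != 0 by rewrite oppr_eq0 expf_neq0.
have step (k : nat) : tame (- q ^+ k) ->
  (1 + - q ^+ k = 0 \/ tame (- q ^+ k / q)) ->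
    tame (- q ^+ k.+1).
  by rewrite exprS -mulrN; exact: tame_next.
have h0 : tame (- q ^+ 0).
  by apply: geom_growth_eq (geom_growth_cst 1) => k; rewrite expr0 phiC phi_m1.
suff [] : tame (- q ^+ n) /\ tame (- q ^+ n.+1) by [].
elim: n => [|n [IH1 IH2]].
  by split=> //; apply: step => //; left; rewrite expr0 subrr.
split=> //; apply: step => //; right.
by rewrite mulNr exprSr mulfK.
Qed.

Section Dual.
Variable s : C.
Hypothesis hs : a * b * t * s = 1.
Hypothesis s0 : 0 < s.

(** [1 + a s q^k] is, up to a nonzero factor, [1 + b t q^-k], and likewise
    with [a] and [b] exchanged. *)
Lemma dual_nondeg k : (1 + a * (s * q ^ k) != 0) /\ (1 + b * (s * q ^ k) != 0).
Proof.
have [_ _ h1] := ha; have [_ _ h2] := hb.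
have sE : s = (a * b * t)^-1.
  by apply: (mulfI (mulf_neq0 (mulf_neq0 a0 b0) tn0));
    rewrite hs mulfV // !mulf_neq0.
have qk := expfz_neq0 k qn0.
split.
  have := h2 (- k); apply: contraNneq => h.
  rewrite -invr_expz (_ : _ + _ = (1 + a * (s * q ^ k)) * (b * t / q ^ k));
    first by rewrite h mul0r.
  by rewrite sE; field; rewrite a0 b0 tn0 qk.
have := h1 (- k); apply: contraNneq => h.
rewrite -invr_expz (_ : _ + _ = (1 + b * (s * q ^ k)) * (a * t / q ^ k));
  first by rewrite h mul0r.
by rewrite sE; field; rewrite a0 b0 tn0 qk.
Qed.

(** For large [g = s q^-m] and large [x = t q^-n], the product [a b g x] is
    a power of [q], so [phi_bounded_far] applies; the recurrence then
    descends to the remaining [g]. *)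
Lemma tame_pos k : tame (s * q ^ k).
Proof.
have sn0 : s != 0 by rewrite gt_eqF.
have hh : (0 : C) < 2^-1 by rewrite invr_gt0.
have si : 0 <= s^-1 by rewrite invr_ge0 ltW.
have ti : 0 <= t^-1 by rewrite invr_ge0 ltW.
have [M hM] := qX_small hq si hh; have [N hN] := qX_small hq ti hh.
have [D D0 hD] := phi_bounded_far hq han hbn (half_ge0 R) (half_lt1 R).
have far m : (M <= m)%N -> tame (s * q ^ (- m%:Z)).
  move=> Mm; apply: (@geom_growth_eventually _ N); exists D, 0%N => n.
  rewrite expr0 expr1n mulr1.
  apply: (hD _ _ (- m%:Z + Negz (n + N))).
  - by rewrite mulf_neq0 // expfz_neq0.
  - exact: xN_neq0.
  - rewrite -exprnN normrM normrN1 mul1r normfV gtr0_norm; last first.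
      by rewrite divr_gt0 // exprn_gt0.
    rewrite invf_div.
    apply: le_trans hM; rewrite mulrC ler_wpM2l // -(subnK Mm) exprD.
    by rewrite ler_piMl ?qX_ge0 ?qX_le1.
  - rewrite NegzE -exprnN normrM normrN1 mul1r normfV gtr0_norm; last first.
      by rewrite divr_gt0 // exprn_gt0.
    rewrite invf_div.
    apply: le_trans hN; rewrite mulrC ler_wpM2l // -addSn exprD.
    by rewrite ler_piMl ?qX_ge0 ?qX_le1.
  - by rewrite expfzDr // -[RHS]mul1r -hs; ring.
have step k' : tame (s * q ^ k') -> tame (s * q ^ (k' + 1)) ->
  tame (s * q ^ (k' + 1 + 1)).
  move=> h1 h2; have [na nb] := dual_nondeg (k' + 1).
  have -> : s * q ^ (k' + 1 + 1) = q * (s * q ^ (k' + 1)) by rewrite expfzS //;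
    ring.
  apply: tame_next => //; first by rewrite mulf_neq0 // expfz_neq0.
  by right; rewrite expfzS // -mulrA mulfK.
pose T k' := tame (s * q ^ k').
have far' k' : k' <= - M%:Z -> T k'.
  by move=> /int_below [m hm ->]; exact: far.
have near m : T (- M%:Z - 1 + m%:Z) /\ T (- M%:Z - 1 + m%:Z + 1).
  elim: m => [|m [IH1 IH2]].
    by split; apply: far'; rewrite addr0 ?subrK // lerBlDr lerDl.
  rewrite int_addS; split; first exact: IH2.
  exact: step IH1 IH2.
rewrite -/(T k); have [h|/int_above [m ->]] := int_le_total (- M%:Z) k.
  exact: far'.
by case: (near m).
Qed.
End Dual.

End Orthogonality.

(** * Sums over the support *)

Section IndexSums.
Variable R : realType.
Notation C := R[i].
Notation I := (nat + int)%type.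
Implicit Types (F G : I -> C) (l : C).

Definition abs_isummable F := abs_summable (fun n => F (inl n)) /\ abs_zsummable
  (fun k => F (inr k)).
Definition has_isum F l := exists l1 l2,
  [/\ has_csum (fun n => F (inl n)) l1, has_zsum (fun k => F (inr k)) l2 & l =
    l1 + l2].
Definition isum F := csum (fun n => F (inl n)) + zsum (fun k => F (inr k)).

Lemma abs_isummable_has_isum F : abs_isummable F -> has_isum F (isum F).
Proof.
move=> [h1 h2]; exists (csum (fun n => F (inl n))), (zsum (fun k => F (inr k))).
by split => //; [exact: abs_summable_has_csum|exact: abs_zsummable_has_zsum].
Qed.

Lemma has_isum_isum F l : has_isum F l -> isum F = l.
Proof. by move=> [l1 [l2 [h1 h2 ->]]];
  rewrite /isum (has_csum_csum h1) (has_zsum_zsum h2). Qed.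

Lemma has_isum_unique F l l' : has_isum F l -> has_isum F l' -> l = l'.
Proof. by move=> /has_isum_isum <- /has_isum_isum. Qed.

Lemma has_isum_eq F G l : (forall i, F i = G i) -> has_isum F l -> has_isum G l.
Proof. by move=> /funext ->. Qed.

Lemma has_isumD F G l l' : has_isum F l -> has_isum G l' ->
  has_isum (fun i => F i + G i) (l + l').
Proof.
move=> [l1 [l2 [h1 h2 ->]]] [l3 [l4 [h3 h4 ->]]].
exists (l1 + l3), (l2 + l4); split;
  [exact: has_csumD h1 h3|exact: has_zsumD h2 h4|ring].
Qed.

Lemma has_isumZ c F l : has_isum F l -> has_isum (fun i => c * F i) (c * l).
Proof.
move=> [l1 [l2 [h1 h2 ->]]]; exists (c * l1), (c * l2).
by split; [exact: has_csumZ|exact: has_zsumZ|ring].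
Qed.

Lemma has_isum0 : has_isum (fun=> 0) 0.
Proof.
exists 0, 0; split; [exact: has_csum0| |by rewrite addr0].
by exists 0, 0; split; [exact: has_csum0|exact: has_csum0|rewrite addr0].
Qed.

End IndexSums.

(** * Orthogonality and recursion of the norms *)

Section Orthogonal.
Variable R : realType.
Notation C := R[i].
Notation I := (nat + int)%type.
Variables q a b : C.
Hypothesis hq : 0 < q < 1.
Implicit Types (g l x : C) (n m : nat) (k : int) (i j : I).

Let q0 : 0 < q. Proof. by case/andP: hq. Qed.
Let q1 : q < 1. Proof. by case/andP: hq. Qed.
Let qn0 : q != 0. Proof. by rewrite gt_eqF. Qed.
Local Notation phi := (phi q a b).
Local Notation phi_qdiff := (phi_qdiff q a b).
Local Notation wgt := (wgt q a b).
Local Notation pearson := (pearson q a b).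

Definition node (t : C) i : C := match i with inl n => - q ^+ n | inr k =>
  t * q ^ k end.
Definition node_abs (t : C) i : C := match i with inl n => q ^+ n | inr k =>
  t * q ^ k end.
Definition node_wgt (t : C) i : C := wgt (node t i) * node_abs t i.

Section Primal.
Variable t : C.
Hypothesis t0 : 0 < t.
Hypothesis ha : nondeg q t a.
Hypothesis hb : nondeg q t b.
Let a0 : a != 0. Proof. by case: ha. Qed.
Let b0 : b != 0. Proof. by case: hb. Qed.
Let han n : 1 - a * q ^+ n != 0. Proof. by case: ha. Qed.
Let hbn n : 1 - b * q ^+ n != 0. Proof. by case: hb. Qed.

Lemma tame_node s i : 0 < s -> a * b * t * s = 1 -> tame q a b t (node s i).
Proof. by move=> s0 hs; case: i => [n|k];
  [exact: tame_neg|exact: tame_pos]. Qed.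

Lemma clim_mq : (fun n => - q ^+ n) ~> 0.
Proof. by have := clim_cq hq (-1); apply: clim_eq => n; rewrite mulN1r. Qed.

Lemma phi_mul_abs_isummable g l : tame q a b t g -> tame q a b t l ->
  abs_isummable (fun i => phi g (node t i) * phi l (node t i) * node_wgt t i).
Proof.
move=> hg hl; split.
  have [D D0 hD] :=
    clim_bounded (climM (phi_clim a b hq g clim_mq)
      (phi_clim a b hq l clim_mq)).
  apply: abs_summable_le (neg_abs_summable hq a b hD) => n /=.
  by rewrite /node_wgt /= mulrA.
have [D D0 hD] := clim_bounded (climM (phi_clim a b hq g (clim_cq hq t))
  (phi_clim a b hq l (clim_cq hq t))).
have [E [p hE]] := geom_growthM hg hl.
have E0 := geom_growth_nonneg hE.
have r0 : 0 < q^-1 ^+ p by rewrite exprn_gt0 // invr_gt0.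
have hD' n : `|phi g (t * q ^ n%:Z) * phi l (t * q ^ n%:Z)| <= D + E.
  by apply: le_trans (hD n) _; rewrite lerDl.
have hE' n : `|phi g (t * q ^ Negz n) * phi l (t * q ^ Negz n)| <= (D + E) *
  (q^-1 ^+ p) ^+ n.
  by apply: le_trans (hE n) _; rewrite ler_wpM2r ?lerDr ?exprn_ge0 ?invr_ge0 //
    ltW.
apply: (abs_zsummable_le _ (@pos_abs_summable _ q t hq t0 a b
  (fun k => phi g (t * q ^ k) * phi l (t * q ^ k)) _ _ ha hb r0 hD' hE')).
by move=> k; rewrite /node_wgt /= mulrA.
Qed.

Section Casoratian.
Variables g l : C.

(** Built from difference quotients instead of shifted values, and with the
    weight absorbed in [pearson], so that it has a limit at [0]. *)
Definition casoratian x : C := pearson (q * x) *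
  (phi l x * phi_qdiff g x - phi g x * phi_qdiff l x).

(** The coefficients of the difference equation are exactly the values of
    [pearson] at the two ends divided by the weight; when the equations of
    [phi g] and [phi l] are cross-multiplied, the products
    [phi g x * phi l x] on their left sides cancel. *)
Lemma casoratian_diff x : x != 0 -> 1 + a * x != 0 -> 1 + b * x != 0 ->
  casoratian (x / q) - casoratian x = - (a * b) * (g - l) *
    (phi g x * phi l x * (wgt x * x)).
Proof.
move=> x0 h1 h2; rewrite /casoratian.
have xq : q * (x / q) = x by field.
rewrite xq pearson_qx // pearsonE //.
have dx f : phi_qdiff f x = - (phi f (q * x) - phi f x) / x.
  by rewrite phi_qx //; field.
have dxq f : phi_qdiff f (x / q) = - (phi f x - phi f (x / q)) * q / x.
  by rewrite -[in phi f x]xq phi_qx //; field; rewrite x0 qn0.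
have dg := phi_difference_eq hq han hbn g x0;
  have dl := phi_difference_eq hq han hbn l x0.
rewrite !dx !dxq.
have E : phi l x * ((1 + a * x) * (1 + b * x) * (phi g (q * x) - phi g x) +
   q * (1 + x) * (phi g (x / q) - phi g x)) -
   phi g x * ((1 + a * x) * (1 + b * x) * (phi l (q * x) - phi l x) +
   q * (1 + x) * (phi l (x / q) - phi l x)) =
   - (a * b) * (g - l) * x ^+ 2 * (phi g x * phi l x) by rewrite dg dl; ring.
move: E; set pgq := phi g (q * x); set plq := phi l (q * x).
set pg' := phi g (x / q); set pl' := phi l (x / q); set w := wgt x.
set pgx := phi g x; set plx := phi l x => E.
apply: (mulIf x0).
have -> : - (a * b) * (g - l) * (pgx * plx * (w * x)) * x =
  (- (a * b) * (g - l) * x ^+ 2 * (pgx * plx)) * w by ring.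
by rewrite -E; field.
Qed.

Let L : C := phi l 0 * phi_qdiff g 0 - phi g 0 * phi_qdiff l 0.

(** The limit does not depend on the side from which [0] is approached, so
    the contributions of the two halves of the support cancel. *)
Lemma casoratian_clim (u : nat -> C) : u ~> 0 -> (fun n => casoratian (u n)) ~>
  L.
Proof.
move=> hu; rewrite -[L]mul1r; apply: climM.
  by apply: (pearson_clim1 hq); have := climZ q hu; rewrite mulr0.
have P f := phi_clim a b hq f hu; have S f := phi_qdiff_clim a b hq f hu.
exact: climB (climM (P l) (S g)) (climM (P g) (S l)).
Qed.

Hypothesis hg : tame q a b t g.
Hypothesis hl : tame q a b t l.

Lemma casoratian_clim_infty : (fun n => casoratian (t * q ^ Negz n / q)) ~> 0.
Proof.
have xN n : t * q ^ Negz n / q = t * q ^ Negz n.+1.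
  rewrite (_ : Negz n = Negz n.+1 + 1); last by rewrite !NegzE; clear; lia.
  by rewrite expfzS // -mulrA mulfK.
have nx n : t * q ^ Negz n != 0 := tq_neq0 hq t0 (Negz n).
have hinv : geom_growth q (fun n => (t * q ^ Negz n)^-1).
  exists (t^-1 * q), 0%N => n; rewrite NegzE -exprnN expr0 expr1n mulr1
    invf_div.
  rewrite gtr0_norm ?divr_gt0 ?exprn_gt0 // mulrC exprS ler_wpM2l ?invr_ge0
    ?(ltW t0) //.
  by rewrite ler_piMr ?(ltW q0) // qX_le1.
have hS f : tame q a b t f ->
  geom_growth q (fun n => phi f (t * q ^ Negz n / q)).
  case=> D [p hD]; exists (D * (q^-1 ^+ p)), p => n.
  by rewrite xN -mulrA -exprS; exact: hD.
(* The Casoratian is the weight times a combination of sequences of at most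
   geometric growth. *)
have H := geom_growthM (geom_growthD hq (geom_growth_cst q 1)
  (geom_growth_xN hq t0)) (geom_growthM (geom_growth_cst q q) (geom_growthM hinv
  (geom_growthD hq (geom_growthM (hS g hg) hl)
    (geom_growthM (geom_growth_cst q (-1)) (geom_growthM (hS l hl) hg))))).
apply: clim_eq (wgt_geom_growth_clim0 hq t0 ha hb H) => n.
rewrite /casoratian; set x := t * q ^ Negz n; have x0 : x != 0 by exact: nx.
have xq : q * (x / q) = x by field.
have pq f : phi_qdiff f (x / q) = - (phi f x - phi f (x / q)) * q / x.
  by rewrite -[in phi f x]xq phi_qx //; field; rewrite x0 qn0.
by rewrite xq pearsonE // !pq; field.
Qed.

(** The contribution of the half ending in [-1] is the limit of the
    Casoratian at [0], that of the other half is its negative. *)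
Lemma phi_orthogonal_scaled : has_isum (fun i => - (a * b) * (g - l) *
  (phi g (node t i) * phi l (node t i) * node_wgt t i)) 0.
Proof.
exists L, (0 - L); split; last by ring.
- have hc : (fun n => casoratian (- q ^+ n / q)) ~> L.
    apply: casoratian_clim; have := climZ q^-1 clim_mq; rewrite mulr0.
    by apply: clim_eq => n; rewrite mulrC.
  (* [pearson] vanishes at [-1]. *)
  have c0 : casoratian (- q ^+ 0 / q) = 0.
    by rewrite /casoratian expr0 (_ : q * (-1 / q) = -1);
      [rewrite pearsonE // subrr !mul0r|field].
  have := has_csumZ (-1) (telescope_has_csum hc); rewrite c0 sub0r mulN1r opprK.
  apply: has_csum_eq => n.
  rewrite (_ : - q ^+ n.+1 / q = - q ^+ n); last by rewrite exprS; field.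
  rewrite casoratian_diff ?oppr_eq0 ?expf_neq0 ?(nondeg_neg1 _ ha)
    ?(nondeg_neg1 _ hb) //.
  by rewrite /node_wgt /=; ring.
- have hc : (fun n => casoratian (t * q ^ n%:Z / q)) ~> L.
    apply: casoratian_clim; have := clim_cq hq (t / q).
    by apply: clim_eq => n; rewrite -exprnP mulrAC.
  have := has_zsum_telescope (f := fun k => casoratian (t * q ^ k / q)) hc
    casoratian_clim_infty.
  apply: has_zsum_eq => k; rewrite expfzS // mulrA mulfK //.
  rewrite casoratian_diff ?(tq_neq0 hq) ?(nondeg_pos1 _ ha) ?(nondeg_pos1 _ hb)
    //.
Qed.

Lemma phi_orthogonal : g != l ->
  has_isum (fun i => phi g (node t i) * phi l (node t i) * node_wgt t i) 0.
Proof.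
move=> gl; have c0 : - (a * b) * (g - l) != 0.
  by rewrite mulf_neq0 ?oppr_eq0 ?mulf_neq0 // subr_eq0.
have := has_isumZ (- (a * b) * (g - l))^-1 phi_orthogonal_scaled; rewrite mulr0.
by apply: has_isum_eq => i; rewrite mulrA mulVf // mul1r.
Qed.

End Casoratian.

Definition sqnorm g : C := isum (fun i => phi g (node t i) * phi g (node t i) *
  node_wgt t i).

Lemma sqnorm_has_isum g : tame q a b t g ->
  has_isum (fun i => phi g (node t i) * phi g (node t i) * node_wgt t i)
    (sqnorm g).
Proof. by move=> hg; apply: abs_isummable_has_isum;
  exact: phi_mul_abs_isummable. Qed.

(** The recurrence at [g] integrated against [phi (q g)], and the recurrence
    at [q g] integrated against [phi g], both express the integral of
    [(1 + x) phi g phi (q g)]; orthogonality leaves one squared norm in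
    each. *)
Lemma sqnorm_step g : g != 0 -> 1 + a * g != 0 -> 1 + b * g != 0 ->
  tame q a b t g -> tame q a b t (q * g) -> tame q a b t (q * (q * g)) ->
  (1 + g = 0 \/ tame q a b t (g / q)) ->
  q * wgt (q * g) * sqnorm (q * g) = wgt g * sqnorm g.
Proof.
move=> g0 h1 h2 tg tqg tqqg tgq.
have qg0 : q * g != 0 by rewrite mulf_neq0.
have ne1 : q * g != g by rewrite -subr_eq0 -{2}[g]mul1r -mulrBl mulf_neq0 //
  subr_eq0 lt_eqF.
have ne2 : q * (q * g) != g.
  rewrite mulrA -subr_eq0 -{2}[g]mul1r -mulrBl mulf_neq0 // subr_eq0 -expr2
    lt_eqF //.
  exact: (qX_lt1 hq 1).
have ne3 : g / q != q * g.
  by apply: contra ne2 => /eqP <-; rewrite mulrCA mulfV // mulr1.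
pose X := fun i => (1 + node t i) * (phi g (node t i) * phi (q * g) (node t i) *
  node_wgt t i).
have o1 := phi_orthogonal tg tqg; rewrite eq_sym in o1; have {}o1 := o1 ne1.
have E1 : has_isum (fun i => - (a * b) * g ^+ 2 * X i)
  ((1 + a * g) * (1 + b * g) * sqnorm (q * g)).
  have H3 : has_isum
    (fun i => q * (1 + g) * ((phi (g / q) (node t i) - phi g (node t i)) *
      phi (q * g) (node t i) * node_wgt t i)) 0.
    case: tgq => [->|tgq].
      by apply: has_isum_eq (@has_isum0 R) => i; rewrite mulr0 mul0r.
    have o2 := phi_orthogonal tgq tqg ne3.
    have := has_isumZ (q * (1 + g)) (has_isumD o2 (has_isumZ (-1) o1)).
    rewrite mulr0 addr0 mulr0; apply: has_isum_eq => i; ring.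
  have := has_isumD (has_isumZ ((1 + a * g) * (1 + b * g))
    (has_isumD (sqnorm_has_isum tqg) (has_isumZ (-1) o1))) H3.
  rewrite mulr0 !addr0; apply: has_isum_eq => i; rewrite /X.
  rewrite (_ : - (a * b) * g ^+ 2 * _ = (- (a * b) * (1 + node t i) * g ^+ 2 *
    phi g (node t i)) *
     phi (q * g) (node t i) * node_wgt t i); last by ring.
  rewrite -(phi_recurrence hq ha hb) //; ring.
have E2 : has_isum (fun i => - (a * b) * (q * g) ^+ 2 * X i)
  (q * (1 + q * g) * sqnorm g).
  have o3 := phi_orthogonal tqqg tg ne2.
  have := has_isumD (has_isumZ ((1 + a * (q * g)) * (1 + b * (q * g)))
    (has_isumD o3 (has_isumZ (-1) o1)))
    (has_isumZ (q * (1 + q * g))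
      (has_isumD (sqnorm_has_isum tg) (has_isumZ (-1) o1))).
  rewrite !mulr0 !addr0 mulr0 add0r; apply: has_isum_eq => i; rewrite /X.
  rewrite (_ : - (a * b) * (q * g) ^+ 2 * _ =
    (- (a * b) * (1 + node t i) * (q * g) ^+ 2 * phi (q * g) (node t i)) *
     phi g (node t i) * node_wgt t i); last by ring.
  rewrite -(phi_recurrence hq ha hb) // (_ : q * g / q = g); last by field.
  ring.
have E3 := has_isumZ (q ^+ 2) E1.
have E : q ^+ 2 * ((1 + a * g) * (1 + b * g) * sqnorm (q * g)) = q * (1 + q * g)
  * sqnorm g.
  by apply: has_isum_unique E3 _; apply: has_isum_eq E2 => i; ring.
have W : (1 + q * g) * wgt (q * g) = (1 + a * g) * (1 + b * g) * wgt g.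
  by rewrite -pearsonE // pearson_qx.
apply: (mulfI (mulf_neq0 h1 h2)); rewrite [RHS]mulrA -W.
apply: (mulfI qn0);
  rewrite [LHS](_ : _ = q ^+ 2 * ((1 + a * g) * (1 + b * g) * sqnorm (q * g)) *
    wgt (q * g)); last by ring.
by rewrite E; ring.
Qed.

End Primal.
End Orthogonal.

(** * Kernels with orthogonal rows and columns *)

Section RealLimits.
Variable R : realType.
Implicit Types (u v : nat -> R).

Lemma rlim_le u (l K : R) : u @ \oo --> l ->
  (exists N, forall n, (N <= n)%N -> u n <= K) -> l <= K.
Proof.
move=> /cvgrPdist_lt hu [N hN]; apply/ler_addgt0Pr => e /hu [M _ hM].
have := hM (maxn M N) (leq_maxl _ _); have := hN _ (leq_maxr M N).
by rewrite ltr_norml; lra.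
Qed.

Lemma rlim_dist_le u (l c K : R) : u @ \oo --> l ->
  (exists N, forall n, (N <= n)%N -> `|u n - c| <= K) -> `|l - c| <= K.
Proof.
move=> hu [N hN].
have h : (fun n => `|u n - c|) @ \oo --> `|l - c|.
  by apply: cvg_norm; apply: cvgB => //; exact: cvg_cst.
by apply: rlim_le h _; exists N.
Qed.

Lemma rlim_sum (T : Type) (s : seq T) (F : T -> nat -> R) (l : T -> R) :
  (forall i, F i @ \oo --> l i) ->
  (fun n => \sum_(i <- s) F i n) @ \oo --> \sum_(i <- s) l i.
Proof.
move=> h; elim: s => [|i s IH].
  by rewrite big_nil; under eq_fun do rewrite big_nil; exact: cvg_cst.
by rewrite big_cons; under eq_fun do rewrite big_cons; apply: cvgD.
Qed.

Lemma rlimZ (c : R) u l : u @ \oo --> l -> (fun n => c * u n) @ \oo --> c * l.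
Proof. by move=> h; apply: cvgM h; exact: cvg_cst. Qed.

Lemma rlim_eventually u (l : R) N : (forall n, (N <= n)%N -> u n = l) ->
  u @ \oo --> l.
Proof.
move=> h; apply/cvgrPdist_lt => e e0; exists N => // n /= /h ->.
by rewrite subrr normr0.
Qed.
End RealLimits.

Section AbstractL2.
Variables (R : realType) (T : eqType) (S : nat -> seq T).
Hypothesis uniqS : forall N, uniq (S N).
Hypothesis stepS : forall N, exists s, S N.+1 = S N ++ s.
Hypothesis exhS : forall i, exists N, i \in S N.
Implicit Types (F G f : T -> R) (N M n : nat).

(** Sums over the index type are limits of sums over the increasing finite
    stages [S N]. *)
Definition psum F N : R := \sum_(i <- S N) F i.
Definition pcvg F (l : R) := psum F @ \oo --> l.

Lemma stage_cat N M : (N <= M)%N -> exists s, S M = S N ++ s.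
Proof.
move=> /subnKC <-; elim: (M - N)%N => [|k [s IH]].
  by exists [::]; rewrite addn0 cats0.
by rewrite addnS; have [s' ->] := stepS (N + k); exists (s ++ s');
  rewrite IH catA.
Qed.

Lemma stage_sub N M i : (N <= M)%N -> i \in S N -> i \in S M.
Proof. by move=> /stage_cat [s ->] h; rewrite mem_cat h. Qed.

Lemma psum_mono F N M : (forall i, 0 <= F i) -> (N <= M)%N -> psum F N <= psum F
  M.
Proof.
move=> F0 /stage_cat [s e]; rewrite /psum e big_cat /= lerDl.
by apply: sumr_ge0.
Qed.

Lemma psum_le_lim F l N : (forall i, 0 <= F i) -> pcvg F l -> psum F N <= l.
Proof.
move=> F0 h; rewrite -lerN2; apply: (@rlim_le _ (fun n => - psum F n));
  first exact: cvgN.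
by exists N => n /(psum_mono F0); rewrite lerN2.
Qed.

Lemma psum_dist F G N M : (forall i, `|F i| <= G i) -> (N <= M)%N ->
  `|psum F N - psum F M| <= psum G M - psum G N.
Proof.
move=> FG /stage_cat [s e]; rewrite /psum e !big_cat /= opprD addrA subrr add0r
  normrN.
rewrite addrAC subrr add0r; apply: le_trans (ler_norm_sum _ _ _) _.
by apply: ler_sum.
Qed.

Lemma sum_delta (s : seq T) o F : uniq s -> o \in s ->
  \sum_(i <- s) (i == o)%:R * F i = F o.
Proof.
move=> us os; rewrite (bigD1_seq o) //= eqxx mul1r big1 ?addr0 //.
by move=> i /negPf ->; rewrite mul0r.
Qed.

Lemma pcvg_fin F N : pcvg (fun x => if x \in S N then F x else 0)
  (\sum_(x <- S N) F x).
Proof.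
apply: (@rlim_eventually _ _ _ N) => M NM; rewrite /psum.
have [s e] := stage_cat NM; have := uniqS M;
  rewrite e cat_uniq => /and3P[_ /hasPn hs _].
rewrite big_cat /= [X in _ + X]big_seq [X in _ + X]big1 ?addr0.
  by rewrite !big_seq; apply: eq_bigr => i ->.
by move=> i /hs /negPf ->.
Qed.

Lemma psum_out_le F l N M : (forall i, 0 <= F i) -> pcvg F l ->
  psum (fun x => if x \in S N then 0 else F x) M <= l - psum F N.
Proof.
move=> F0 h.
have G0 i : 0 <= (if i \in S N then 0 else F i) by case: ifP.
apply: le_trans (psum_mono G0 (leq_maxl M N)) _.
have NM : (N <= maxn M N)%N by exact: leq_maxr.
have := psum_le_lim (maxn M N) F0 h; have [s e] := stage_cat NM.
have := uniqS (maxn M N); rewrite /psum e cat_uniq => /and3P[_ /hasPn hs _].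
have z1 : \sum_(i <- S N) (if i \in S N then 0 else F i) = 0.
  by rewrite big_seq big1 // => i ->.
have z2 : \sum_(i <- s) (if i \in S N then 0 else F i) = \sum_(i <- s) F i.
  by rewrite [LHS]big_seq [RHS]big_seq; apply: eq_bigr => i /hs /negPf ->.
by rewrite !big_cat /= z1 z2 add0r lerBrDl.
Qed.

Variables (phi : T -> T -> R) (mu nu h hh : T -> R).
Hypothesis mu0 : forall i, 0 < mu i.
Hypothesis nu0 : forall i, 0 < nu i.
Hypothesis rows : forall g l, pcvg (fun x => phi g x * phi l x * mu x)
  ((g == l)%:R * h g).
Hypothesis cols : forall x y, pcvg (fun g => phi g x * phi g y * nu g)
  ((x == y)%:R * hh x).

(** Pythagoras, from the orthogonality of the rows. *)
Lemma comb_sq_cvg (c : T -> R) n :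
  pcvg (fun x => (\sum_(g <- S n) c g * phi g x) ^+ 2 * mu x)
    (\sum_(g <- S n) c g ^+ 2 * h g).
Proof.
have -> : \sum_(g <- S n) c g ^+ 2 * h g =
    \sum_(g <- S n) \sum_(l <- S n) c g * c l * ((g == l)%:R * h g).
  rewrite big_seq [RHS]big_seq; apply: eq_bigr => g gS.
  transitivity (\sum_(l <- S n) (l == g)%:R * (c g * c l * h g)).
    by rewrite sum_delta // expr2.
  by apply: eq_bigr => l _; rewrite eq_sym; ring.
have -> : (fun x => (\sum_(g <- S n) c g * phi g x) ^+ 2 * mu x) =
    (fun x => \sum_(g <- S n) \sum_(l <- S n) c g * c l *
      (phi g x * phi l x * mu x)).
  apply/funext => x; rewrite expr2 mulr_suml mulr_suml; apply: eq_bigr => g _.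
  rewrite mulr_sumr mulr_suml; apply: eq_bigr => l _; ring.
rewrite /pcvg (_ : psum _ = fun N => \sum_(g <- S n) \sum_(l <- S n)
    c g * c l * psum (fun x => phi g x * phi l x * mu x) N).
  apply: rlim_sum => g; apply: rlim_sum => l; apply: rlimZ; exact: rows.
apply/funext => N; rewrite /psum exchange_big; apply: eq_bigr => g _.
by rewrite exchange_big; apply: eq_bigr => l _; rewrite mulr_sumr.
Qed.

Lemma comb_pair_cvg (c : T -> R) n l : l \in S n ->
  pcvg (fun x => (\sum_(g <- S n) c g * phi g x) * phi l x * mu x) (c l * h l).
Proof.
move=> ln.
have -> : c l * h l = \sum_(g <- S n) c g * ((g == l)%:R * h g).
  transitivity (\sum_(g <- S n) (g == l)%:R * (c g * h g));
    first by rewrite sum_delta.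
  by apply: eq_bigr => g _; ring.
have -> : (fun x => (\sum_(g <- S n) c g * phi g x) * phi l x * mu x) =
    (fun x => \sum_(g <- S n) c g * (phi g x * phi l x * mu x)).
  apply/funext => x; rewrite !mulr_suml; apply: eq_bigr => g _; ring.
rewrite /pcvg (_ : psum _ = fun N => \sum_(g <- S n)
    c g * psum (fun x => phi g x * phi l x * mu x) N).
  apply: rlim_sum => g; apply: rlimZ; exact: rows.
apply/funext => N; rewrite /psum exchange_big; apply: eq_bigr => g _.
by rewrite mulr_sumr.
Qed.

Section Constants.
Variable M : R.
Hypothesis bnd : forall g, nu g * h g <= M.
Variable o : T.
Hypothesis phi_o : forall g, phi g o = 1.

(** Let [Sn] be the partial sums over [g] of [nu g * phi g x]. By column
    orthogonality and [phi g o = 1] they tend pointwise to [hh o] times the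
    indicator of [o]; by row orthogonality their inner product with [phi l]
    is [nu l * h l]. Comparing the two limits gives the claim, and the
    exchange is legitimate because the bound on [nu g * h g] keeps [Sn]
    bounded in the square norm. *)
Lemma norm_constant l : nu l * h l = mu o * hh o.
Proof.
have M0 : 0 <= M.
  apply: le_trans (bnd o); rewrite mulr_ge0 ?(ltW (nu0 _)) //.
  have p0 i : 0 <= phi o i * phi o i * mu i by rewrite -expr2 mulr_ge0 ?sqr_ge0
    // ltW.
  have hO : pcvg (fun x => phi o x * phi o x * mu x) (h o).
    by have := @rows o o; rewrite eqxx mul1r.
  by apply: le_trans (psum_le_lim 0 p0 hO); apply: sumr_ge0.
have hnu : pcvg nu (hh o).
  have := @cols o o; rewrite eqxx mul1r; congr (pcvg _ _); apply/funext => g.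
  by rewrite phi_o !mul1r.
pose Sn n x := \sum_(g <- S n) nu g * phi g x.
pose Q := M * hh o.
have Q0 : 0 <= Q.
  have nu0' i : 0 <= nu i by exact: ltW.
  by rewrite mulr_ge0 //; apply: le_trans (psum_le_lim 0 nu0' hnu);
    apply: sumr_ge0.
have sq0 n i : 0 <= Sn n i ^+ 2 * mu i by rewrite mulr_ge0 ?sqr_ge0 // ltW.
have hQ n N : psum (fun x => Sn n x ^+ 2 * mu x) N <= Q.
  apply: le_trans (psum_le_lim N (sq0 n) (@comb_sq_cvg nu n)) _.
  apply: (@le_trans _ _ (M * psum nu n)); last first.
    by rewrite ler_wpM2l // psum_le_lim // => i; exact: ltW.
  rewrite /psum mulr_sumr; apply: ler_sum => g _.
  by rewrite expr2 -mulrA mulrC ler_wpM2r // ltW.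
have hl0 i : 0 <= phi l i * phi l i * mu i by rewrite -expr2 mulr_ge0 ?sqr_ge0
  // ltW.
have hl : pcvg (fun x => phi l x * phi l x * mu x) (h l).
  by have := @rows l l; rewrite eqxx mul1r.
(* The tail of the inner product of [Sn] with [phi l] is controlled by
   [x y <= d x^2 / 2 + y^2 / (2 d)], with [d] free. *)
have A (d : R) N0 n : 0 < d -> l \in S n ->
    `|nu l * h l - psum (fun x => Sn n x * phi l x * mu x) N0| <=
    d / 2 * Q + (h l - psum (fun x => phi l x * phi l x * mu x) N0) / (2 * d).
  move=> d0 ln; apply: (rlim_dist_le (@comb_pair_cvg nu n l ln));
    exists N0 => N NN.
  rewrite distrC.
  apply: (@le_trans _ _
    (psum (fun x => d / 2 * (Sn n x ^+ 2 * mu x) + (phi l x * phi l x * mu x) /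
      (2 * d)) N -
     psum (fun x => d / 2 * (Sn n x ^+ 2 * mu x) + (phi l x * phi l x * mu x) /
       (2 * d)) N0)).
    apply: psum_dist => // i; rewrite normrM (gtr0_norm (mu0 i)).
    rewrite (_ : _ + _ = (d / 2 * Sn n i ^+ 2 + phi l i ^+ 2 / (2 * d)) * mu i);
      last by ring.
    rewrite ler_wpM2r ?(ltW (mu0 i)) // normrM.
    rewrite -(real_normK (num_real (Sn n i)))
      -(real_normK (num_real (phi l i))).
    move: (`|Sn n i|) (`|phi l i|) => x y; rewrite -subr_ge0.
    rewrite (_ : _ - _ = (d * x - y) ^+ 2 / (2 * d)); last by field;
      rewrite gt_eqF.
    by rewrite divr_ge0 ?sqr_ge0 // mulr_ge0 // ltW.
  rewrite /psum !big_split /= -!mulr_sumr -!mulr_suml.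
  have h1 := hQ n N; have h2 := psum_le_lim N hl0 hl.
  have h3 : 0 <= psum (fun x => Sn n x ^+ 2 * mu x) N0 by apply: sumr_ge0.
  rewrite opprD addrACA; apply: lerD.
    rewrite -mulrBr ler_wpM2l ?divr_ge0 ?(ltW d0) //; move: h1 h3;
      rewrite /psum; lra.
  rewrite -mulrBl ler_wpM2r ?invr_ge0 ?mulr_ge0 ?(ltW d0) //.
  by move: h2; rewrite /psum; lra.
have [Nl hNl] := exhS l; have [No hNo] := exhS o.
(* Over the finite stage [S N0] the pointwise limit of [Sn] can be taken. *)
have B (d : R) N0 : 0 < d -> (No <= N0)%N ->
    `|mu o * hh o - nu l * h l| <=
    d / 2 * Q + (h l - psum (fun x => phi l x * phi l x * mu x) N0) / (2 * d).
  move=> d0 NN.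
  apply: (@rlim_dist_le _ (fun n => psum (fun x => Sn n x * phi l x * mu x)
    N0)); last first.
    exists Nl => n Nn; rewrite distrC; apply: A => //; exact: stage_sub hNl.
  have -> : mu o * hh o = \sum_(x <- S N0) (phi l x * mu x) *
    ((x == o)%:R * hh x).
    transitivity (\sum_(x <- S N0) (x == o)%:R * (phi l x * mu x * hh x)).
      by rewrite sum_delta ?phi_o ?mul1r //; exact: stage_sub hNo.
    by apply: eq_bigr => x _; ring.
  rewrite (_ : (fun n => _) = fun n => \sum_(x <- S N0) (phi l x * mu x) *
     psum (fun g => phi g x * phi g o * nu g) n).
    by apply: rlim_sum => x; apply: rlimZ; exact: cols.
  apply/funext => n; apply: eq_bigr => x _;
    rewrite /Sn !mulr_suml /psum mulr_sumr.
  by apply: eq_bigr => g _; rewrite phi_o; ring.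
(* Now [N0] tends to infinity, and afterwards [d] to zero. *)
have Cc (d : R) : 0 < d -> `|mu o * hh o - nu l * h l| <= d / 2 * Q.
  move=> d0; rewrite -subr_ge0 -lerN2 oppr0.
  have hlim : (fun N => `|mu o * hh o - nu l * h l| - (d / 2 * Q) -
      (h l - psum (fun x => phi l x * phi l x * mu x) N) / (2 * d)) @ \oo -->
      `|mu o * hh o - nu l * h l| - (d / 2 * Q) - (h l - h l) / (2 * d).
    apply: cvgB; first exact: cvg_cst.
    by apply: cvgM; [apply: cvgB => //; exact: cvg_cst|exact: cvg_cst].
  have := rlim_le hlim (K := 0); rewrite subrr mul0r subr0 opprB; apply.
  by exists No => N /(B _ _ d0); lra.
apply/eqP; rewrite eq_sym -subr_eq0 -normr_le0; apply/ler_addgt0Pr => e e0;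
  rewrite add0r.
have Q1 : 0 < Q + 1 by lra.
apply: le_trans (Cc (2 * e / (Q + 1)) _) _;
  first by rewrite divr_gt0 // mulr_gt0.
rewrite (_ : _ * Q = e * (Q / (Q + 1))); last by field; rewrite gt_eqF.
rewrite -[leRHS]mulr1 ler_wpM2l ?(ltW e0) // ler_pdivrMr // mul1r; lra.
Qed.
End Constants.

Section Density.
Variable kap : R.
Hypothesis kap0 : 0 < kap.
Hypothesis hk : forall g, nu g * h g = kap.
Hypothesis hhk : forall x, mu x * hh x = kap.

(** Replace [f] by its restriction [fN] to a finite stage. The squared
    distance of [fN] to its [n]-th orthogonal expansion is its squared norm
    minus a Bessel sum, and column orthogonality computes the limit of the
    latter as the full squared norm. *)
Lemma density f L : pcvg (fun x => f x ^+ 2 * mu x) L -> forall e : R, 0 < e ->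
  exists c : T -> R, exists n0, forall n, (n0 <= n)%N -> forall M,
    psum (fun x => (f x - \sum_(g <- S n) c g * phi g x) ^+ 2 * mu x) M <= e.
Proof.
move=> hf e e0.
have f0 x : 0 <= f x ^+ 2 * mu x by rewrite mulr_ge0 ?sqr_ge0 // ltW.
have e4 : 0 < e / 4 by lra.
have [N _ /(_ N (leqnn N)) hN] :=
  (cvgrPdist_lt (psum (fun x => f x ^+ 2 * mu x)) L).1 hf _ e4.
(* [b g] is the inner product of [fN] with [phi g], and dividing it by
   [h g = kap / nu g] gives the Fourier coefficient [c g]. *)
pose b g := \sum_(y <- S N) f y * mu y * phi g y.
pose c g := nu g / kap * b g.
pose fN x := if x \in S N then f x else 0.
pose G n x := \sum_(g <- S n) c g * phi g x.
pose A := \sum_(x <- S N) f x ^+ 2 * mu x.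
pose Rn n := A - \sum_(g <- S n) c g * b g.
have sqnorm_re n : pcvg (fun x => (fN x - G n x) ^+ 2 * mu x) (Rn n).
  have h1 := @pcvg_fin (fun x => f x ^+ 2 * mu x) N.
  have h2 := @pcvg_fin (fun x => f x * G n x * mu x) N.
  have h3 := @comb_sq_cvg c n.
  have -> : Rn n = A + (-2) * (\sum_(x <- S N) f x * G n x * mu x) +
    \sum_(g <- S n) c g ^+ 2 * h g.
    have -> : \sum_(x <- S N) f x * G n x * mu x = \sum_(g <- S n) c g * b g.
      transitivity (\sum_(x <- S N) \sum_(g <- S n) c g *
        (f x * mu x * phi g x)).
        apply: eq_bigr => x _; rewrite /G mulr_sumr mulr_suml;
          apply: eq_bigr => g _; ring.
      by rewrite exchange_big; apply: eq_bigr => g _; rewrite mulr_sumr.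
    have -> : \sum_(g <- S n) c g ^+ 2 * h g = \sum_(g <- S n) c g * b g.
      apply: eq_bigr => g _; rewrite expr2 -mulrA; congr (_ * _).
      rewrite /c (_ : _ * h g = b g * (nu g * h g) / kap); last by ring.
      by rewrite hk mulfK // gt_eqF.
    rewrite /Rn; ring.
  rewrite /pcvg (_ : psum _ = fun M =>
      psum (fun x => if x \in S N then f x ^+ 2 * mu x else 0) M +
      -2 * psum (fun x => if x \in S N then f x * G n x * mu x else 0) M +
      psum (fun x => (\sum_(g <- S n) c g * phi g x) ^+ 2 * mu x) M).
    by apply: cvgD => //; apply: cvgD => //; exact: rlimZ.
  apply/funext => M; rewrite /psum mulr_sumr -!big_split /=;
    apply: eq_bigr => x _.
  by rewrite /fN -/(G n x); case: ifP => _; ring.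
(* Parseval for [fN]: expand the squares of the [b g] and use column
   orthogonality. *)
have hRlim : Rn @ \oo --> (0 : R).
  have -> : 0 = A - kap^-1 * (kap * A) by rewrite mulKf ?subrr // gt_eqF.
  apply: cvgB; first exact: cvg_cst.
  rewrite (_ : (fun n => _) = fun n => kap^-1 * \sum_(g <- S n) b g ^+ 2 * nu
    g); last first.
    by apply/funext => n; rewrite mulr_sumr; apply: eq_bigr => g _; rewrite /c;
      ring.
  apply: rlimZ.
  have -> : kap * A = \sum_(y <- S N) \sum_(z <- S N) f y * mu y * (f z * mu z)
    * ((y == z)%:R * hh y).
    rewrite /A mulr_sumr big_seq [RHS]big_seq; apply: eq_bigr => y yS.
    transitivity
      (\sum_(z <- S N) (z == y)%:R * (f y * mu y * (f z * mu z) * hh y)).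
      by rewrite sum_delta // -(hhk y); ring.
    by apply: eq_bigr => z _; rewrite eq_sym; ring.
  rewrite (_ : (fun n => _) = fun n => \sum_(y <- S N) \sum_(z <- S N) f y * mu
    y * (f z * mu z) *
     psum (fun g => phi g y * phi g z * nu g) n).
    by apply: rlim_sum => y; apply: rlim_sum => z; apply: rlimZ; exact: cols.
  apply/funext => n.
  transitivity (\sum_(g <- S n) \sum_(y <- S N) \sum_(z <- S N)
     f y * mu y * (f z * mu z) * (phi g y * phi g z * nu g)).
    apply: eq_bigr => g _; rewrite expr2 mulr_suml mulr_suml;
      apply: eq_bigr => y _.
    rewrite mulr_sumr mulr_suml; apply: eq_bigr => z _; ring.
  rewrite exchange_big; apply: eq_bigr => y _; rewrite exchange_big;
    apply: eq_bigr => z _.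
  by rewrite mulr_sumr.
have [n0 _ hn0] := (cvgrPdist_lt Rn 0).1 hRlim _ e4.
exists c, n0 => n nn M.
have r0 x : 0 <= (fN x - G n x) ^+ 2 * mu x by rewrite mulr_ge0 ?sqr_ge0 // ltW.
have k1 := psum_le_lim M r0 (sqnorm_re n).
have k2 := psum_out_le N M f0 hf.
have k3 : Rn n < e / 4.
  by have := hn0 n nn; rewrite sub0r normrN => /(le_lt_trans (ler_norm _)).
have k4 : L - psum (fun x => f x ^+ 2 * mu x) N < e / 4 by apply: le_lt_trans
  (ler_norm _) hN.
apply: (@le_trans _ _
  (2 * psum (fun x => if x \in S N then 0 else f x ^+ 2 * mu x) M +
   2 * psum (fun x => (fN x - G n x) ^+ 2 * mu x) M)); last by lra.
rewrite /psum !mulr_sumr -big_split /=; apply: ler_sum => x _.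
rewrite -/(G n x) /fN; have m0 := ltW (mu0 x).
case: ifP => _.
  by rewrite mulr0 add0r mulr_natl mulr2n lerDl mulr_ge0 ?sqr_ge0.
rewrite -subr_ge0 (_ : _ - _ = (f x + G n x) ^+ 2 * mu x); last by ring.
by rewrite mulr_ge0 ?sqr_ge0.
Qed.
End Density.

End AbstractL2.

(** * The conditions on the parameters *)

Section ParamConditions.
Variable R : realType.
Notation C := R[i].
Implicit Types (q a b t x c : C) (n : nat) (k : int).

(** What the proof uses of the four alternatives: reality of [phi] and
    positivity of the weight, in a form that survives the exchange of [t]
    and [(a * b * t)^-1]. *)
Definition admissible q a b t : Prop :=
  [/\ 0 < q < 1, 0 < t, 0 < a * b, a + b \is Num.real &
   (forall n, 0 < (1 - a * q ^+ n) * (1 - b * q ^+ n)) /\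
   (forall k, 0 < (1 + a * t * q ^ k) * (1 + b * t * q ^ k))].

Lemma qz_le1 q k : 0 < q < 1 -> 0 <= k -> q ^ k <= 1.
Proof. by move=> hq; case: k => // n _; exact: qX_le1. Qed.

Lemma qz_ge1 q k : 0 < q < 1 -> k <= 0 -> 1 <= q ^ k.
Proof.
move=> hq; case: k => n; first by case: n.
by move=> _; rewrite NegzE -exprnN invf_ge1 ?qX_gt0 // qX_le1.
Qed.

(** Both numbers lie in the same gap of the integral powers of [q], so
    multiplying by [q^k] and comparing with [1] gives the same answer for
    both. *)
Lemma same_gap q al be (k0 : int) k : 0 < q < 1 ->
  q ^ k0 < al < q ^ (k0 - 1) -> q ^ k0 < be < q ^ (k0 - 1) ->
  0 < (1 - al * q ^ k) * (1 - be * q ^ k).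
Proof.
move=> hq /andP[al1 al2] /andP[be1 be2]; have q0 := q_gt0 hq.
have qk : 0 < q ^ k by exact: qz_gt0.
have qn0 : q != 0 by rewrite gt_eqF.
have [h|h] : (k0 - 1 + k <= -1) \/ (0 <= k0 - 1 + k) by clear; lia.
  have h1 : 1 <= q ^ (k0 + k) by apply: qz_ge1 => //; clear -h; lia.
  have neg c : q ^ k0 < c -> 1 - c * q ^ k < 0.
    move=> hc; rewrite subr_lt0; apply: le_lt_trans h1 _.
    by rewrite expfzDr // ltr_pM2r.
  by rewrite nmulr_rgt0 ?neg.
have h1 : q ^ (k0 - 1 + k) <= 1 by apply: qz_le1.
have pos c : c < q ^ (k0 - 1) -> 0 < 1 - c * q ^ k.
  move=> hc; rewrite subr_gt0; apply: lt_le_trans h1.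
  by rewrite expfzDr // ltr_pM2r.
by rewrite mulr_gt0 ?pos.
Qed.

Lemma conj_mul_gt0 (z : C) : z != 0 -> 0 < z^* * z.
Proof. by move=> z0; rewrite mulrC -normCK exprn_gt0 // normr_gt0. Qed.

(** In the first alternative the two factors are conjugate; in the second,
    and for the factors not covered by the gap condition in the last two,
    each factor is positive; the gap conditions give factors of equal sign. *)
Lemma parameters_admissible q a b t : 0 < q < 1 -> parameters a b q t ->
  admissible q a b t.
Proof.
move=> hq [t0 hpar]; have q0 := q_gt0 hq; have qn0 : q != 0 by rewrite gt_eqF.
have qr k : (q ^ k)^* = q ^ k.
  by apply: conj_Creal; apply: ger0_real; apply: ltW; exact: qz_gt0.
have tr : t^* = t by apply: conj_Creal; apply: ger0_real; exact: ltW.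
case: hpar =>
  [[ab anr]|[/andP[a0 a1] /andP[b0 b1]]|[k0 [_ ka kb]]|[k0 [ka kb]]].
- have bnr : b \isn't Num.real.
    apply: contra anr => br; by rewrite ab conj_Creal.
  have lin (y : C) : y \is Num.real -> y != 0 -> 1 + b * y != 0.
    move=> yr y0; apply: contra bnr => /eqP h.
    have -> : b = - y^-1.
      by apply: (mulIf y0); rewrite mulNr mulVf //; apply/eqP;
        rewrite -addr_eq0 addrC h.
    by rewrite realN realV.
  have cl (y : C) : y \is Num.real -> y != 0 -> 0 < (1 + a * y) * (1 + b * y).
    move=> yr y0; have -> : 1 + a * y = (1 + b * y)^*.
      by rewrite rmorphD rmorph1 rmorphM /= (conj_Creal yr) ab.
    by apply: conj_mul_gt0; exact: lin.
  have bn0 : b != 0 by apply: contra bnr => /eqP ->; exact: real0.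
  split=> //.
  + by rewrite ab conj_mul_gt0.
  + by rewrite ab CrealE rmorphD /= conjCK addrC.
  + split=> [n|k].
      have yr : - q ^+ n \is Num.real by rewrite realN ger0_real // qX_ge0.
      have y0 : - q ^+ n != 0 by rewrite oppr_eq0 expf_neq0.
      by have := cl _ yr y0; rewrite !mulrN.
    have y0 : 0 < t * q ^ k by rewrite mulr_gt0 // qz_gt0.
    have := cl _ (ger0_real (ltW y0)) (lt0r_neq0 y0); by rewrite !mulrA.
- split=> //; first exact: mulr_gt0.
    by apply: ger0_real; rewrite addr_ge0 // ltW.
  split=> [n|k].
    have P c : 0 < c -> c < 1 -> 0 < 1 - c * q ^+ n.
      move=> c0 c1; rewrite subr_gt0; apply: le_lt_trans c1.
      by rewrite ler_piMr ?(ltW c0) // qX_le1.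
    by rewrite mulr_gt0 // P.
  have P c : 0 < c -> 0 < 1 + c * t * q ^ k.
    by move=> c0; rewrite addr_gt0 // !mulr_gt0 // qz_gt0.
  by rewrite mulr_gt0 // P.
- have P c : q ^ k0 < c < q ^ (k0 - 1) -> 0 < c.
    by case/andP=> h _; apply: lt_trans h; exact: qz_gt0.
  have a0 := P _ ka; have b0 := P _ kb.
  split=> //; first exact: mulr_gt0.
    by apply: ger0_real; rewrite addr_ge0 // ltW.
  split=> [n|k]; first exact: (same_gap n hq ka kb).
  have P' c : 0 < c -> 0 < 1 + c * t * q ^ k.
    by move=> c0; rewrite addr_gt0 // !mulr_gt0 // qz_gt0.
  by rewrite mulr_gt0 // P'.
- have P c : q ^ k0 < - (c * t) < q ^ (k0 - 1) -> c < 0.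
    case/andP=> h _; have : 0 < - (c * t) by apply: lt_trans h; exact: qz_gt0.
    by rewrite oppr_gt0 pmulr_llt0.
  have a0 := P _ ka; have b0 := P _ kb.
  split=> //; first by rewrite nmulr_rgt0.
    by apply: ler0_real; rewrite -[leRHS]addr0 lerD // ltW.
  split=> [n|k].
    have P' c : c < 0 -> 0 < 1 - c * q ^+ n.
      by move=> c0; rewrite -mulNr addr_gt0 // mulr_gt0 ?oppr_gt0 // qX_gt0.
    by rewrite mulr_gt0 // P'.
  by have := same_gap k hq ka kb; rewrite !mulNr !opprK.
Qed.

Lemma admissible_nondeg q a b t : admissible q a b t -> nondeg q t a /\ nondeg q
  t b.
Proof.
move=> [hq t0 ab _ [h1 h2]].
have := lt0r_neq0 ab; rewrite mulf_eq0 negb_or => /andP[a0 b0].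
split; split=> // n.
- by have := lt0r_neq0 (h1 n); rewrite mulf_eq0 negb_or => /andP[].
- by have := lt0r_neq0 (h2 n); rewrite mulf_eq0 negb_or => /andP[].
- by have := lt0r_neq0 (h1 n); rewrite mulf_eq0 negb_or => /andP[].
- by have := lt0r_neq0 (h2 n); rewrite mulf_eq0 negb_or => /andP[].
Qed.

(** The product of [1 + a s q^k] and [1 + b s q^k] is a positive multiple of
    the product of [1 + a t q^-k] and [1 + b t q^-k]. *)
Lemma admissible_dual q a b t : admissible q a b t ->
  admissible q a b (a * b * t)^-1.
Proof.
move=> h; have [[a0 _ _] [b0 _ _]] := admissible_nondeg h.
case: h => hq t0 ab abr [h1 h2]; have q0 := q_gt0 hq.
have tn0 := lt0r_neq0 t0; have qn0 := lt0r_neq0 q0.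
split=> //; first by rewrite invr_gt0 mulr_gt0.
split=> // k; have qk := qz_gt0 hq k.
have -> : (1 + a * (a * b * t)^-1 * q ^ k) * (1 + b * (a * b * t)^-1 * q ^ k) =
  q ^ k * q ^ k / (a * b * t * t) *
    ((1 + a * t * q ^ (- k)) * (1 + b * t * q ^ (- k))).
  by rewrite -invr_expz; field; rewrite a0 b0 tn0 lt0r_neq0.
have p1 : 0 < a * b * t * t by apply: mulr_gt0 => //; apply: mulr_gt0.
have p2 : 0 < q ^ k * q ^ k by apply: mulr_gt0.
by apply: mulr_gt0 => //; apply: divr_gt0.
Qed.

Lemma clim_ge0 (u : nat -> C) (l : C) : (forall n, 0 <= u n) -> u ~> l ->
  0 <= l.
Proof.
move=> u0 h; suff <- : `|l| = l by [].
by apply: (clim_unique (clim_norm h)); apply: clim_eq h => n; rewrite ger0_norm.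
Qed.

Lemma clim_real (u : nat -> C) (l : C) : (forall n, u n \is Num.real) ->
  u ~> l -> l \is Num.real.
Proof.
move=> ur h; have h2 := real_clim (clim_Re h).
have -> : l = ((complex.Re l)%:C)%C.
  by apply: (clim_unique h); apply: clim_eq h2 => n; rewrite RRe_real.
by rewrite complex_real.
Qed.

Section Admissible.
Variables q a b t : C.
Hypothesis hadm : admissible q a b t.
Let hq : 0 < q < 1. Proof. by case: hadm. Qed.
Let q0 : 0 < q. Proof. exact: q_gt0 hq. Qed.
Let t0 : 0 < t. Proof. by case: hadm. Qed.
Local Notation qfact_inf := (qfact_inf q).
Local Notation qfact := (qfact q).
Local Notation phi := (phi q a b).

Lemma qfact_inf_gt0 c : c < 1 -> c \is Num.real -> 0 < qfact_inf c.
Proof.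
move=> c1 cr.
have P (k : nat) : 0 < 1 - c * q ^+ k.
  rewrite subr_gt0; have [c0|c0] := real_leP (real0 C) cr.
    by apply: le_lt_trans c1; rewrite ler_piMr // qX_le1.
  by apply: lt_trans ltr01; rewrite pmulr_llt0 // qX_gt0.
rewrite lt0r (qfact_inf_neq0 hq) /=; last by move=> k; rewrite lt0r_neq0.
apply: clim_ge0 (qfact_clim hq c) => n; apply: prodr_ge0 => k _; exact: ltW.
Qed.

Lemma qfact_inf_pair_gt0 c1 c2 : (forall k : nat, 0 < (1 - c1 * q ^+ k) *
  (1 - c2 * q ^+ k)) ->
  0 < qfact_inf c1 * qfact_inf c2.
Proof.
move=> h; have h' (k : nat) : 1 - c1 * q ^+ k != 0 /\ 1 - c2 * q ^+ k != 0.
  by have := lt0r_neq0 (h k); rewrite mulf_eq0 negb_or => /andP[].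
rewrite lt0r mulf_neq0 /=; try by apply: (qfact_inf_neq0 hq) => k; case: (h' k).
apply: clim_ge0 (climM (qfact_clim hq c1) (qfact_clim hq c2)) => n.
rewrite !qfactE -big_split /=; apply: prodr_ge0 => k _; exact: ltW.
Qed.

Lemma node_abs_gt0 i : 0 < node_abs q t i.
Proof. by case: i => [n|k]; [exact: qX_gt0|rewrite /= mulr_gt0 // qz_gt0]. Qed.

Lemma node_real i : node q t i \is Num.real.
Proof.
case: i => [n|k] /=; first by rewrite realN ger0_real // qX_ge0.
by rewrite ger0_real // ltW // mulr_gt0 // qz_gt0.
Qed.

Lemma node_neq0 i : node q t i != 0.
Proof.
case: i => [n|k] /=; first by rewrite oppr_eq0 expf_neq0 // lt0r_neq0.
by rewrite lt0r_neq0 // mulr_gt0 // qz_gt0.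
Qed.

Lemma node_norm i : `|node q t i| = node_abs q t i.
Proof.
case: i => [n|k] /=; first by rewrite normrN qX_norm.
by rewrite gtr0_norm // mulr_gt0 // qz_gt0.
Qed.

Lemma node_wgt_gt0 i : 0 < node_wgt q a b t i.
Proof.
have [_ _ _ _ [h1 h2]] := hadm; have qn0 := lt0r_neq0 q0.
rewrite /node_wgt mulr_gt0 ?node_abs_gt0 // /wgt divr_gt0 //.
  case: i => [n|k] /=.
    rewrite mulrNN -exprS; apply: qfact_inf_gt0; first exact: qX_lt1.
    by rewrite ger0_real // qX_ge0.
  have p : 0 < q * (t * q ^ k) by rewrite !mulr_gt0 // qz_gt0.
  rewrite mulNr; apply: qfact_inf_gt0; first by apply: lt_trans ltr01;
    rewrite oppr_lt0.
  by rewrite realN ger0_real // ltW.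
(* Only the product of the two denominators is known to be positive. *)
apply: qfact_inf_pair_gt0; case: i => [n|k] m /=.
  have := h1 (n + m)%N; rewrite exprD; congr (0 < _); ring.
have := h2 (k + m); rewrite expfzDr // -exprnP; congr (0 < _); ring.
Qed.

(** The coefficients depend on [a] and [b] through [a b] and [a + b] only,
    which are real also when [a] and [b] are conjugate. *)
Lemma phi_real g x : g \is Num.real -> x \is Num.real -> phi g x \is Num.real.
Proof.
move=> gr xr; have [_ _ ab abr _] := hadm.
have qr n : q ^+ n \is Num.real by rewrite ger0_real // qX_ge0.
have [ha hb] := admissible_nondeg hadm; have [_ han _] := ha;
  have [_ hbn _] := hb.
apply: clim_real (phi_term_has_csum a b hq g x) => n; apply: rpred_sum => k _.
have upr y m : y \is Num.real -> shifted_pow q y m \is Num.real.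
  by move=> yr; apply: rpred_prod => j _; rewrite realD.
rewrite /phi_term; apply: realM; last exact: upr.
apply: realM; last exact: upr.
rewrite /phi_coef realM // ?realV.
  by rewrite realM // realX // realN gtr0_real.
rewrite -mulrA realM //.
  by apply: rpred_prod => j _; rewrite realB ?real1 // realM // gtr0_real.
rewrite !qfactE -big_split /=; apply: rpred_prod => j _.
rewrite (_ : _ * _ = 1 - (a + b) * q ^+ j + a * b * (q ^+ j * q ^+ j));
  last by ring.
apply: realD; first by apply: realB; [exact: real1|exact: realM].
by apply: realM; [exact: gtr0_real|exact: realM].
Qed.

End Admissible.
End ParamConditions.

(** * Finite stages of the support *)

Section Exhaustion.
Notation I := (nat + int)%type.
Implicit Types (i : I) (N : nat).

(** Each stage adds one point on the negative half and one in each direction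
    on the positive half, so partial sums over the stages are the partial
    sums of the three series; see [sum_exhaust]. *)
Fixpoint exhaust N : seq I :=
  if N is N'.+1 then exhaust N' ++ [:: inl N'; inr (Posz N'); inr (Negz N')]
    else [::].

Definition exhaust_rank i : nat := match i with inl n | inr (Posz n) | inr
  (Negz n) => n end.

Lemma mem_exhaust i N : (i \in exhaust N) = (exhaust_rank i < N)%N.
Proof.
elim: N => [|N IH] //=; rewrite mem_cat IH !inE ltnS [RHS]leq_eqVlt orbC;
  congr (_ || _).
by case: i {IH} => [n|[n|n]] //=; rewrite ?orbF //=.
Qed.

Lemma uniq_exhaust N : uniq (exhaust N).
Proof.
elim: N => //= N IH; rewrite cat_uniq IH /=.
by rewrite !mem_exhaust /= ltnn.
Qed.

Lemma step_exhaust N : exists s, exhaust N.+1 = exhaust N ++ s.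
Proof. by eexists. Qed.

Lemma exhaustP i : exists N, i \in exhaust N.
Proof. by exists (exhaust_rank i).+1; rewrite mem_exhaust. Qed.

Lemma sum_exhaust (V : zmodType) (F : I -> V) N : \sum_(i <- exhaust N) F i =
  \sum_(k < N) F (inl (k : nat)) +
  (\sum_(k < N) F (inr (Posz k)) + \sum_(k < N) F (inr (Negz k))).
Proof.
elim: N => [|N IH]; first by rewrite !big_ord0 big_nil !addr0.
rewrite big_cat IH !big_ord_recr /= !big_cons big_nil addr0.
by rewrite addrACA; congr (_ + _); rewrite addrACA.
Qed.

Variable R : realType.
Notation C := R[i].
Implicit Types (F : I -> C) (l : C).

Lemma has_isum_clim F l : has_isum F l -> (fun N => \sum_(i <- exhaust N) F i)
  ~> l.
Proof.
move=> [l1 [l2 [h1 [l3 [l4 [h3 h4 ->]]] ->]]].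
by apply: clim_eq (climD h1 (climD h3 h4)) => N; rewrite sum_exhaust.
Qed.

Lemma has_isum_pcvg F l : has_isum F l ->
  pcvg exhaust (fun i => complex.Re (F i)) (complex.Re l).
Proof.
move=> /has_isum_clim /clim_Re h;
  rewrite /pcvg (_ : psum _ _ = fun N => complex.Re (\sum_(i <- exhaust N) F i))
    //.
by apply/funext => N; rewrite Re_sum.
Qed.

Lemma exhaust_bounded_isummable F B : (forall i, 0 <= F i) ->
  (forall N, \sum_(i <- exhaust N) F i <= B) -> abs_isummable F /\ isum F <= B.
Proof.
move=> F0 hB.
have hb : abs_isummable F.
  have nn (f : nat -> I) N : 0 <= \sum_(k < N) F (f k) by apply: sumr_ge0.
  have nrmE (f : nat -> I) N : \sum_(k < N) `|F (f k)| = \sum_(k < N) F (f k).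
    by apply: eq_bigr => k _; rewrite ger0_norm.
  split; [|split]; exists B => N; apply: le_trans (hB N); rewrite sum_exhaust;
    have a0 := nn inl N; have b0 := nn (fun k => inr (Posz k)) N;
    have c0 := nn (fun k => inr (Negz k)) N.
  - by rewrite (nrmE inl) lerDl addr_ge0.
  - by rewrite (nrmE (fun k => inr (Posz k))) addrCA lerDl addr_ge0.
  - by rewrite (nrmE (fun k => inr (Negz k))) addrA lerDr addr_ge0.
split=> //; have h := has_isum_clim (abs_isummable_has_isum hb).
have l0 : 0 <= isum F by apply: clim_ge0 h => N; apply: sumr_ge0.
rewrite -(ger0_norm l0); apply: (clim_norm_le h) => N.
by rewrite ger0_norm // sumr_ge0.
Qed.

End Exhaustion.

(** * Values of the norms *)

Section Norms.
Variable R : realType.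
Notation C := R[i].
Notation I := (nat + int)%type.
Implicit Types (q a b t s : C) (i j g l : I).

Lemma ReM_real (x y : C) : x \is Num.real -> complex.Re (x * y) = complex.Re x *
  complex.Re y.
Proof.
case: x => x1 x2; rewrite complex_real => /eqP ->; case: y => y1 y2 /=.
by rewrite mul0r subr0.
Qed.

Lemma Re_gt0 (x : C) : 0 < x -> 0 < complex.Re x.
Proof. by case: x => x1 x2; rewrite ltcE => /andP[]. Qed.

Lemma node_inj q t i j : 0 < q < 1 -> 0 < t -> node q t i = node q t j -> i = j.
Proof.
move=> hq t0; have q0 := q_gt0 hq; have qn0 := lt0r_neq0 q0.
have q1 : q < 1 by case/andP: hq.
have tn0 := lt0r_neq0 t0.
have pn n k : - q ^+ n != t * q ^ k.
  apply/eqP => h; have : 0 < - q ^+ n by rewrite h mulr_gt0 // qz_gt0.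
  by rewrite oppr_gt0 => /(lt_trans (qX_gt0 hq n)); rewrite ltxx.
have qinj n m : (n < m)%N -> q ^+ n != q ^+ m.
  move=> nm; rewrite -(subnKC nm) addSnnS exprD.
  rewrite -subr_eq0 -{1}[q ^+ n]mulr1 -mulrBr mulf_neq0 ?expf_neq0 //.
  by rewrite subr_eq0 eq_sym lt_eqF // qX_lt1.
have qinj' n m : q ^+ n = q ^+ m -> n = m.
  by case: (ltngtP n m) => // h e; have := qinj _ _ h; rewrite e eqxx.
case: i => [n|k]; case: j => [m|k'] //=.
- by move=> /oppr_inj /qinj' ->.
- by move=> h; have := pn n k'; rewrite h eqxx.
- by move=> h; have := pn m k; rewrite h eqxx.
move=> /(mulfI tn0) h; congr inr.
have : q ^ (k - k') = 1 by rewrite expfzDr // h -expfzDr // subrr expr0z.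
have e : k = k' + (k - k') by rewrite addrC subrK.
move: (k - k') e => d -> {h}; case: d => n.
  by rewrite -exprnP -(expr0 q) => /qinj' ->; rewrite addr0.
rewrite NegzE -exprnN => /(congr1 (fun z => z^-1));
  rewrite invrK invr1 -(expr0 q).
by move=> /qinj'.
Qed.

Lemma dual_rel q a b t : admissible q a b t -> a * b * t * (a * b * t)^-1 = 1.
Proof.
by move=> [_ t0 ab _ _]; rewrite mulfV // mulf_neq0 // lt0r_neq0.
Qed.

Section Pair.
Variables q a b t s : C.
Hypothesis ht : admissible q a b t.
Hypothesis hs : admissible q a b s.
Hypothesis hts : a * b * t * s = 1.
Let hq : 0 < q < 1. Proof. by case: ht. Qed.
Let t0 : 0 < t. Proof. by case: ht. Qed.
Let s0 : 0 < s. Proof. by case: hs. Qed.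
Let ha : nondeg q t a. Proof. by case: (admissible_nondeg ht). Qed.
Let hb : nondeg q t b. Proof. by case: (admissible_nondeg ht). Qed.
Let qn0 : q != 0. Proof. exact: lt0r_neq0 (q_gt0 hq). Qed.
Local Notation phi := (phi q a b).

(** All values involved are real; the kernel is made real-valued because the
    results on kernels rest on the order of the reals. *)
Definition phi_re g x := complex.Re (phi (node q s g) (node q t x)).
Definition wgt_re x := complex.Re (node_wgt q a b t x).
Definition sqnorm_re g := complex.Re (sqnorm q a b t (node q s g)).

Lemma tame_dual g : tame q a b t (node q s g).
Proof. exact: (tame_node hq t0 ha hb g s0 hts). Qed.

Lemma phi_node_real g x : phi (node q s g) (node q t x) \is Num.real.
Proof. by apply: (phi_real ht); [exact: node_real hs g|exact: node_real ht x].
  Qed.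

Lemma rows_has_isum g l : has_isum (fun x => phi (node q s g) (node q t x) * phi
  (node q s l) (node q t x) * node_wgt q a b t x)
  ((g == l)%:R * sqnorm q a b t (node q s g)).
Proof.
case: eqP => [->|gl]; first by rewrite mul1r;
  exact: (sqnorm_has_isum hq t0 ha hb (tame_dual l)).
rewrite mul0r; apply: (phi_orthogonal hq t0 ha hb (tame_dual g) (tame_dual l)).
by apply/eqP => /(node_inj hq s0).
Qed.

Lemma rows_pcvg g l : pcvg exhaust (fun x => phi_re g x * phi_re l x * wgt_re x)
  ((g == l)%:R * sqnorm_re g).
Proof.
have := has_isum_pcvg (rows_has_isum g l).
have -> : complex.Re ((g == l)%:R * sqnorm q a b t (node q s g)) = (g == l)%:R *
  sqnorm_re g.
  by rewrite ReM_real ?realn //; case: eqP.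
congr (pcvg _ _ _); apply/funext => x.
have hg := phi_node_real g x; have hl := phi_node_real l x.
by rewrite (ReM_real _ (realM hg hl)) (ReM_real _ hg).
Qed.

Lemma sqnorm_real g : sqnorm q a b t (node q s g) \is Num.real.
Proof.
apply: clim_real (has_isum_clim (sqnorm_has_isum hq t0 ha hb (tame_dual g))) =>
  N.
apply: rpred_sum => x _; apply: realM;
  last exact: gtr0_real (node_wgt_gt0 ht x).
by apply: realM; exact: phi_node_real.
Qed.

(** [sqnorm_step] along the chain [- q^n]; the factor [q] there is the ratio
    of consecutive absolute values. *)
Lemma chain_neg n : node_wgt q a b s (inl n) * sqnorm q a b t (node q s (inl n)) =
  node_wgt q a b s (inl 0%N) * sqnorm q a b t (node q s (inl 0%N)).
Proof.
elim: n => [|n IH]; first reflexivity.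
apply: etrans IH.
have qe m : - q ^+ m.+1 = q * - q ^+ m by rewrite exprS mulrN.
have := @sqnorm_step _ q a b hq t t0 ha hb (- q ^+ n).
rewrite -!qe => /(_ (node_neq0 hs (inl n))) h.
have {}h := h (nondeg_neg1 n ha) (nondeg_neg1 n hb) (tame_dual (inl n))
  (tame_dual (inl n.+1)) (tame_dual (inl n.+2)).
(* The point [-1] has no predecessor on the chain, but there the coefficient
   [1 + g] vanishes. *)
have hh : 1 + - q ^+ n = 0 \/ tame q a b t (- q ^+ n / q).
  case: n {h} => [|n]; first by left; rewrite expr0 subrr.
  by right; rewrite qe mulrAC mulfV // mul1r; exact: tame_dual (inl n).
have {}h := h hh.
rewrite /node_wgt /= exprS.
rewrite (_ : _ * sqnorm q a b t (- (q * q ^+ n)) = q ^+ n *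
  (q * wgt q a b (- (q * q ^+ n)) * sqnorm q a b t (- (q * q ^+ n))));
    last by ring.
by rewrite -exprS h; ring.
Qed.

Lemma chain_pos k : node_wgt q a b s (inr k) * sqnorm q a b t (node q s (inr k)) =
  node_wgt q a b s (inr 0) * sqnorm q a b t (node q s (inr 0)).
Proof.
rewrite -[RHS]mul1r -(exp1rz _ k).
apply: (@int_geom C (fun k => node_wgt q a b s (inr k) * sqnorm q a b t
  (node q s (inr k))) 1) => [|{}k].
  exact: oner_neq0.
have qe k' : s * q ^ (k' + 1) = q * (s * q ^ k') by rewrite expfzS //; ring.
have [na nb] := dual_nondeg hq t0 ha hb hts k.
have h := @sqnorm_step _ q a b hq t t0 ha hb (s * q ^ k) (node_neq0 hs (inr k))
  na nb (tame_dual (inr k)).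
rewrite -!qe in h.
have {}h := h (tame_dual (inr (k + 1))) (tame_dual (inr (k + 1 + 1))).
have hh : 1 + s * q ^ k = 0 \/ tame q a b t (s * q ^ k / q).
  right; rewrite (_ : s * q ^ k / q = s * q ^ (k - 1));
    first exact: tame_dual (inr (k - 1)).
  by rewrite -{1}(subrK 1 k) expfzS // -mulrA mulfK.
have {}h := h hh.
rewrite /node_wgt /= mul1r [X in _ * X * _]qe.
rewrite (_ : _ * sqnorm q a b t _ = s * q ^ k *
  (q * wgt q a b (s * q ^ (k + 1)) * sqnorm q a b t (s * q ^ (k + 1))));
    last by ring.
by rewrite h; ring.
Qed.

Lemma sqnorm_m1 : sqnorm q a b t (-1) = mass q t a b.
Proof.
rewrite /sqnorm /isum /mass /mass_neg /mass_pos; congr (csum _ + zsum _);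
  apply/funext => k.
  by rewrite phiC phi_m1 // /= !mul1r.
by rewrite phiC phi_m1 // /= !mul1r.
Qed.

End Pair.

Section Values.
Variables q a b t s : C.
Hypothesis ht : admissible q a b t.
Hypothesis hs : admissible q a b s.
Hypothesis hts : a * b * t * s = 1.
Let hq : 0 < q < 1. Proof. by case: ht. Qed.
Let t0 : 0 < t. Proof. by case: ht. Qed.
Let s0 : 0 < s. Proof. by case: hs. Qed.
Let hst : a * b * s * t = 1. Proof. by rewrite mulrAC. Qed.
Local Notation o := (inl 0%N : I).

(** Columns are the rows of the dual kernel, by the symmetry of [phi]. *)
Lemma cols_pcvg x y : pcvg exhaust (fun g => phi_re q a b t s g x * phi_re q a b
  t s g y * wgt_re q a b s g)
  ((x == y)%:R * sqnorm_re q a b s t x).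
Proof.
have := @rows_pcvg q a b s t hs ht hst x y; congr (pcvg _ _ _);
  apply/funext => g.
by rewrite /phi_re ![phi q a b (node q t _) _]phiC.
Qed.

Lemma wgt_re_gt0 x : 0 < wgt_re q a b t x.
Proof. exact: Re_gt0 (node_wgt_gt0 ht x). Qed.

Lemma phi_re_o g : phi_re q a b t s g o = 1.
Proof. by rewrite /phi_re /= expr0 phi_m1. Qed.

Lemma dual_wgt_sqnorm_re g : wgt_re q a b s g * sqnorm_re q a b t s g =
  complex.Re (node_wgt q a b s g * sqnorm q a b t (node q s g)).
Proof. by rewrite /wgt_re /sqnorm_re
  (ReM_real _ (gtr0_real (node_wgt_gt0 hs g))). Qed.

(** [norm_constant] with [o] the point [-1]; its boundedness hypothesis
    holds because only two values occur, one for each chain. *)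
Lemma dual_wgt_sqnorm_re_const g : wgt_re q a b s g * sqnorm_re q a b t s g =
  wgt_re q a b t o * sqnorm_re q a b s t o.
Proof.
pose D i := complex.Re (node_wgt q a b s i * sqnorm q a b t (node q s i)).
apply: (norm_constant uniq_exhaust step_exhaust exhaustP wgt_re_gt0 _
  (rows_pcvg ht hs hts) cols_pcvg
  (M := `|D o| + `|D (inr 0)|) _ (o := o) _).
- by move=> i; apply: Re_gt0; exact: node_wgt_gt0 hs i.
- move=> i; rewrite dual_wgt_sqnorm_re; case: i => [n|k].
    rewrite (chain_neg ht hs hts n) -/(D o); apply: le_trans (ler_norm _) _.
    by rewrite lerDl.
  rewrite (chain_pos ht hs hts k) -/(D (inr 0)); apply: le_trans (ler_norm _) _.
  by rewrite lerDr.
- exact: phi_re_o.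
Qed.

Lemma dual_wgt_sqnorm g : node_wgt q a b s g * sqnorm q a b t (node q s g) = wgt
  q a b (-1) * mass q s a b.
Proof.
have gr : node_wgt q a b s g * sqnorm q a b t (node q s g) \is Num.real.
  by apply: realM;
    [exact: gtr0_real (node_wgt_gt0 hs g)|exact: sqnorm_real ht hs hts g].
have h1 := gtr0_real (node_wgt_gt0 ht o).
have h2 := sqnorm_real hs ht hst o.
have h : complex.Re (node_wgt q a b s g * sqnorm q a b t (node q s g)) =
   complex.Re (node_wgt q a b t o * sqnorm q a b s (node q t o)).
  by rewrite -dual_wgt_sqnorm_re dual_wgt_sqnorm_re_const ReM_real.
rewrite -(RRe_real gr) h (RRe_real (realM h1 h2)) /node_wgt /= expr0 mulr1.
by rewrite sqnorm_m1.
Qed.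

End Values.

Lemma wgt_m1_gt0 q a b t : admissible q a b t -> 0 < wgt q a b (-1).
Proof.
by move=> h; have := node_wgt_gt0 h (inl 0%N); rewrite /node_wgt /= expr0 mulr1.
Qed.

(** Taking [g = -1] in [dual_wgt_sqnorm], its left side is the weight at
    [-1] times the mass for [t]. *)
Lemma mass_dual q a b t s : admissible q a b t -> admissible q a b s ->
  a * b * t * s = 1 ->
  mass q s a b = mass q t a b.
Proof.
move=> ht hs hts; have := dual_wgt_sqnorm ht hs hts (inl 0%N).
rewrite /node_wgt /= expr0 mulr1 sqnorm_m1 => h.
by apply: (mulfI (lt0r_neq0 (wgt_m1_gt0 ht))); rewrite h.
Qed.

End Norms.

(** * The orthogonal basis *)

Section Glue.
Variable R : realType.
Notation C := R[i].
Notation I := (nat + int)%type.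
Implicit Types (q a b t : C) (i j : I).

Lemma weightE a b q (x : C) : weight a b q x = wgt q a b x.
Proof. by rewrite /weight /qpoch_inf !big_cons !big_nil !mulr1. Qed.

Lemma qMeixnerE a b q (g x : C) : g != 0 -> x != 0 -> qMeixner a b q g x = phi q
  a b g x.
Proof.
move=> g0 x0; rewrite /qMeixner /phi22; congr csum; apply/funext => n.
have e : (- (a * b)) ^+ n = (-1) ^+ n * (a ^+ n * b ^+ n).
  by rewrite -[- (a * b)]mulN1r !exprMn.
rewrite /qpoch !big_cons !big_nil !mulr1 -!/(qfact q _ n) /phi_term /phi_coef
  !shifted_pow_qfact // e !exprMn !invfM.
by ring.
Qed.

Definition supp_pt q t i : qsupp q t :=
  match i with inl n => neg_pt q t n | inr k => pos_pt q t k end.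

Lemma val_supp_pt q t i : \val (supp_pt q t i) = node q t i.
Proof. by case: i. Qed.

Lemma qintegral_has_isum q t (F : qsupp q t -> C) (l : C) :
  has_isum (fun i => F (supp_pt q t i) * node_abs q t i) l ->
  qintegrable F /\ qintegral F = (1 - q) * l.
Proof.
move=> [l1 [l2 [h1 h2 ->]]]; split.
  by split; [exact: has_csum_cvg h1|exact: has_zsum_cvg h2].
have e1 : csum (fun k => F (neg_pt q t k) * q ^+ k) = l1 := has_csum_csum h1.
have e2 : zsum (fun k => F (pos_pt q t k) * (t * q ^ k)) = l2 :=
  has_zsum_zsum h2.
by rewrite /qintegral e1 e2 mulrDr.
Qed.

Lemma csum_cvgP (u : nat -> C) : csum_cvg u -> exists l, has_csum u l.
Proof. by move=> /cvg_ex [l h]; exists l; apply/has_csumE. Qed.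

Lemma qintegrable_has_isum q t (F : qsupp q t -> C) : qintegrable F ->
  exists l, has_isum (fun i => F (supp_pt q t i) * node_abs q t i) l.
Proof.
move=> [/csum_cvgP [l1 h1] [/csum_cvgP [l2 h2] /csum_cvgP [l3 h3]]].
by exists (l1 + (l2 + l3)), l1, (l2 + l3); split=> //; exists l2, l3.
Qed.

Section Basis.
Variables q a b t s : C.
Hypothesis ht : admissible q a b t.
Hypothesis hs : admissible q a b s.
Hypothesis hts : a * b * t * s = 1.
Let hq : 0 < q < 1. Proof. by case: ht. Qed.
Let q0 : 0 < q. Proof. exact: q_gt0 hq. Qed.
Let q1 : q < 1. Proof. by case/andP: hq. Qed.
Let t0 : 0 < t. Proof. by case: ht. Qed.
Let s0 : 0 < s. Proof. by case: hs. Qed.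
Let hst : a * b * s * t = 1. Proof. by rewrite mulrAC. Qed.

Lemma qMeixner_node i j : qMeixner a b q (node q s i) (node q t j) = phi q a b
  (node q s i) (node q t j).
Proof. by apply: qMeixnerE; [exact: node_neq0 hs i|exact: node_neq0 ht j]. Qed.

Lemma conj_phi i j : (phi q a b (node q s i) (node q t j))^* = phi q a b
  (node q s i) (node q t j).
Proof. exact: conj_Creal (phi_node_real ht hs i j). Qed.

Definition orth_integrand i j := fun x : qsupp q t =>
  qMeixner a b q (node q s i) (\val x) *
    (qMeixner a b q (node q s j) (\val x))^* * weight a b q (\val x).

Lemma orth_integrand_has_isum i j : has_isum
  (fun k => orth_integrand i j (supp_pt q t k) * node_abs q t k)
  ((i == j)%:R * sqnorm q a b t (node q s i)).
Proof.
apply: has_isum_eq (rows_has_isum ht hs hts i j) => k.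
by rewrite /orth_integrand val_supp_pt !qMeixner_node conj_phi weightE /node_wgt
  mulrA.
Qed.

Lemma sqnorm_value i : (1 - q) * sqnorm q a b t (node q s i) =
  Hconst a b q (node q s i) * Iconst a b q t.
Proof.
have [ha hb] := admissible_nondeg ht.
have h := dual_wgt_sqnorm ht hs hts i;
  rewrite (mass_dual ht hs hts) mass_formula // in h.
have m0 := lt0r_neq0 (node_wgt_gt0 hs i).
apply: (mulfI m0); rewrite mulrCA h.
rewrite /Hconst /Iconst (node_norm hs) /theta /qpoch_inf !big_cons !big_nil
  !mulr1.
rewrite /mass_value /theta1 /node_wgt /wgt.
rewrite -!/(qfact_inf q _).
have j0 := lt0r_neq0 (node_abs_gt0 hs i).
have w0 : wgt q a b (node q s i) != 0.
  by have := m0; rewrite /node_wgt mulf_eq0 negb_or => /andP[].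
move: w0; rewrite /wgt mulf_eq0 invr_eq0 negb_or => /andP[n1 n2].
have -> : - q * -1 = q by ring.
have -> : - a * -1 = a by ring.
have -> : - b * -1 = b by ring.
move: n2; rewrite mulf_eq0 negb_or => /andP[n2 n3].
rewrite !invfM.
set T1 := qfact_inf q (- a * b * t) * _ * _; set X := node q s i.
set U := (qfact_inf q (- a * t))^-1 * _.
have e : qfact_inf q (- q * X) / qfact_inf q (- q * X) = 1 by rewrite mulfV.
have e2 : qfact_inf q (- a * X) / qfact_inf q (- a * X) = 1 by rewrite mulfV.
have e3 : qfact_inf q (- b * X) / qfact_inf q (- b * X) = 1 by rewrite mulfV.
have e4 : node_abs q s i / node_abs q s i = 1 by rewrite mulfV.
set LL := (X in X = _).
transitivity
  (LL * (qfact_inf q (- q * X) / qfact_inf q (- q * X) *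
    (qfact_inf q (- a * X) / qfact_inf q (- a * X)) *
  (qfact_inf q (- b * X) / qfact_inf q (- b * X)) *
    (node_abs q s i / node_abs q s i))).
  by rewrite e e2 e3 e4 !mulr1.
rewrite /LL.
ring.
Qed.

Lemma qintegral_orth_integrand i j : qintegral (orth_integrand i j) =
  (i == j)%:R * (Hconst a b q (node q s i) * Iconst a b q t).
Proof.
by have [_ ->] := qintegral_has_isum (orth_integrand_has_isum i j);
  rewrite mulrCA sqnorm_value.
Qed.

Local Notation mf i := (@qMeixner_fun R a b q t (node q s i)).

Lemma qMeixner_fun_Hspace i : Hspace a b q t (mf i).
Proof.
have [h _] := qintegral_has_isum (orth_integrand_has_isum i i).
move: h; congr qintegrable; apply/funext => x.
by rewrite /orth_integrand -normCK.
Qed.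

Lemma qMeixner_fun_neq0 i : mf i <> (fun=> 0).
Proof.
move=> /(congr1 (fun f => f (supp_pt q t (inl 0%N)))).
rewrite /qMeixner_fun val_supp_pt qMeixner_node /= expr0 phi_m1.
by move/eqP; rewrite oner_eq0.
Qed.

Lemma phi_reE i j : phi q a b (node q s i) (node q t j) =
  ((phi_re q a b t s i j)%:C)%C.
Proof. by rewrite /phi_re RRe_real //; exact: phi_node_real ht hs i j. Qed.

Lemma wgt_reE j : node_wgt q a b t j = ((wgt_re q a b t j)%:C)%C.
Proof. by rewrite /wgt_re RRe_real //;
  exact: gtr0_real (node_wgt_gt0 ht j). Qed.

Lemma density_real (f : I -> R) (B : R) :
  (forall N, psum exhaust (fun x => f x ^+ 2 * wgt_re q a b t x) N <= B) ->
  forall e : R, 0 < e -> exists c : I -> R, exists n0, forall n, (n0 <= n)%N ->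
    forall M,
    psum exhaust
      (fun x => (f x - \sum_(g <- exhaust n) c g * phi_re q a b t s g x) ^+ 2 *
        wgt_re q a b t x) M <= e.
Proof.
move=> hB e e0.
have mu0 x := wgt_re_gt0 ht x; have nu0 x := wgt_re_gt0 hs x.
have f0 x : 0 <= f x ^+ 2 * wgt_re q a b t x by rewrite mulr_ge0 ?sqr_ge0 //
  ltW.
have [L hL] : exists L, pcvg exhaust (fun x => f x ^+ 2 * wgt_re q a b t x) L.
  apply/cvg_ex; apply: nondecreasing_is_cvgn.
    by move=> n m; exact: (psum_mono step_exhaust f0).
  by exists B => _ [n _ <-]; exact: hB.
pose kap := wgt_re q a b s (inl 0%N) * sqnorm_re q a b t s (inl 0%N).
have kE g : wgt_re q a b s g * sqnorm_re q a b t s g = kap.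
  exact: etrans (dual_wgt_sqnorm_re_const ht hs hts g)
    (esym (dual_wgt_sqnorm_re_const ht hs hts (inl 0%N))).
have kE' x : wgt_re q a b t x * sqnorm_re q a b s t x = kap.
  exact: (dual_wgt_sqnorm_re_const hs ht hst x).
have kap0 : 0 < kap.
  rewrite mulr_gt0 //.
  have p0 x : 0 <= phi_re q a b t s (inl 0%N) x * phi_re q a b t s (inl 0%N) x *
    wgt_re q a b t x.
    by rewrite -expr2 mulr_ge0 ?sqr_ge0 // ltW.
  have hrow : pcvg exhaust (fun x => phi_re q a b t s (inl 0%N) x * phi_re q a b
    t s (inl 0%N) x * wgt_re q a b t x)
     (sqnorm_re q a b t s (inl 0%N)).
    by have := @rows_pcvg R q a b t s ht hs hts (inl 0%N) (inl 0%N);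
      rewrite eqxx mul1r.
  apply: lt_le_trans (psum_le_lim step_exhaust 1 p0 hrow).
  rewrite /psum /= big_cons ltr_pwDl //; last by apply: sumr_ge0.
  by rewrite phi_re_o !mul1r.
have [c [n0 h]] := density uniq_exhaust step_exhaust mu0
  (@rows_pcvg R q a b t s ht hs hts)
  (@cols_pcvg R q a b t s ht hs hts) kap0 kE kE' hL e0.
by exists c, n0.
Qed.

Lemma Re_sq_add (z : C) : `|z| ^+ 2 =
  ((complex.Re z ^+ 2 + complex.Im z ^+ 2)%:C)%C.
Proof. by rewrite -add_Re2_Im2. Qed.

(** Since the kernel is real, real and imaginary parts of [f] can be
    approximated separately, with the two coefficient families combined into
    complex coefficients. *)
Lemma density_complex (f : qsupp q t -> C) : Hspace a b q t f -> forall e : C,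
  0 < e ->
  exists (n : nat) (c : 'I_n -> C) (g : 'I_n -> qsupp q t -> C),
    (forall m : 'I_n, exists k, g m = mf k) /\
    Hnorm a b q t (fun x => f x - \sum_(i < n) c i * g i x) < e.
Proof.
move=> hf e /posCP [r r0 ->].
have [l hl] := qintegrable_has_isum hf.
have [B B0 hB] := clim_bounded (has_isum_clim hl).
pose fR i := complex.Re (f (supp_pt q t i));
  pose fI i := complex.Im (f (supp_pt q t i)).
have termE i : `|f (supp_pt q t i)| ^+ 2 * weight a b q (\val (supp_pt q t i)) *
  node_abs q t i =
    (((fR i ^+ 2 + fI i ^+ 2) * wgt_re q a b t i)%:C)%C.
  by rewrite val_supp_pt weightE -mulrA -/(node_wgt q a b t i) wgt_reE Re_sq_add
    -rmorphM.
have mu0 x := wgt_re_gt0 ht x.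
have hB2 N : psum exhaust (fun i => (fR i ^+ 2 + fI i ^+ 2) * wgt_re q a b t i)
  N <= complex.Re B.
  have := hB N; under eq_bigr do rewrite termE.
  rewrite -rmorph_sum /= => h.
  have : `|((psum exhaust (fun i => (fR i ^+ 2 + fI i ^+ 2) * wgt_re q a b t i)
    N)%:C)%C| <= B by exact: h.
  rewrite ger0_norm; last first.
    by rewrite ler0c; apply: sumr_ge0 => i _;
      rewrite mulr_ge0 ?addr_ge0 ?sqr_ge0 // ltW.
  by rewrite lecE => /andP[].
have hBR N : psum exhaust (fun i => fR i ^+ 2 * wgt_re q a b t i) N <=
  complex.Re B.
  apply: le_trans (hB2 N); apply: ler_sum => i _.
  by rewrite ler_wpM2r ?(ltW (mu0 i)) // lerDl sqr_ge0.
have hBI N : psum exhaust (fun i => fI i ^+ 2 * wgt_re q a b t i) N <=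
  complex.Re B.
  apply: le_trans (hB2 N); apply: ler_sum => i _.
  by rewrite ler_wpM2r ?(ltW (mu0 i)) // lerDr sqr_ge0.
have e0 : 0 < r ^+ 2 / 4 by rewrite divr_gt0 // exprn_gt0.
have [c1 [n1 h1]] := density_real hBR e0;
  have [c2 [n2 h2]] := density_real hBI e0.
pose n := maxn n1 n2; pose m := size (exhaust n).
pose idx (k : 'I_m) := nth (inl 0%N) (exhaust n) k.
exists m, (fun k => (c1 (idx k) +i* c2 (idx k))%C), (fun k => mf (idx k));
  split.
  by move=> k; exists (idx k).
set F := fun x : qsupp q t => _.
pose AR x := fR x - \sum_(g <- exhaust n) c1 g * phi_re q a b t s g x.
pose AI x := fI x - \sum_(g <- exhaust n) c2 g * phi_re q a b t s g x.
have FE i : F (supp_pt q t i) = (AR i +i* AI i)%C.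
  rewrite /F.
  have -> : \sum_(k < m) (c1 (idx k) +i* c2 (idx k))%C * qMeixner_fun a b q t
    (node q s (idx k)) (supp_pt q t i) =
      \sum_(g <- exhaust n) (c1 g +i* c2 g)%C * phi q a b (node q s g)
        (node q t i).
    rewrite [RHS](big_nth (inl 0%N)) big_mkord; apply: eq_bigr => k _.
    by rewrite /qMeixner_fun val_supp_pt qMeixner_node.
  have -> : \sum_(g <- exhaust n) (c1 g +i* c2 g)%C * phi q a b (node q s g)
    (node q t i) =
     ((\sum_(g <- exhaust n) c1 g * phi_re q a b t s g i) +i*
       (\sum_(g <- exhaust n) c2 g * phi_re q a b t s g i))%C.
    elim: (exhaust n) => [|g S IH]; first by rewrite !big_nil.
    rewrite !big_cons IH phi_reE; simpc.
    by [].
  by rewrite /AR /AI /fR /fI; case: (f _) => x y.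
have Fn i : F (supp_pt q t i) * (F (supp_pt q t i))^* * weight a b q
  (\val (supp_pt q t i)) * node_abs q t i =
    (((AR i ^+ 2 + AI i ^+ 2) * wgt_re q a b t i)%:C)%C.
  by rewrite -normCK val_supp_pt weightE -mulrA -/(node_wgt q a b t i) wgt_reE
    Re_sq_add FE -rmorphM.
have [||hs1 hs2] := @exhaust_bounded_isummable R
  (fun i => (((AR i ^+ 2 + AI i ^+ 2) * wgt_re q a b t i)%:C)%C)
   ((r ^+ 2 / 2)%:C)%C.
- by move=> i; rewrite ler0c mulr_ge0 ?addr_ge0 ?sqr_ge0 // ltW.
- move=> N; rewrite -rmorph_sum lecR.
  have := h1 n (leq_maxl _ _) N; have := h2 n (leq_maxr _ _) N.
  rewrite -/(psum _ _ _) /psum.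
  under [X in _ -> _ -> X <= _]eq_bigr do rewrite mulrDl.
  rewrite big_split /= /AR /AI; lra.
have [_ hI] := qintegral_has_isum (F := fun x => F x * (F x)^* * weight a b q
  (\val x))
  (has_isum_eq (fun i => esym (Fn i)) (abs_isummable_has_isum hs1)).
rewrite /Hnorm /Hinner hI.
set J := isum _ in hs2 *.
have J0 : 0 <= J.
  apply: clim_ge0 (has_isum_clim (abs_isummable_has_isum hs1)) => N;
    apply: sumr_ge0 => i _.
  by rewrite ler0c mulr_ge0 ?addr_ge0 ?sqr_ge0 // ltW.
have r0' : 0 < ((r)%:C)%C :> C by rewrite ltcR.
rewrite -[ltRHS](sqrCK (ltW r0')) ltr_sqrtC ?nnegrE ?mulr_ge0 ?subr_ge0
  ?exprn_ge0 ?(ltW q1) ?(ltW r0') //.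
apply: (@le_lt_trans _ _ J); first by rewrite ler_piMl // lerBlDr lerDl ltW.
apply: le_lt_trans hs2 _; rewrite -rmorphXn /= ltcR.
by have : 0 < r ^+ 2 by [rewrite exprn_gt0]; lra.
Qed.

End Basis.
End Glue.

Theorem corollary3p2 (R : realType) (a b q t : R[i])
    (hq : 0 < q < 1) (hpar : parameters a b q t) :
  let Gamma : set R[i] := [set - q ^+ k | k in [set: nat]] `|`
               [set q ^ k / (a * b * t) | k in [set: int]] in
  orthogonal_basis a b q t [set qMeixner_fun a b q t gamma | gamma in Gamma] /\
  forall gamma lambda : R[i], Gamma gamma -> Gamma lambda ->
    qintegral (fun x : qsupp q t =>
      qMeixner a b q gamma (\val x) * (qMeixner a b q lambda (\val x))^*
      * weight a b q (\val x)) =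
    (gamma == lambda)%:R * Hconst a b q gamma * Iconst a b q t.
Proof.
move=> Gamma.
have ht := parameters_admissible hq hpar; have hs := admissible_dual ht.
have hts := dual_rel ht; set s := (a * b * t)^-1 in hs hts.
have s0 : 0 < s by case: hs.
have GP g : Gamma g -> exists i, g = node q s i.
  by case=> [[k _ <-]|[k _ <-]]; [exists (inl k)|exists (inr k); rewrite mulrC].
have GI i : Gamma (node q s i).
  by case: i => k; [left; exists k|right; exists k => //=; rewrite mulrC].
have main g l : Gamma g -> Gamma l -> qintegral (fun x : qsupp q t =>
      qMeixner a b q g (\val x) * (qMeixner a b q l (\val x))^* * weight a b q
        (\val x)) =
    (g == l)%:R * Hconst a b q g * Iconst a b q t.
  move=> /GP[i ->] /GP[j ->]; rewrite -mulrA.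
  have -> : (node q s i == node q s j) = (i == j).
    by apply/eqP/eqP => [/(node_inj hq s0)|->].
  exact: (qintegral_orth_integrand ht hs hts i j).
split=> //; split.
- by move=> _ [g /GP[i ->] <-]; exact: (qMeixner_fun_Hspace ht hs hts i).
- by move=> [g /GP[i ->]]; exact: (qMeixner_fun_neq0 ht).
- move=> _ _ [g Gg <-] [l Gl <-] gl.
  apply: etrans (main _ _ Gg Gl) _; case: eqP => [e|_]; last by rewrite !mul0r.
  by case: gl; rewrite e.
- move=> f hf e e0.
  have [n [c [g [hg hn]]]] := density_complex ht hs hts hf e0.
  exists n, c, g; split=> // i; have [k ->] := hg i.
  by exists (node q s k).
Qed.
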